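(* Let $d \ge 2$ and let $\Lambda_d$ be the largest constant such that $$\int_{S^{d-1}} f\,\Gamma_2(\log f,\log f)\, d\sigma \;\ge\; \Lambda_d \int_{S^{d-1}} f\,|\nabla_\sigma \log f|^2\, d\sigma$$ holds for every (smooth) function $f:S^{d-1}\to\mathbb{R}_{>0}$ that is symmetric, i.e. $f(\sigma)=f(-\sigma)$ for every $\sigma\in S^{d-1}$. Then $$\Lambda_d \;\ge\; d+3-\frac{1}{d-1}.$$ In particular, $\Lambda_2\ge 4$ and $\Lambda_3\ge 5.5$.
   Context: $S^{d-1}\subset\mathbb{R}^d$ is the unit sphere with its round metric; $d\sigma$ is the surface measure normalized so that $\int_{S^{d-1}}d\sigma=1$; $\nabla_\sigma$ is the spherical (Riemannian) gradient and $\nabla_\sigma^2$ the Riemannian Hessian on $S^{d-1}$, with $\|\cdot\|$ the Hilbert–Schmidt norm. For a function $g$ on $S^{d-1}$, $$\Gamma_2(g,g)=\|\nabla_\sigma^2 g\|^2+(d-2)|\nabla_\sigma g|^2.$$ *)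

(* Defs.v *)
From HB Require Import structures.
From mathcomp Require Import all_boot all_order all_algebra.
From mathcomp Require Import all_classical all_reals all_analysis.
From mathcomp Require Import measurable_realfun.

Set Implicit Arguments.
Unset Strict Implicit.
Unset Printing Implicit Defensive.

Import Order.TTheory GRing.Theory Num.Theory.
Import numFieldNormedType.Exports.

Local Open Scope classical_set_scope.
Local Open Scope ring_scope.

Definition rV_display : measure_display -> measure_display.
Proof. exact. Qed.

(* The sigma-algebra on R^n = 'rV[R]_n generated by the coordinates (which is
   the Borel one). *)
Section measurable_rV.
Context {R : realType}.

Definition rV_coord n (i : 'I_n) (x : 'rV[R]_n) : R := x 0 i.

Definition rV_measurable n : set (set 'rV[R]_n) :=
  g_sigma_preimage (@rV_coord n).

Let rV_measurable0 n : @rV_measurable n set0.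
Proof. exact: sigma_algebra0. Qed.

Let rV_measurableC n A : @rV_measurable n A -> @rV_measurable n (~` A).
Proof. exact: sigma_algebraC. Qed.

Let rV_measurable_bigcup n (F : (set 'rV[R]_n)^nat) :
  (forall i, rV_measurable (F i)) -> rV_measurable (\bigcup_i F i).
Proof. exact: sigma_algebra_bigcup. Qed.

HB.instance Definition _ n := @isMeasurable.Build
  (rV_display default_measure_display) 'rV[R]_n
  (@rV_measurable n) (@rV_measurable0 n) (@rV_measurableC n)
  (@rV_measurable_bigcup n).

Lemma measurable_rV_coord n (i : 'I_n) : measurable_fun setT (@rV_coord n i).
Proof.
move=> _ Y mY; rewrite setTI; apply: sub_sigma_algebra => /=.
rewrite -bigcup_seq/=; exists i => /=; first by rewrite mem_index_enum.
by exists Y => //; rewrite setTI.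
Qed.

Lemma measurable_rVP d (T : measurableType d) n (f : T -> 'rV[R]_n) :
  (forall i, measurable_fun setT (rV_coord i \o f)) -> measurable_fun setT f.
Proof.
move=> mf.
have h : g_sigma_preimage (fun i => @rV_coord n i \o f) `<=` measurable.
  apply: smallest_sub; first exact: sigma_algebra_measurable.
  move=> A; rewrite -bigcup_seq/= => -[i _ [B mB <-]].
  exact: mf.
move=> _ A mA; apply: h; rewrite g_sigma_preimage_comp.
by exists A.
Qed.

End measurable_rV.

(* Lebesgue measure on R^n, as the n-fold product of the one on R. *)
Section lebesgue_rV.
Context {R : realType}.

Definition consrV n (p : measurableTypeR R * 'rV[R]_n) : 'rV[R]_n.+1 :=
  row_mx (p.1 : R)%:M p.2.

Definition unconsrV n (x : 'rV[R]_n.+1) : measurableTypeR R * 'rV[R]_n :=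
  (x 0 0, @rsubmx _ _ 1 _ x).

Lemma consrVK n : cancel (@consrV n) (@unconsrV n).
Proof.
move=> [t y]; rewrite /unconsrV /consrV /=; congr pair; last exact: row_mxKr.
rewrite (_ : 0 = @lshift 1 n 0); last exact/val_inj.
by rewrite (@row_mxEl _ _ 1 n) mxE eqxx mulr1n.
Qed.

Lemma measurable_consrV n : measurable_fun setT (@consrV n).
Proof.
apply: measurable_rVP => i; case: (@split_ordP 1 n i) => j ->.
  rewrite (_ : _ \o _ = fst) //; apply/funext => -[t y] /=.
  by rewrite /rV_coord /consrV (@row_mxEl _ _ 1 n) (ord1 j) mxE eqxx mulr1n.
rewrite (_ : _ \o _ = rV_coord j \o snd).
  by apply: measurableT_comp => //; exact: measurable_rV_coord.
by apply/funext => -[t y] /=; rewrite /rV_coord /consrV (@row_mxEr _ _ 1 n).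
Qed.

Lemma measurable_unconsrV n : measurable_fun setT (@unconsrV n).
Proof.
apply/measurable_fun_pair; first exact: measurable_rV_coord.
apply: measurable_rVP => j.
rewrite (_ : _ \o _ = rV_coord (@rshift 1 n j)); last first.
  by apply/funext => x; rewrite /rV_coord /= mxE.
exact: measurable_rV_coord.
Qed.

Section step.
Context n (mu : {sigma_finite_measure set 'rV[R]_n -> \bar R}).

Definition lebesgue_rVS : set 'rV[R]_n.+1 -> \bar R :=
  pushforward (@lebesgue_measure R \x mu)%E (@consrV n).

HB.instance Definition _ := Measure.copy lebesgue_rVS
  (measure_function_pushforward__canonical__measure_function_Measure
     (@lebesgue_measure R \x mu)%E (@measurable_consrV n)).

Let lebesgue_rVS_sigma_finite : sigma_finite setT lebesgue_rVS.
Proof.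
have /sigma_finiteP[F [TF ndF Foo]] := sigma_finiteT (@lebesgue_measure R).
have /sigma_finiteP[G [TG ndG Goo]] := sigma_finiteT mu.
exists (fun k => @unconsrV n @^-1` (F k `*` G k)).
  rewrite -preimage_bigcup (_ : \bigcup_i _ = setT) ?preimage_setT//.
  rewrite -subTset => -[t y] _ /=.
  have [i _ Fi] : (\bigcup_i F i) t by rewrite -TF.
  have [j _ Gj] : (\bigcup_i G i) y by rewrite -TG.
  exists (maxn i j) => //; split.
  - by move: t Fi; exact/subsetPset/ndF/leq_maxl.
  - by move: y Gj; exact/subsetPset/ndG/leq_maxr.
move=> k; have [mF Fk] := Foo k; have [mG Gk] := Goo k; split.
  rewrite -[X in measurable X]setTI; apply: measurable_unconsrV => //.
  exact: measurableX.
rewrite /lebesgue_rVS /pushforward -comp_preimage.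
rewrite (_ : _ \o _ = id); last by apply/funext => p /=; rewrite consrVK.
by rewrite preimage_id product_measure1E// lte_mul_pinfty// ge0_fin_numE.
Qed.

HB.instance Definition _ :=
  @Measure_isSigmaFinite.Build _ _ _ lebesgue_rVS lebesgue_rVS_sigma_finite.

End step.

Fixpoint lebesgue_rV n : {sigma_finite_measure set 'rV[R]_n -> \bar R} :=
  match n with
  | 0 => \d_(0 : 'rV[R]_0)
  | m.+1 => lebesgue_rVS (lebesgue_rV m)
  end.

End lebesgue_rV.

Section sphere.
Context {R : realType}.

(* Hilbert-Schmidt norm; on row vectors it is the Euclidean norm (the norm
   `|x| of the library is the sup norm). *)
Definition hsnorm m n (A : 'M[R]_(m, n)) : R :=
  Num.sqrt (\sum_(i < m) \sum_(j < n) A i j ^+ 2).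

Definition sphere d : set 'rV[R]_d := [set x | hsnorm x = 1].

Definition normalize d (x : 'rV[R]_d) : 'rV[R]_d := (hsnorm x)^-1 *: x.

Definition punctured_ball d : set 'rV[R]_d := [set x | 0 < hsnorm x <= 1].

Lemma measurable_hsnorm d : measurable_fun setT (@hsnorm 1 d).
Proof.
apply: (@measurableT_comp _ _ _ _ _ _ (@Num.sqrt R) _
  (fun x : 'rV[R]_d => \sum_(i < 1) \sum_(j < d) x i j ^+ 2)).
  by apply: continuous_measurable_fun; exact: sqrt_continuous.
apply: measurable_sum => i; apply: measurable_sum => j.
by rewrite (ord1 i); apply: measurable_funX; exact: measurable_rV_coord.
Qed.

Lemma measurable_normalize d : measurable_fun setT (@normalize d).
Proof.
have mV : measurable_fun setT (fun t : R => t^-1).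
  rewrite -(setvU [set (0 : R)]); apply/measurable_funU; rewrite ?setvU.
  - exact: measurableC.
  - exact: measurable_set1.
  - split; last exact: measurable_fun_set1.
    apply: open_continuous_measurable_fun.
      exact/closed_openC/closed_eq.
    by move=> t; rewrite inE /= => /eqP t0; exact: inv_continuous.
apply: measurable_rVP => i.
rewrite (_ : _ \o _ = (fun x => (hsnorm x)^-1) \* rV_coord i); last first.
  by apply/funext => x; rewrite /rV_coord /= mxE.
apply: measurable_funM; last exact: measurable_rV_coord.
exact: (measurableT_comp mV (@measurable_hsnorm d)).
Qed.

Lemma measurable_punctured_ball d : measurable (@punctured_ball d).
Proof.
rewrite (_ : @punctured_ball d = setT `&` @hsnorm 1 d @^-1` `]0, 1]%classic).
  exact: measurable_hsnorm.
by rewrite setTI; apply/seteqP; split => x; rewrite /= in_itv.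
Qed.

(* Normalized surface measure: the mass of A is the share of the volume of the
   unit ball taken by the cone {r y : 0 < r <= 1, y in A}. *)
Definition sphere_measure d (A : set 'rV[R]_d) : \bar R :=
  (((fine (lebesgue_rV d (@punctured_ball d)))^-1)%:E *
   lebesgue_rV d (@normalize d @^-1` A `&` @punctured_ball d))%E.

Let ball_volume_inv_ge0 d :
  0 <= (fine (lebesgue_rV d (@punctured_ball d)))^-1.
Proof. by rewrite invr_ge0 fine_ge0. Qed.

HB.instance Definition _ d := Measure.copy (@sphere_measure d)
  (mscale (NngNum (ball_volume_inv_ge0 d))
    (measure_function_pushforward__canonical__measure_function_Measure
       (mrestr (lebesgue_rV d) (@measurable_punctured_ball d))
       (@measurable_normalize d))).

(* The 0-homogeneous extension to R^d minus the origin of a map given on the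
   sphere. *)
Definition radial d (T : Type) (g : 'rV[R]_d -> T) : 'rV[R]_d -> T :=
  g \o @normalize d.

Definition partial d (i : 'I_d) (F : 'rV[R]_d -> R) : 'rV[R]_d -> R :=
  fun x => 'D_(delta_mx 0 i) F x.

(* C^oo on the sphere: all iterated partial derivatives of the 0-homogeneous
   extension are differentiable away from the origin. *)
Definition smooth_on_sphere d (f : 'rV[R]_d -> R) : Prop :=
  forall (s : seq 'I_d) (x : 'rV[R]_d), x != 0 ->
    differentiable (foldr (@partial d) (radial f) s) x.

(* Row vectors act on the left: v *m tangent_proj x is the orthogonal
   projection of v onto the tangent space at x of the sphere. *)
Definition tangent_proj d (x : 'rV[R]_d) : 'M[R]_d := 1%:M - x^T *m x.

Definition sgrad d (g : 'rV[R]_d -> R) (x : 'rV[R]_d) : 'rV[R]_d :=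
  (\row_i partial i (radial g) x) *m tangent_proj x.

(* The Hessian at x as the endomorphism v |-> nabla_v (grad g) of the tangent
   space, extended by 0 to the normal line; the Levi-Civita connection of the
   sphere is the tangential part of the flat directional derivative
   'D_v F x = v *m 'J F x. *)
Definition shess d (g : 'rV[R]_d -> R) (x : 'rV[R]_d) : 'M[R]_d :=
  tangent_proj x *m 'J (radial (sgrad g)) x *m tangent_proj x.

Definition Gamma2 d (g : 'rV[R]_d -> R) (x : 'rV[R]_d) : R :=
  hsnorm (shess g x) ^+ 2 + (d%:R - 2) * hsnorm (sgrad g x) ^+ 2.

Definition Gamma2_ineq d (L : R) (f : 'rV[R]_d -> R) : Prop :=
  let logf := fun x => ln (f x) in
  (\int[@sphere_measure d]_(x in @sphere d) (f x * Gamma2 logf x)%:E >=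
   L%:E * \int[@sphere_measure d]_(x in @sphere d)
            (f x * hsnorm (sgrad logf x) ^+ 2)%:E)%E.

Definition admissible d : set R :=
  [set L | forall f : 'rV[R]_d -> R,
     smooth_on_sphere f ->
     (forall x, sphere x -> 0 < f x) ->
     (forall x, sphere x -> f (- x) = f x) ->
     Gamma2_ineq L f].

(* The largest admissible constant.  The default 0 is smaller than
   d + 3 - 1/(d - 1) for all d >= 2, so that such a lower bound on Lambda d
   entails that there is a largest admissible constant. *)
Definition Lambda d : R := xget 0 (@admissible d `&` ubound (@admissible d)).

End sphere.

Arguments Lambda : clear implicits.

(* Main.v *)
(* Put u = sqrt f, n = d - 1 and integrate over the sphere.  The claim becomes
     int |Hess u|^2 + |grad u|^2 Lap u / u >= (5 - 1/n) int |grad u|^2,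
   and it follows from three facts:
   - Bochner: int |Hess u|^2 = int (Lap u)^2 - (n - 1) int |grad u|^2;
   - the spectral gap of even functions: int (Lap u)^2 >= 2 d int |grad u|^2;
   - int |Hess u - (Lap u / n) g - c (grad u (x) grad u / u - |grad u|^2 g / (n u))|^2 >= 0
     for c = n / (n - 1) (for n = 1: c = 1), where the term grad u . Hess u . grad u / u
     is removed by integrating by parts the divergence of |grad u|^2 grad u / u.
   Integration by parts rests on int L_ij h = 0 for the rotation fields
   L_ij = x_i d_j - x_j d_i, which is the rotation invariance of the surface measure.
   For the spectral gap, split u by its parity in each coordinate.  If u is odd in
   x_a and x_b, the Wirtinger inequalities int (L_ab u)^2 >= 4 int u^2 and
   int (L_aj u)^2, int (L_bj u)^2 >= int u^2 add up to
   int |grad u|^2 >= (4 + 2 (d - 2)) int u^2.  If u is even in all coordinates, apply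
   this to every L_ij u, using 1/2 sum_ij |grad L_ij u|^2 = |Hess u|^2 + (n - 1) |grad u|^2.
   The supremum defining the optimal constant is finite and attained because a
   nonconstant f has positive and finite Fisher information. *)
From mathcomp Require Import all_boot all_order all_algebra.
From mathcomp Require Import all_classical all_reals all_analysis.
From mathcomp Require Import measurable_realfun ring lra.
Require Import Defs.

Set Implicit Arguments.
Unset Strict Implicit.
Unset Printing Implicit Defensive.

Import Order.TTheory GRing.Theory Num.Theory.
Import numFieldNormedType.Exports.

Local Open Scope classical_set_scope.
Local Open Scope ring_scope.

(** * Measure-preserving maps of R^n and of the sphere *)

Section measure_preserving.
Context {R : realType}.

(** A function on the sphere is handled through its 0-homogeneous extension to R^n minus the origin.
    Here n is the ambient dimension, one more than the n of the overview. Tangential calculus then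
    becomes Euclidean calculus together with two Euler identities, x . grad U = 0 and Hess U x = -
    grad U; no charts occur. The price is the singularity at the origin, which is why smoothness,
    continuity and equality of functions are asserted away from 0 only. The gap 2n is the value of k
    (k + n - 2) at k = 2, the first nonzero even degree of spherical harmonics, but it is reached
    without their theory. For a function with a definite parity in each coordinate, invariance under
    x |-> - x makes the number of odd coordinates even unless the function vanishes. Hence either
    two odd coordinates are available or there are none, and these are the two cases of the
    argument. *)

Definition mpres d (T : measurableType d) (mu : set T -> \bar R) (f : T -> T) :=
  measurable_fun setT f /\ forall A, measurable A -> mu (f @^-1` A) = mu A.

Notation leb := (@lebesgue_measure R).
Notation mR := (measurableTypeR R).

(** Half-open intervals determine the Lebesgue measure, so the image measure has to be compared on
    them only. *)
Lemma mpres_lebesgue (f : mR -> mR) : measurable_fun setT f ->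
  (forall a b : R, a < b -> leb (f @^-1` `]a, b]%classic) = leb `]a, b]%classic) ->
  mpres leb f.
Proof.
move=> mf h; split => // A mA; apply/esym.
rewrite (@lebesgue_measure_unique R (measure_function_pushforward__canonical__measure_function_Measure leb mf)) //.
move=> _ [[a b] _ <-] /=; rewrite /pushforward.
have [ab|ba] := ltP a b; first by rewrite h.
by rewrite set_itv_ge ?bnd_simp -?leNgt// preimage_set0 !measure0.
Qed.

Lemma mpres_translation (t : R) : mpres leb (fun x : mR => x + t : mR).
Proof.
apply: mpres_lebesgue; first exact: measurable_funD.
move=> a b ab.
rewrite (_ : _ @^-1` _ = `]a - t, b - t]%classic); last first.
  by apply/seteqP; split => x /=; rewrite !in_itv/= ltrBlDr lerBrDr.
rewrite !lebesgue_measure_itv/= !lte_fin ltrD2r ab.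
by rewrite -!EFinB; congr EFin; ring.
Qed.

Lemma mpres_opp : mpres leb (fun x : mR => - x : mR).
Proof.
apply: mpres_lebesgue; first exact: oppr_measurable.
move=> a b ab.
rewrite (_ : _ @^-1` _ = `[- b, - a[%classic); last first.
  by apply/seteqP; split => x /=; rewrite !in_itv/= ltrNr lerNl andbC.
rewrite !lebesgue_measure_itv/= !lte_fin ltrN2 ab.
by rewrite -!EFinB; congr EFin; ring.
Qed.

End measure_preserving.

(** * Maps of R^n that change one coordinate *)

Section mpres_lebesgue_rV.
Context {R : realType}.
Notation leb := (@lebesgue_measure R).
Notation mR := (measurableTypeR R).

Definition upd n (j : 'I_n) (x : 'rV[R]_n) (t : R) : 'rV[R]_n :=
  \row_k (if k == j then t else x 0 k).

Lemma measurable_upd n (j : 'I_n) (g : 'rV[R]_n -> R) :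
  measurable_fun setT (g : _ -> mR) -> measurable_fun setT (fun x => upd j x (g x)).
Proof.
move=> mg; apply: measurable_rVP => i.
rewrite (_ : _ \o _ = fun x => if i == j then g x else x 0 i); last first.
  by apply/funext => t; rewrite /rV_coord /= mxE.
by case: eqP => _ //; exact: measurable_rV_coord.
Qed.

(** The product measure integrates the measures of the sections over the first factor, and on each
    such section [g] acts by [h x]. *)
Lemma mpres_prod_fiberl d (T : measurableType d) d' (T' : measurableType d')
    (m1 : {sigma_finite_measure set T -> \bar R})
    (m2 : {sigma_finite_measure set T' -> \bar R}) (g : T * T' -> T * T') (h : T -> T' -> T') :
  measurable_fun setT g -> (forall x y, g (x, y) = (x, h x y)) ->
  (forall x, mpres m2 (h x)) -> mpres (m1 \x m2)%E g.
Proof.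
move=> mg gE hh; split => // A mA.
rewrite /product_measure1; apply: eq_integral => x _ /=.
rewrite (_ : xsection (g @^-1` A) x = h x @^-1` (xsection A x)).
  by apply: (hh x).2; exact: measurable_xsection.
by apply/seteqP; split => y; rewrite /xsection /= !inE /= gE.
Qed.

(** By uniqueness the product measure is also the iterated integral in the other order, whose
    sections are the ones on which [g] acts by [h y]. *)
Lemma mpres_prod_fiberr d (T : measurableType d) d' (T' : measurableType d')
    (m1 : {sigma_finite_measure set T -> \bar R})
    (m2 : {sigma_finite_measure set T' -> \bar R}) (g : T * T' -> T * T') (h : T' -> T -> T) :
  measurable_fun setT g -> (forall x y, g (x, y) = (h y x, y)) ->
  (forall y, mpres m1 (h y)) -> mpres (m1 \x m2)%E g.
Proof.
move=> mg gE hh; split => // A mA.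
have E B : measurable B -> (m1 \x m2)%E B = (m1 \x^ m2)%E B.
  apply: product_measure_unique => X Y mX mY.
  by apply: product_measure2E.
rewrite !E //; last by rewrite -[X in measurable X]setTI; exact: mg.
rewrite /product_measure2; apply: eq_integral => y _ /=.
rewrite (_ : ysection (g @^-1` A) y = h y @^-1` (ysection A y)).
  by apply: (hh y).2; exact: measurable_ysection.
by apply/seteqP; split => x; rewrite /ysection /= !inE /= gE.
Qed.

Lemma mpres_consrV n (f : 'rV[R]_n.+1 -> 'rV[R]_n.+1) (g : mR * 'rV[R]_n -> mR * 'rV[R]_n) :
  measurable_fun setT f -> (forall p, f (consrV p) = consrV (g p)) ->
  mpres (leb \x lebesgue_rV n)%E g -> mpres (lebesgue_rV n.+1) f.
Proof.
move=> mf fg [mg h]; split => // A mA.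
rewrite /= /lebesgue_rVS /pushforward -[RHS]h.
  by congr (_ _); apply/seteqP; split => p /=; rewrite fg.
by rewrite -[X in measurable X]setTI; exact: measurable_consrV.
Qed.

Lemma consrV_upd0 n (t s : R) (y : 'rV[R]_n) : upd 0 (consrV (t, y)) s = consrV (s, y).
Proof.
apply/rowP => i; rewrite mxE /consrV; case: (@split_ordP 1 n i) => j -> /=.
  rewrite !(@row_mxEl _ _ 1 n) (ord1 j) !mxE eqxx mulr1n.
  by [].
rewrite !(@row_mxEr _ _ 1 n).
by [].
Qed.

Lemma consrV_updS n (j : 'I_n) (t s : R) (y : 'rV[R]_n) :
  upd (lift ord0 j) (consrV (t, y)) s = consrV (t, upd j y s).
Proof.
apply/rowP => i; rewrite mxE /consrV; case: (@split_ordP 1 n i) => k -> /=.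
  by rewrite !(@row_mxEl _ _ 1 n) (ord1 k) !mxE.
rewrite !(@row_mxEr _ _ 1 n) mxE.
have -> : (rshift 1 k == lift ord0 j) = (k == j).
  by apply/eqP/eqP => [/(congr1 val)/= [E]|->]; exact/val_inj.
by [].
Qed.

(* Fubini: the coordinate [j] is changed by a map of R that preserves the
   Lebesgue measure once the other coordinates are fixed. *)
Lemma mpres_upd n (j : 'I_n) (g : 'rV[R]_n -> R) :
  measurable_fun setT (g : _ -> mR) -> (forall x, mpres leb (fun t : mR => g (upd j x t) : mR)) ->
  mpres (lebesgue_rV n) (fun x => upd j x (g x)).
Proof.
elim: n j g => [[]//|n IH] j g mg hg.
have mgc : measurable_fun setT (fun p : mR * 'rV[R]_n => g (consrV p) : mR).
  exact: (measurableT_comp mg (@measurable_consrV _ n)).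
have [j0|[j' jE]] : j = 0 \/ exists j' : 'I_n, j = lift ord0 j'.
  by case: (unliftP ord0 j) => [j' ->|->]; [right; exists j'|left].
- subst j; apply: (@mpres_consrV _ _ (fun p => (g (consrV p), p.2))).
  + exact: measurable_upd.
  + by move=> [t y]; rewrite consrV_upd0.
  + apply: (@mpres_prod_fiberr _ _ _ _ _ _ _ (fun y t => g (consrV (t, y)))) => //.
      exact/measurable_fun_pair.
    move=> y; have := hg (consrV (0, y)).
    by under eq_fun do rewrite consrV_upd0.
- subst j; apply: (@mpres_consrV _ _ (fun p => (p.1, upd j' p.2 (g (consrV p))))).
  + exact: measurable_upd.
  + by move=> [t y]; rewrite consrV_updS.
  + apply: (@mpres_prod_fiberl _ _ _ _ _ _ _ (fun t y => upd j' y (g (consrV (t, y))))) => //.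
      apply/measurable_fun_pair; first exact: measurable_fst.
      apply: measurable_rVP => i.
      rewrite (_ : _ \o _ = fun p : mR * 'rV[R]_n => if i == j' then g (consrV p) else p.2 0 i); last first.
        by apply/funext => p; rewrite /rV_coord /= mxE.
      case: eqP => _ //.
      by apply: (measurableT_comp (@measurable_rV_coord _ _ i)).
    move=> t; apply: (IH j' (fun y => g (consrV (t, y)))).
      apply: (measurableT_comp mg); apply: (measurableT_comp (@measurable_consrV _ n)).
      exact: measurable_pair1.
    move=> y; have := hg (consrV (t, y)).
    by under eq_fun do rewrite consrV_updS.
Qed.

End mpres_lebesgue_rV.

(** * Reflections and plane rotations preserve the surface measure *)

Section sphere_symmetries.
Context {R : realType}.
Notation mR := (measurableTypeR R).

Definition flip n (i : 'I_n) (x : 'rV[R]_n) := upd i x (- x 0 i).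

Definition shear n (i j : 'I_n) (t : R) (x : 'rV[R]_n) := upd j x (x 0 j + t * x 0 i).

Definition rot n (i j : 'I_n) (c s : R) (x : 'rV[R]_n) : 'rV[R]_n :=
  \row_k (if k == i then c * x 0 i - s * x 0 j
          else if k == j then s * x 0 i + c * x 0 j else x 0 k).

Lemma mpres_flip n (i : 'I_n) : mpres (lebesgue_rV n) (@flip n i).
Proof.
apply: mpres_upd; first by apply: measurableT_comp; [exact: oppr_measurable|exact: measurable_rV_coord].
move=> x; under eq_fun do rewrite mxE eqxx; exact: mpres_opp.
Qed.

Lemma mpres_shear n (i j : 'I_n) (t : R) : i != j -> mpres (lebesgue_rV n) (shear i j t).
Proof.
move=> ij; apply: mpres_upd.
  apply: measurable_funD; first exact: measurable_rV_coord.
  by apply: measurable_funM => //; exact: measurable_rV_coord.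
move=> x; under eq_fun do rewrite !mxE eqxx (negbTE ij).
exact: mpres_translation.
Qed.

Lemma mpres_comp d (T : measurableType d) (mu : set T -> \bar R) (f g : T -> T) :
  mpres mu f -> mpres mu g -> mpres mu (f \o g).
Proof.
move=> [mf hf] [mg hg]; split; first exact: measurableT_comp.
move=> A mA; rewrite comp_preimage hg ?hf//.
by rewrite -[X in measurable X]setTI; exact: mf.
Qed.

(* A plane rotation is a product of three shears. *)
Lemma mpres_rot n (i j : 'I_n) (c s : R) : i != j -> s != 0 -> c ^+ 2 + s ^+ 2 = 1 ->
  mpres (lebesgue_rV n) (rot i j c s).
Proof.
(* For c = cos t and s = sin t this is - tan (t / 2), the classical parameter of the outer two
   shears; it requires s != 0. *)
move=> ij s0 cs; pose a := (c - 1) / s.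
have ji : j != i by rewrite eq_sym.
rewrite (_ : rot i j c s = shear j i a \o shear i j s \o shear j i a).
  by apply: mpres_comp; [apply: mpres_comp|]; exact: mpres_shear.
apply/funext => x; apply/rowP => k; rewrite /shear /= !mxE !eqxx (negbTE ij) (negbTE ji).
have sa : s * a = c - 1 by rewrite /a; field.
have aa : a + a * c = - s.
  apply: (mulfI s0); transitivity (s * a * (1 + c)); first by ring.
  by rewrite sa; transitivity (c ^+ 2 - 1); [ring|rewrite -cs; ring].
have [ki|ki] := eqVneq k i; last first.
  have [kj|kj] := eqVneq k j; last by [].
  rewrite ?mxE ?eqxx ?(negbTE ij) ?(negbTE ji).
  transitivity (x 0 j + s * x 0 i + (s * a) * x 0 j); last by ring.
  by rewrite sa; ring.
rewrite ?mxE ?eqxx ?(negbTE ij).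
transitivity (x 0 i * (1 + s * a) + (a + a * (1 + s * a)) * x 0 j); last by ring.
by rewrite sa (_ : 1 + (c - 1) = c); [rewrite aa; ring|ring].
Qed.

Definition sqnorm n (x : 'rV[R]_n) : R := \sum_(i < n) x 0 i ^+ 2.

Lemma hsnormE n (x : 'rV[R]_n) : hsnorm x = Num.sqrt (sqnorm x).
Proof. by rewrite /hsnorm big_ord1. Qed.

Lemma sqnorm_ge0 n (x : 'rV[R]_n) : 0 <= sqnorm x.
Proof. by apply: sumr_ge0 => i _; exact: sqr_ge0. Qed.

Lemma sqr_hsnorm n (x : 'rV[R]_n) : hsnorm x ^+ 2 = sqnorm x.
Proof. by rewrite hsnormE sqr_sqrtr// sqnorm_ge0. Qed.

Lemma hsnorm_eq1 n (x : 'rV[R]_n) : (hsnorm x = 1) <-> (sqnorm x = 1).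
Proof.
rewrite -sqr_hsnorm; split => [->|]; first by rewrite expr1n.
move=> /eqP; rewrite sqrf_eq1 => /orP[/eqP//|/eqP E].
by have := sqrtr_ge0 (sqnorm x); rewrite -hsnormE E lerNr oppr0 ler10.
Qed.

Lemma sqnorm_eq0 n (x : 'rV[R]_n) : (sqnorm x == 0) = (x == 0).
Proof.
apply/eqP/eqP => [|->]; last by rewrite /sqnorm big1// => i _; rewrite mxE expr0n.
move=> /eqP; rewrite psumr_eq0; last by move=> i _; exact: sqr_ge0.
move=> /allP h; apply/rowP => i; rewrite mxE; apply/eqP.
by have := h i (mem_index_enum _); rewrite /= sqrf_eq0.
Qed.

Lemma hsnorm_gt0 n (x : 'rV[R]_n) : (0 < hsnorm x) = (x != 0).
Proof. by rewrite hsnormE sqrtr_gt0 lt_def sqnorm_ge0 sqnorm_eq0 andbT. Qed.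

Lemma hsnormZ n (c : R) (x : 'rV[R]_n) : hsnorm (c *: x) = `|c| * hsnorm x.
Proof.
rewrite !hsnormE /sqnorm; under eq_bigr do rewrite mxE exprMn.
by rewrite -mulr_sumr sqrtrM ?sqr_ge0// sqrtr_sqr.
Qed.

Lemma sqnorm_flip n (i : 'I_n) (x : 'rV[R]_n) : sqnorm (flip i x) = sqnorm x.
Proof.
apply: eq_bigr => k _; rewrite mxE; case: eqP => [->|//]; by rewrite sqrrN.
Qed.

Lemma sqnorm_rot n (i j : 'I_n) c s (x : 'rV[R]_n) : i != j -> c ^+ 2 + s ^+ 2 = 1 ->
  sqnorm (rot i j c s x) = sqnorm x.
Proof.
move=> ij cs; have ji : j != i by rewrite eq_sym.
rewrite /sqnorm (bigD1 i)//= (bigD1 j)//= [RHS](bigD1 i)//= [X in _ = _ + X](bigD1 j)//=.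
rewrite !mxE !eqxx (negbTE ji) !addrA; congr (_ + _).
  transitivity ((c ^+ 2 + s ^+ 2) * (x 0 i ^+ 2 + x 0 j ^+ 2)); first by ring.
  by rewrite cs mul1r.
by apply: eq_bigr => k /andP[ki kj]; rewrite mxE (negbTE ki) (negbTE kj).
Qed.

Lemma flipZ n (i : 'I_n) (a : R) x : flip i (a *: x) = a *: flip i x.
Proof. by apply/rowP => k; rewrite !mxE; case: eqP => // _; rewrite mulrN. Qed.

Lemma rotZ n (i j : 'I_n) c s (a : R) x : rot i j c s (a *: x) = a *: rot i j c s x.
Proof.
by apply/rowP => k; rewrite !mxE; case: eqP => [_|_]; [ring|case: eqP => // _; ring].
Qed.

Lemma flipK n (i : 'I_n) : involutive (@flip n i).
Proof. by move=> x; apply/rowP => k; rewrite !mxE eqxx; case: eqP => [->|//]; rewrite opprK. Qed.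

Lemma normalize_isometry n (T : 'rV[R]_n -> 'rV[R]_n) x :
  (forall x, sqnorm (T x) = sqnorm x) -> (forall a x, T (a *: x) = a *: T x) ->
  normalize (T x) = T (normalize x).
Proof. by move=> h1 h2; rewrite /normalize h2 !hsnormE h1. Qed.

(** The surface measure of A is proportional to the volume of the cone over A in the punctured ball.
    A homogeneous map that preserves the norm commutes with [normalize] and preserves the ball,
    hence maps cones to cones. *)
Lemma mpres_sphere n (T : 'rV[R]_n -> 'rV[R]_n) :
  mpres (lebesgue_rV n) T -> (forall x, sqnorm (T x) = sqnorm x) ->
  (forall a x, T (a *: x) = a *: T x) -> mpres (@sphere_measure R n) T.
Proof.
move=> [mT hT] h1 h2; split => // A mA; rewrite /sphere_measure; congr (_ * _)%E.
rewrite -[RHS]hT; last first.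
  apply: measurableI; last exact: measurable_punctured_ball.
  by rewrite -[X in measurable X]setTI; exact: measurable_normalize.
congr (_ _); apply/seteqP; split => x /=;
  by rewrite normalize_isometry// /punctured_ball/= !hsnormE h1.
Qed.

Lemma mpres_sphere_flip n (i : 'I_n) : mpres (@sphere_measure R n) (@flip n i).
Proof. by apply: mpres_sphere; [exact: mpres_flip|exact: sqnorm_flip|exact: flipZ]. Qed.

Lemma mpres_sphere_rot n (i j : 'I_n) (c s : R) : i != j -> s != 0 -> c ^+ 2 + s ^+ 2 = 1 ->
  mpres (@sphere_measure R n) (rot i j c s).
Proof.
move=> ij s0 cs; apply: mpres_sphere; first exact: mpres_rot.
  by move=> x; exact: sqnorm_rot.
by move=> a x; exact: rotZ.
Qed.

Lemma sphere_measure_le1 n (A : set 'rV[R]_n) : measurable A -> (sphere_measure A <= 1)%E.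
Proof.
move=> mA; rewrite /sphere_measure.
set V := lebesgue_rV n _; set W := lebesgue_rV n _.
have WV : (W <= V)%E.
  apply: le_measure; rewrite ?inE//; last exact: measurable_punctured_ball.
  apply: measurableI; last exact: measurable_punctured_ball.
  by rewrite -[X in measurable X]setTI; exact: measurable_normalize.
have W0 : (0 <= W)%E by exact: measure_ge0.
(* If V is infinite or 0, the conventions for [fine] and for the inverse make the normalizing factor
   0, and the bound is trivial. *)
move: WV W0; case: V => [v||] /=; rewrite ?invr0 ?mul0e ?lee01//.
case: W => [w||] //=; rewrite !lee_fin => wv w0.
have [->|v0] := eqVneq v 0; first by rewrite invr0 mul0r ler01.
by rewrite mulrC ler_pdivrMr ?mul1r// lt_def v0 (le_trans w0 wv).
Qed.

End sphere_symmetries.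

(** * Integration on the sphere *)

Section sphere_integral.
Context {R : realType} {n : nat}.
Notation mR := (measurableTypeR R).
Notation rV := 'rV[R]_n.

(** The sigma-algebra is generated by the coordinates, so it contains boxes; an open set is the
    union of the countably many boxes inside it with rational centre and half-side 1 / (k + 1). *)
Lemma open_measurable_rV (U : set rV) : open U -> measurable U.
Proof.
move=> oU.
pose box (p : 'rV[rat]_n * nat) : set rV :=
  [set x | forall i, `|x 0 i - ratr (p.1 0 i)| < p.2.+1%:R^-1].
have mbox p : measurable (box p).
  rewrite (_ : box p = \bigcap_(i in [set: 'I_n])
     ((fun x : rV => x 0 i) @^-1` (ball (ratr (p.1 0 i) : R) p.2.+1%:R^-1))); last first.
    apply/seteqP; split => x /= h i; first by move=> _; rewrite /ball/= distrC; exact: h.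
    by have := h i Logic.I; rewrite /ball/= distrC.
  apply: fin_bigcap_measurable; first exact: finite_finset.
  move=> i _; rewrite -[X in measurable X]setTI.
  by apply: (@measurable_rV_coord R n i) => //; exact: measurable_ball.
pose bx (p : 'rV[rat]_n * nat) := if `[< box p `<=` U >] then box p else set0.
rewrite (_ : U = \bigcup_p bx p).
  apply: countable_bigcupT_measurable; first exact: countableP.
  by move=> p; rewrite /bx; case: asboolP => _; [exact: mbox|exact: measurable0].
apply/seteqP; split => [x Ux|x [p _]]; last first.
  by rewrite /bx; case: asboolP => // h /h.
have /nbhs_ballP[e /= e0 eU] : nbhs x U by exact: open_nbhs_nbhs.
have [k ke] : exists k : nat, k.+1%:R^-1 < e / 2.
  exists (Num.truncn (e / 2)^-1).
  by rewrite invf_plt ?posrE ?divr_gt0// truncnS_gt.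
have /choice[q hq] : forall i : 'I_n, exists q : rat, `|x 0 i - ratr q| < k.+1%:R^-1.
  move=> i; have /rat_in_itvoo[q] : x 0 i - k.+1%:R^-1 < x 0 i + k.+1%:R^-1.
    by rewrite ltrBlDr -addrA ltrDl addr_gt0.
  by rewrite in_itv/= => h; exists q; rewrite distrC ltr_distl.
exists (\row_i q i, k) => //; rewrite /bx; set p := (_, k).
case: asboolP => [_|].
  by move=> i /=; rewrite mxE.
case=> y /= hy; apply: eU; split => // i j; rewrite (ord1 i) /ball /=.
have := hy j; rewrite mxE => {}hy.
rewrite -[X in `|X|](subrKA (ratr (q j))).
apply: (le_lt_trans (ler_normD _ _)); rewrite [X in _ < X](splitr e).
by rewrite ltrD// (lt_trans _ ke)// distrC.
Qed.

Definition cont0 (F : rV -> R) := forall x, x != 0 -> {for x, continuous F}.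

Lemma open_neq0 : open [set x : rV | x != 0].
Proof.
have -> : [set x : rV | x != 0] = ~` [set 0].
  by apply/seteqP; split => x /= /eqP.
by apply: closed_openC; exact/accessible_closed_set1/hausdorff_accessible/norm_hausdorff.
Qed.

(** Whatever value F has at the origin is harmless, since a single point is measurable. *)
Lemma cont0_measurable (F : rV -> R) : cont0 F -> measurable_fun setT (F : rV -> mR).
Proof.
move=> cF.
have m0 : measurable [set x : rV | x != 0] by apply: open_measurable_rV; exact: open_neq0.
have E : [set: rV] = [set x | x != 0] `|` [set 0].
  apply/seteqP; split => // x _ /=; have [->|] := eqVneq x 0; [by right|by left].
have m1 : measurable [set (0 : rV)].
  rewrite (_ : [set 0] = ~` [set x : rV | x != 0]); first exact: measurableC.
  by apply/seteqP; split => x /= => [->|/negP/negPn/eqP//]; rewrite eqxx.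
rewrite E; apply/measurable_funU => //; split; last exact: measurable_fun_set1.
apply: (measurability _ (RGenOInfty.measurableE R)).
move=> /= _ [_ [a ->]] <-; apply: open_measurable_rV.
rewrite openE => x /= [x0 Fx]; rewrite /interior.
near=> y; split; last first.
  near: y; apply: (cF x x0); apply: open_nbhs_nbhs; split; [exact: rray_open|exact: Fx].
by near: y; apply: open_nbhs_nbhs; split; [exact: open_neq0|].
Unshelve. all: by end_near. Qed.

Lemma hsnorm_continuous : continuous (@hsnorm R 1 n).
Proof.
move=> x; rewrite (_ : @hsnorm R 1 n = Num.sqrt \o @sqnorm R n); last first.
  by apply/funext => y /=; rewrite hsnormE.
apply: continuous_comp; last exact: sqrt_continuous.
rewrite /sqnorm; elim: (index_enum _) => [|i r IH].
  rewrite (_ : (fun y => _) = cst 0); first exact: cst_continuous.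
  by apply/funext => y; rewrite big_nil.
rewrite (_ : (fun y : 'rV_n => \sum_(j <- i :: r) y 0 j ^+ 2) =
  fun y : 'rV_n => y 0 i * y 0 i + \sum_(j <- r) y 0 j ^+ 2).
  have c := @coord_continuous R 1 n 0 i x.
  exact: cvgD (cvgM c c) IH.
by apply/funext => y; rewrite big_cons expr2.
Qed.

(** Bounds are needed slightly inside the sphere as well: in [odd_in_bound_pos] a segment that moves
    one coordinate to 0 leaves the sphere but stays in this compact set, away from the origin. *)
Definition annulus : set rV := [set x | 2^-1 <= hsnorm x <= 1].

Lemma coord_le_hsnorm (x : rV) i : `|x 0 i| <= hsnorm x.
Proof.
rewrite hsnormE -sqrtr_sqr ler_wsqrtr// /sqnorm (bigD1 i)//= lerDl.
by apply: sumr_ge0 => j _; exact: sqr_ge0.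
Qed.

Lemma annulus_compact : compact annulus.
Proof.
apply: bounded_closed_compact.
  exists 1; split => // M M1 x /= /andP[_ x1].
  rewrite /Num.norm/= mx_normrE; apply/bigmax_leP; split; first exact: ltW (lt_trans ltr01 M1).
  move=> [i j] _ /=; rewrite (ord1 i).
  by rewrite (le_trans (coord_le_hsnorm _ _))// (le_trans x1)// ltW.
rewrite (_ : annulus = @hsnorm R 1 n @^-1` `[2^-1, 1]%classic); last first.
  by apply/seteqP; split => x; rewrite /= in_itv.
apply: closed_comp; last exact: itv_closed.
by move=> x _; exact: hsnorm_continuous.
Qed.

Lemma annulus_neq0 (x : rV) : annulus x -> x != 0.
Proof.
by move=> /andP[h _]; rewrite -hsnorm_gt0 (lt_le_trans _ h)// invr_gt0.
Qed.

Lemma sphere_annulus (x : rV) : sphere x -> annulus x.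
Proof. by rewrite /sphere/annulus/= => ->; rewrite lexx andbT; lra. Qed.

Lemma sphere_neq0 (x : rV) : sphere x -> x != 0.
Proof. by move=> /sphere_annulus/annulus_neq0. Qed.

Lemma cont0_bounded (F : rV -> R) : cont0 F ->
  exists2 M, 0 < M & forall x, annulus x -> `|F x| <= M.
Proof.
move=> cF.
have cw : {within annulus, continuous F}.
  apply: continuous_in_subspaceT => x /set_mem Ax; exact/cF/annulus_neq0.
have /compact_bounded[M [_ h]] := continuous_compact cw annulus_compact.
exists (`|M| + 1) => [|x Ax]; first by rewrite ltr_wpDl.
apply: h; last by exists x.
by rewrite (le_lt_trans (ler_norm _))// ltrDl.
Qed.

Notation mu := (@sphere_measure R n).
Notation S := (@sphere R n).

Lemma measurable_sphere : measurable S.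
Proof.
rewrite (_ : S = setT `&` @hsnorm R 1 n @^-1` [set 1]); last by rewrite setTI.
exact: measurable_hsnorm.
Qed.

Lemma sphere_measure_finite : (mu S < +oo)%E.
Proof.
by apply: (le_lt_trans (sphere_measure_le1 measurable_sphere)); exact: ltry.
Qed.

Lemma bounded_sphere_integrable (F : rV -> R) (M : R) : measurable_fun setT (F : rV -> mR) ->
  (forall x, S x -> `|F x| <= M) -> mu.-integrable S (EFin \o F).
Proof.
move=> mF FM; apply: measurable_bounded_integrable.
- exact: measurable_sphere.
- exact: sphere_measure_finite.
- exact: measurable_funTS.
- exists M; split; first exact: num_real.
  by move=> N MN x Sx; apply: (le_trans (FM x Sx)); exact: ltW.
Qed.

Lemma cont0_integrable (F : rV -> R) : cont0 F -> mu.-integrable S (EFin \o F).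
Proof.
move=> cF; have [M _ h] := cont0_bounded cF.
apply: (@bounded_sphere_integrable _ M); first exact: cont0_measurable.
by move=> x /sphere_annulus; exact: h.
Qed.

Definition sint (F : rV -> R) : R := Rintegral mu S F.

Lemma eq_sint (F G : rV -> R) : (forall x, S x -> F x = G x) -> sint F = sint G.
Proof. by move=> FG; apply: eq_Rintegral => x /set_mem/FG. Qed.

Lemma sintD (F G : rV -> R) : cont0 F -> cont0 G ->
  sint (fun x => F x + G x) = sint F + sint G.
Proof.
by move=> cF cG; apply: RintegralD; [exact: measurable_sphere|exact: cont0_integrable..].
Qed.

Lemma sintB (F G : rV -> R) : cont0 F -> cont0 G ->
  sint (fun x => F x - G x) = sint F - sint G.
Proof.
by move=> cF cG; apply: RintegralB; [exact: measurable_sphere|exact: cont0_integrable..].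
Qed.

Lemma sintZ (a : R) (F : rV -> R) : cont0 F -> sint (fun x => a * F x) = a * sint F.
Proof.
by move=> cF; apply: RintegralZl; [exact: measurable_sphere|exact: cont0_integrable].
Qed.

Lemma sint0 : sint (fun=> 0) = 0.
Proof. by rewrite /sint Rintegral_cst ?mul0r//; exact: measurable_sphere. Qed.

Lemma sint_ge0 (F : rV -> R) : (forall x, S x -> 0 <= F x) -> 0 <= sint F.
Proof. exact: Rintegral_ge0. Qed.

Lemma cont0_cst (a : R) : cont0 (fun=> a).
Proof. by move=> x _; exact: cst_continuous. Qed.

Lemma cont0D (F G : rV -> R) : cont0 F -> cont0 G -> cont0 (fun x => F x + G x).
Proof. by move=> cF cG x x0; exact: (cvgD (cF x x0) (cG x x0)). Qed.

Lemma cont0M (F G : rV -> R) : cont0 F -> cont0 G -> cont0 (fun x => F x * G x).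
Proof. by move=> cF cG x x0; exact: (cvgM (cF x x0) (cG x x0)). Qed.

Lemma cont0_sum (I : Type) (r : seq I) (P : pred I) (F : I -> rV -> R) :
  (forall i, cont0 (F i)) -> cont0 (fun x => \sum_(i <- r | P i) F i x).
Proof.
move=> cF; elim: r => [|i r IH].
  by under eq_fun do rewrite big_nil; exact: cont0_cst.
under eq_fun do rewrite big_cons; case: (P i) => //.
by apply: cont0D.
Qed.

Lemma sint_sum (I : Type) (r : seq I) (P : pred I) (F : I -> rV -> R) :
  (forall i, cont0 (F i)) ->
  sint (fun x => \sum_(i <- r | P i) F i x) = \sum_(i <- r | P i) sint (F i).
Proof.
move=> cF; elim: r => [|i r IH].
  by rewrite big_nil; under eq_fun do rewrite big_nil; exact: sint0.
rewrite big_cons; under eq_fun do rewrite big_cons; case: (P i) => //.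
by rewrite sintD ?IH//; exact: cont0_sum.
Qed.

Lemma sint_mpres (T : rV -> rV) (F : rV -> R) : mpres mu T ->
  (forall x, sqnorm (T x) = sqnorm x) -> cont0 F -> sint (F \o T) = sint F.
Proof.
move=> [mT hT] nT cF.
have ST : T @^-1` S = S.
  by apply/seteqP; split => x; rewrite /sphere/= !hsnorm_eq1 nT.
have [M _ hM] := cont0_bounded cF.
have mF := cont0_measurable cF.
have h : (\int[pushforward mu T]_(x in S) (F x)%:E =
          \int[mu]_(x in S) (EFin \o (F \o T)) x)%E.
  rewrite (integral_pushforward mT) ?ST//.
  - exact: measurableT_comp.
  - apply: (@bounded_sphere_integrable (F \o T) M); first exact: measurableT_comp.
    by move=> x; rewrite -{1}ST => /sphere_annulus; exact: hM.
  - exact: measurable_sphere.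
rewrite /sint/Rintegral -h; congr fine; apply: eq_measure_integral => A mA _.
exact: hT.
Qed.

Lemma sint_dct (F_ : nat -> rV -> R) (F : rV -> R) (M : R) :
  (forall k, measurable_fun setT (F_ k : rV -> mR)) -> measurable_fun setT (F : rV -> mR) ->
  (forall k x, S x -> `|F_ k x| <= M) ->
  (forall x, S x -> F_ ^~ x @ \oo --> F x) ->
  (fun k => sint (F_ k)) @ \oo --> sint F.
Proof.
move=> mF_ mF FM cF.
have mS := measurable_sphere.
have [|||||_ _ h] := @dominated_convergence _ rV R mu S mS (fun k => EFin \o F_ k) (EFin \o F) (cst M%:E).
- by move=> k; apply/measurable_EFinP; exact: measurable_funTS (mF_ k).
- by apply/measurable_EFinP; exact: measurable_funTS mF.
- by apply/aeW => x Sx; apply/fine_cvgP; split; [exact: nearW|exact: cF].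
- apply: (@bounded_sphere_integrable (cst M) `|M|) => //.
- by apply/aeW => x k Sx; rewrite lee_fin; exact: FM.
apply: fine_cvg; rewrite fineK; first exact: h.
apply: integrable_fin_num => //; apply: (@bounded_sphere_integrable _ M) => // x Sx.
have hc : (fun k => `|F_ k x|) @ \oo --> `|F x| by apply: cvg_norm; exact: cF.
rewrite -(cvg_lim (@Rhausdorff R) hc); apply: limr_le; first exact: cvgP hc.
by apply: nearW => k; exact: FM.
Qed.

End sphere_integral.

(** * Functions smooth away from the origin *)

(** Differentiability is local: the affine approximation of F at x has the same remainder for G near
    x. *)
Lemma near_eq_differentiable (R : realType) (V W : normedModType R) (F G : V -> W) (x : V) :
  (\near x, F x = G x) -> differentiable F x -> differentiable G x.
Proof.
move=> FG dF; have FGx : F x = G x := nbhs_singleton FG.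
have [cF EF] := (diff_locallyP _ _).1 dF.
have EG : G \o shift x = cst (G x) + 'd F x +o_ (0 : V) id.
  apply/eqaddoP => e e0; have := (eqaddoP _ _ _ _).1 EF e e0 => h.
  have FG' : \forall y \near (0 : V), F (y + x) = G (y + x).
    by move: FG; rewrite (near_shift 0) subr0.
  near=> y; rewrite -[X in `|X|]/(G (y + x) - (G x + 'd F x y)).
  rewrite -FGx; have <- : F (y + x) = G (y + x) by near: y.
  by near: y.
have dE : 'd G x = 'd F x :> (V -> W) by apply: diff_unique.
by apply/diff_locallyP; rewrite dE.
Unshelve. all: by end_near. Qed.

Section smooth_functions.
Context {R : realType} {n : nat}.
Notation rV := 'rV[R]_n.
Implicit Types (F G : rV -> R) (x : rV).

Definition eq_off0 T (F G : rV -> T) := forall x, x != 0 -> F x = G x.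

Lemma near_neq0 x : x != 0 -> \forall y \near x, y != 0.
Proof. by move=> x0; apply: open_nbhs_nbhs; split; [exact: open_neq0|]. Qed.

Lemma eq_off0_near T (F G : rV -> T) x : eq_off0 F G -> x != 0 -> \near x, F x = G x.
Proof.
move=> FG x0; near=> y; apply: FG; near: y; exact: near_neq0.
Unshelve. all: by end_near. Qed.

Lemma eq_off0_derive F G x v : eq_off0 F G -> x != 0 -> 'D_v F x = 'D_v G x.
Proof. by move=> FG x0; apply: near_eq_derive; exact: eq_off0_near. Qed.

Lemma eq_off0_partial F G i : eq_off0 F G -> eq_off0 (partial i F) (partial i G).
Proof. by move=> FG x x0; exact: eq_off0_derive. Qed.

(* Everything is required off the origin only, where the 0-homogeneous
   extensions of functions on the sphere are singular. *)
Fixpoint smoothk k F : Prop :=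
  (forall x, x != 0 -> differentiable F x) /\
  (if k is k'.+1 then forall i, smoothk k' (partial i F) else True).

Definition smooth F := forall k, smoothk k F.

Lemma foldr_partial_rcons F (s : seq 'I_n) i :
  foldr (@partial R n) F (rcons s i) = foldr (@partial R n) (partial i F) s.
Proof. by rewrite -cats1 foldr_cat. Qed.

(** [foldr] applies the last index of the list first and [smoothk] recurses through the innermost
    derivative, so the lists have to be taken apart from the right. *)
Lemma smoothP F : (forall (s : seq 'I_n) x, x != 0 ->
    differentiable (foldr (@partial R n) F s) x) <-> smooth F.
Proof.
split => [h k|h s].
  elim: k F h => [|k IH] F h /=; split => //; try exact: (h [::]).
  by move=> i; apply: IH => s x x0; rewrite -foldr_partial_rcons; exact: h.
move: F h; elim/last_ind: s => [|s i IH] F h; first by have [] := h 0%N.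
move=> x x0; rewrite foldr_partial_rcons; apply: IH => // k.
by have [_] := h k.+1; exact.
Qed.

Lemma smoothk_diff k F x : smoothk k F -> x != 0 -> differentiable F x.
Proof. by case: k => [|k] [h _]; exact: h. Qed.

Lemma smooth_diff F x : smooth F -> x != 0 -> differentiable F x.
Proof. by move=> /(_ 0%N); exact: smoothk_diff. Qed.

Lemma smooth_partial i F : smooth F -> smooth (partial i F).
Proof. by move=> h k; have [_] := h k.+1; exact. Qed.

Lemma smoothkS k F : smoothk k.+1 F -> smoothk k F.
Proof.
by elim: k F => [|k IH] F [h1 h2]; split => // i; exact/IH/h2.
Qed.

Lemma smooth_cont0 F : smooth F -> cont0 F.
Proof. by move=> h x x0; exact/differentiable_continuous/smooth_diff. Qed.

Lemma smoothk_eq0 k F G : eq_off0 F G -> smoothk k F -> smoothk k G.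
Proof.
elim: k F G => [|k IH] F G FG [h1 h2]; split => //.
- by move=> x x0; apply: near_eq_differentiable (h1 x x0); exact: eq_off0_near.
- by move=> x x0; apply: near_eq_differentiable (h1 x x0); exact: eq_off0_near.
- by move=> i; apply: IH (h2 i); exact: eq_off0_partial.
Qed.

Lemma smoothk_step k F (G : 'I_n -> rV -> R) : (forall x, x != 0 -> differentiable F x) ->
  (forall i, eq_off0 (G i) (partial i F)) -> (forall i, smoothk k (G i)) -> smoothk k.+1 F.
Proof. by move=> h1 h2 h3; split => // i; exact: smoothk_eq0 (h2 i) (h3 i). Qed.

Lemma smooth_eq0 F G : eq_off0 F G -> smooth F -> smooth G.
Proof. by move=> FG h k; exact: smoothk_eq0 (h k). Qed.

Lemma partialD F G i x : differentiable F x -> differentiable G x ->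
  partial i (fun y => F y + G y) x = partial i F x + partial i G x.
Proof. by move=> dF dG; apply: (@deriveD _ _ _ F G); exact: diff_derivable. Qed.

Lemma partialB F G i x : differentiable F x -> differentiable G x ->
  partial i (fun y => F y - G y) x = partial i F x - partial i G x.
Proof. by move=> dF dG; apply: (@deriveB _ _ _ F G); exact: diff_derivable. Qed.

Lemma partialM F G i x : differentiable F x -> differentiable G x ->
  partial i (fun y => F y * G y) x = partial i F x * G x + F x * partial i G x.
Proof.
move=> dF dG; rewrite /partial (@deriveM _ _ F G); try exact: diff_derivable.
by rewrite addrC /GRing.scale/= (mulrC (G x)).
Qed.

Lemma partial_cst a i x : partial i (fun=> a) x = 0.
Proof. exact: derive_cst. Qed.

Lemma partialZ a F i x : differentiable F x ->
  partial i (fun y => a * F y) x = a * partial i F x.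
Proof. by move=> dF; apply: (@deriveZ _ _ _ F a); exact: diff_derivable. Qed.

Lemma differentiable_coord0 (i : 'I_n) x : differentiable (fun y : rV => y 0 i) x.
Proof. exact: differentiable_coord. Qed.

Lemma derive_coord (i : 'I_n) x (v : rV) : 'D_v (fun y : rV => y 0 i) x = v 0 i.
Proof.
apply: cvg_lim => //; apply: cvg_near_cst; near=> h.
rewrite /= !mxE addrK /GRing.scale/= mulrA mulVf ?mul1r//.
near: h; exact: nbhs_dnbhs_neq.
Unshelve. all: by end_near. Qed.

Lemma partial_coord (j i : 'I_n) x : partial i (fun y : rV => y 0 j) x = (i == j)%:R.
Proof. by rewrite /partial derive_coord mxE eqxx andTb eq_sym. Qed.

Lemma chain1 (phi : R -> R) (dphi : R) F x v : is_derive (F x) 1 phi dphi ->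
  differentiable F x ->
  differentiable (fun y => phi (F y)) x /\ 'D_v (fun y => phi (F y)) x = dphi * 'D_v F x.
Proof.
move=> [dp vp] dF; have dp' : differentiable phi (F x) by exact/derivable1_diffP.
have dc : differentiable (phi \o F) x by exact: differentiable_comp.
split; first exact: dc.
rewrite -[LHS]/('D_v (phi \o F) x) deriveE// diff_comp//= (deriv1E dp) derive1E vp.
by rewrite (deriveE _ dF) mulrC.
Qed.

Lemma smoothk_cst k a : smoothk k (fun=> a).
Proof.
elim: k a => [|k IH] a; first by split => // x _; exact: differentiable_cst.
apply: (@smoothk_step _ _ (fun _ _ => 0)) => [x _|i x _|i]; first exact: differentiable_cst.
  by rewrite partial_cst.
exact: IH.
Qed.

Lemma smoothk_coord k (j : 'I_n) : smoothk k (fun y => y 0 j).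
Proof.
case: k => [|k]; first by split => // x _; exact: differentiable_coord.
apply: (@smoothk_step _ _ (fun i _ => (i == j)%:R)) => [x _|i x _|i].
- exact: differentiable_coord.
- by rewrite partial_coord.
- exact: smoothk_cst.
Qed.

Lemma smoothkD k F G : smoothk k F -> smoothk k G -> smoothk k (fun x => F x + G x).
Proof.
elim: k F G => [|k IH] F G sF sG.
  by split => // x x0; apply: (@differentiableD _ _ _ F G); [exact: (smoothk_diff sF)|exact: (smoothk_diff sG)].
apply: (@smoothk_step _ _ (fun i x => partial i F x + partial i G x)).
- by move=> x x0; apply: (@differentiableD _ _ _ F G); [exact: (smoothk_diff sF)|exact: (smoothk_diff sG)].
- by move=> i x x0; rewrite partialD//; [exact: (smoothk_diff sF)|exact: (smoothk_diff sG)].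
- by move=> i; apply: IH; [exact: sF.2|exact: sG.2].
Qed.

Lemma smoothkM k F G : smoothk k F -> smoothk k G -> smoothk k (fun x => F x * G x).
Proof.
elim: k F G => [|k IH] F G sF sG.
  by split => // x x0; apply: (@differentiableM _ _ F G); [exact: (smoothk_diff sF)|exact: (smoothk_diff sG)].
apply: (@smoothk_step _ _ (fun i x => partial i F x * G x + F x * partial i G x)).
- by move=> x x0; apply: (@differentiableM _ _ F G); [exact: (smoothk_diff sF)|exact: (smoothk_diff sG)].
- by move=> i x x0; rewrite partialM//; [exact: (smoothk_diff sF)|exact: (smoothk_diff sG)].
- move=> i; apply: smoothkD; apply: IH; try exact: smoothkS.
  + exact: sF.2.
  + exact: sG.2.
Qed.

Lemma smooth_cst a : smooth (fun=> a). Proof. by move=> k; exact: smoothk_cst. Qed.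
Lemma smooth_coord j : smooth (fun y => y 0 j). Proof. by move=> k; exact: smoothk_coord. Qed.
Lemma smoothD F G : smooth F -> smooth G -> smooth (fun x => F x + G x).
Proof. by move=> h1 h2 k; exact: smoothkD. Qed.
Lemma smoothM F G : smooth F -> smooth G -> smooth (fun x => F x * G x).
Proof. by move=> h1 h2 k; exact: smoothkM. Qed.
Lemma smoothZ a F : smooth F -> smooth (fun x => a * F x).
Proof. by move=> h; apply: smoothM => //; exact: smooth_cst. Qed.
Lemma smoothN F : smooth F -> smooth (fun x => - F x).
Proof.
move=> h; apply: (@smooth_eq0 (fun x => -1 * F x)); last exact: smoothZ.
by move=> x _; rewrite mulN1r.
Qed.
Lemma smoothB F G : smooth F -> smooth G -> smooth (fun x => F x - G x).
Proof. by move=> h1 h2; apply: smoothD => //; exact: smoothN. Qed.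
Lemma smoothX F k : smooth F -> smooth (fun x => F x ^+ k).
Proof.
move=> h; elim: k => [|k IH]; first exact: smooth_cst.
by under eq_fun do rewrite exprS; exact: smoothM.
Qed.
Lemma smooth_sum (I : Type) (r : seq I) (P : pred I) (F : I -> rV -> R) :
  (forall i, smooth (F i)) -> smooth (fun x => \sum_(i <- r | P i) F i x).
Proof.
move=> h; elim: r => [|i r IH].
  by under eq_fun do rewrite big_nil; exact: smooth_cst.
by under eq_fun do rewrite big_cons; case: (P i) => //; exact: smoothD.
Qed.

Lemma partial_sum (I : Type) (r : seq I) (P : pred I) (F : I -> rV -> R) i x :
  (forall j, smooth (F j)) -> x != 0 ->
  partial i (fun x => \sum_(j <- r | P j) F j x) x = \sum_(j <- r | P j) partial i (F j) x.
Proof.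
move=> h x0; elim: r => [|j r IH].
  by under eq_fun do rewrite big_nil; rewrite partial_cst big_nil.
rewrite big_cons; under eq_fun do rewrite big_cons; case: (P j) => //.
by rewrite partialD ?IH//; [exact: smooth_diff|apply: smooth_diff => //; exact: smooth_sum].
Qed.

Section chain.
Variables (F : rV -> R) (P : R -> Prop) (phi dphi : R -> R).
Hypothesis phiP : forall t, P t -> is_derive t 1 phi (dphi t).
Hypothesis FP : forall x, x != 0 -> P (F x).

Lemma chain_diff x : x != 0 -> differentiable F x -> differentiable (fun y => phi (F y)) x.
Proof. by move=> x0 dF; have [] := chain1 0 (phiP (FP x0)) dF. Qed.

Lemma partial_chain x i : x != 0 -> differentiable F x ->
  partial i (fun y => phi (F y)) x = dphi (F x) * partial i F x.
Proof. by move=> x0 dF; have [] := chain1 (delta_mx 0 i) (phiP (FP x0)) dF. Qed.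

Hypothesis sF : smooth F.

(** One step of an induction on the order, for functions whose derivative is an expression in the
    function itself, such as the inverse and the square root: order k - 1 of phi o F is used to
    obtain order k - 1 of dphi o F, and then order k of phi o F. *)
Lemma smoothk_chain k :
  (forall k', (k = k'.+1)%N -> smoothk k' (fun x => phi (F x)) ->
    smoothk k' (fun x => dphi (F x))) ->
  (forall k', (k = k'.+1)%N -> smoothk k' (fun x => phi (F x))) -> smoothk k (fun x => phi (F x)).
Proof.
move=> hd hp; have dF x : x != 0 -> differentiable F x by move=> x0; exact: smooth_diff.
have dp x : x != 0 -> differentiable (fun y => phi (F y)) x.
  by move=> x0; apply: chain_diff => //; exact: dF.
case: k => [|k] in hd hp *; first by split.
apply: (@smoothk_step _ _ (fun i x => dphi (F x) * partial i F x)) => //.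
- by move=> i x x0; rewrite partial_chain//; exact: dF.
- move=> i; apply: smoothkM; last exact: smooth_partial.
  by apply: hd => //; exact: hp.
Qed.

End chain.

Lemma is_derive_inv (t : R) : t != 0 -> is_derive t 1 (fun t : R => t^-1) (- (t ^- 2)).
Proof.
move=> t0; by have := @is_deriveV R id t 1 1 t0 _; rewrite /GRing.scale/= mulr1; apply.
Qed.

Lemma smoothV F : smooth F -> (forall x, x != 0 -> F x != 0) -> smooth (fun x => (F x)^-1).
Proof.
move=> sF F0; elim => [|k IH].
  by apply: (@smoothk_chain F (fun t => t != 0) GRing.inv (fun t => - (t ^- 2))) => // t; exact: is_derive_inv.
apply: (@smoothk_chain F (fun t => t != 0) GRing.inv (fun t => - (t ^- 2))) => //.
- by move=> t; exact: is_derive_inv.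
- move=> k' [<-] h; apply: (@smoothk_eq0 _ (fun x => -1 * ((F x)^-1 * (F x)^-1))).
    by move=> x _; rewrite -expr2 exprVn mulN1r.
  by apply: smoothkM; [exact: smoothk_cst|exact: smoothkM].
- by move=> k' [<-].
Qed.

Lemma partialV F i x : smooth F -> (forall x, x != 0 -> F x != 0) -> x != 0 ->
  partial i (fun x => (F x)^-1) x = - (F x) ^- 2 * partial i F x.
Proof.
move=> sF F0 x0.
apply: (@partial_chain F (fun t => t != 0) GRing.inv (fun t => - (t ^- 2))) => //.
  by move=> t; exact: is_derive_inv.
exact: smooth_diff.
Qed.

Lemma smooth_ln F : smooth F -> (forall x, x != 0 -> 0 < F x) -> smooth (fun x => ln (F x)).
Proof.
move=> sF F0; elim => [|k IH].
  by apply: (@smoothk_chain F (fun t => 0 < t) (@ln R) (fun t => t^-1)).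
apply: (@smoothk_chain F (fun t => 0 < t) (@ln R) (fun t => t^-1)) => //.
- by move=> k' [<-] h; apply: smoothV => // x x0; rewrite gt_eqF// F0.
- by move=> k' [<-].
Qed.

Lemma partial_ln F i x : smooth F -> (forall x, x != 0 -> 0 < F x) -> x != 0 ->
  partial i (fun x => ln (F x)) x = (F x)^-1 * partial i F x.
Proof.
move=> sF F0 x0.
by apply: (@partial_chain F (fun t => 0 < t) (@ln R) (fun t => t^-1)) => //; exact: smooth_diff.
Qed.

(** Unlike [smoothV] this works at a fixed order: in [smooth_sqrt] the denominator 2 sqrt F is known
    to be smooth only up to the order that the induction has reached. *)
Lemma smoothk_inv k F : smoothk k F -> (forall x, x != 0 -> F x != 0) -> smoothk k (fun x => (F x)^-1).
Proof.
move=> + F0; have h x : x != 0 -> differentiable F x -> 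
    differentiable (fun y => (F y)^-1) x /\ forall i,
      partial i (fun y => (F y)^-1) x = - (F x) ^- 2 * partial i F x.
  move=> x0 dF; split; first by have [] := chain1 0 (is_derive_inv (F0 x x0)) dF.
  by move=> i; have [] := chain1 (delta_mx 0 i) (is_derive_inv (F0 x x0)) dF.
elim: k => [|k IH] sF; first by split => // x x0; have [] := h x x0 (smoothk_diff sF x0).
apply: (@smoothk_step _ _ (fun i x => -1 * ((F x)^-1 * (F x)^-1) * partial i F x)).
- by move=> x x0; have [] := h x x0 (smoothk_diff sF x0).
- move=> i x x0; have [_ ->] := h x x0 (smoothk_diff sF x0).
  by rewrite -expr2 exprVn mulN1r.
- move=> i; apply: smoothkM; last exact: sF.2.
  apply: smoothkM; first exact: smoothk_cst.
  by apply: smoothkM; apply: IH; exact: smoothkS.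
Qed.

Lemma smooth_sqrt F : smooth F -> (forall x, x != 0 -> 0 < F x) -> smooth (fun x => Num.sqrt (F x)).
Proof.
move=> sF F0.
have d (t : R) : 0 < t -> is_derive t 1 (@Num.sqrt R) ((2 * Num.sqrt t)^-1) by move=> t0; exact: is_derive1_sqrt.
elim => [|k IH].
  by apply: (@smoothk_chain F (fun t => 0 < t) (@Num.sqrt R) (fun t => (2 * Num.sqrt t)^-1)).
apply: (@smoothk_chain F (fun t => 0 < t) (@Num.sqrt R) (fun t => (2 * Num.sqrt t)^-1)) => //.
- move=> k' [<-] h; apply: smoothk_inv; first by apply: smoothkM => //; exact: smoothk_cst.
  by move=> x x0; rewrite gt_eqF// mulr_gt0// sqrtr_gt0 F0.
- by move=> k' [<-].
Qed.

Lemma partial_sqrt F i x : smooth F -> (forall x, x != 0 -> 0 < F x) -> x != 0 ->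
  partial i (fun x => Num.sqrt (F x)) x = (2 * Num.sqrt (F x))^-1 * partial i F x.
Proof.
move=> sF F0 x0.
apply: (@partial_chain F (fun t => 0 < t) (@Num.sqrt R) (fun t => (2 * Num.sqrt t)^-1)) => //.
exact: smooth_diff.
Qed.

End smooth_functions.

(** * Euler's identity and the symmetry of second derivatives *)

Section calculus.
Context {R : realType} {n : nat}.
Notation rV := 'rV[R]_n.
Implicit Types (F G : rV -> R) (x : rV).

Lemma is_derive_line F x v (s : R) : differentiable F (x + s *: v) ->
  is_derive s 1 (fun t : R => F (x + t *: v)) ('D_v F (x + s *: v)).
Proof.
move=> /(@diff_derivable _ _ _ _ _ v) dF.
have E : (fun h : R => h^-1 *: (((fun t : R => F (x + t *: v)) \o shift s) (h *: 1) - F (x + s *: v)))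
       = (fun h : R => h^-1 *: ((F \o shift (x + s *: v)) (h *: v) - F (x + s *: v))).
  apply/funext => h /=; congr (_ *: (F _ - _)).
  by rewrite [h *: 1]mulr1 scalerDl addrCA.
by split; rewrite /derivable/derive E.
Qed.

Lemma derive_partial F x v : differentiable F x -> 'D_v F x = \sum_k v 0 k * partial k F x.
Proof.
move=> dF; rewrite deriveE// {1}(row_sum_delta v) linear_sum/=.
by apply: eq_bigr => k _; rewrite linearZ/= /partial deriveE.
Qed.

Lemma is_derive_curve F (g : R -> rV) (dg : rV) (t : R) :
  (forall k, is_derive t 1 (fun s => g s 0 k) (dg 0 k)) -> differentiable F (g t) ->
  is_derive t 1 (fun s => F (g s)) (\sum_k dg 0 k * partial k F (g t)).
Proof.
move=> hg dF.
have dvg : derivable g t 1.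
  by apply/derivable_mxP => i j; rewrite (ord1 i); have [] := hg j.
have dfg : differentiable g t by exact/derivable1_diffP.
have Dg : 'D_1 g t = dg.
  rewrite derive_mx//; apply/rowP => k; rewrite mxE.
  by have [_ ->] := hg k.
have dc : differentiable (F \o g) t by exact: differentiable_comp.
apply: DeriveDef; first exact/derivable1_diffP.
rewrite -[LHS]/('D_1 (F \o g) t) deriveE// diff_comp//= -(derive_partial dg dF) deriveE//.
by congr ('d F _ _); rewrite -deriveE.
Qed.

Lemma derive_comp_affine F (T : rV -> rV) x v w :
  (forall h : R, T (h *: v + x) = h *: w + T x) -> 'D_v (F \o T) x = 'D_w F (T x).
Proof.
move=> hT; rewrite /derive.
suff -> : (fun h : R => h^-1 *: (((F \o T) \o shift x) (h *: v) - (F \o T) x)) =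
  (fun h => h^-1 *: ((F \o shift (T x)) (h *: w) - F (T x))) by [].
by apply/funext => h /=; rewrite hT.
Qed.

Definition hom0 F := forall (c : R) x, 0 < c -> F (c *: x) = F x.

(** The sum is the derivative of F in the radial direction, along which F is constant. *)
Lemma euler F x : hom0 F -> differentiable F x -> \sum_k x 0 k * partial k F x = 0.
Proof.
move=> hF dF; rewrite -(derive_partial x dF).
apply: cvg_lim => //; apply: cvg_near_cst; near=> h.
have E : h *: x + x = (h + 1) *: x by rewrite scalerDl scale1r.
rewrite /= E hF ?subrr ?scaler0//.
rewrite -ltrBlDr sub0r; have : `|h| < 1 by near: h; exact: dnbhs0_lt.
by rewrite ltr_norml => /andP[].
Unshelve. all: by end_near. Qed.

Lemma mvt_line F x v (h : R) : 0 < h ->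
  (forall s, 0 <= s <= h -> differentiable F (x + s *: v)) ->
  exists2 s, 0 < s < h & F (x + h *: v) - F x = h * 'D_v F (x + s *: v).
Proof.
move=> h0 dF.
have dd s : s \in `[0, h] -> is_derive s 1 (fun t : R => F (x + t *: v)) ('D_v F (x + s *: v)).
  by rewrite in_itv/= => sh; apply: is_derive_line; exact: dF.
pose phi (t : R) := F (x + t *: v).
have dphi s : s \in `]0, h[ -> is_derive s 1 phi ('D_v F (x + s *: v)).
  by move=> sh; apply: dd; move: sh; rewrite !in_itv/= => /andP[/ltW-> /ltW->].
have cphi : {within `[0, h], continuous phi}.
  by apply: derivable_within_continuous => s sh; have [] := dd s sh.
have [s] := MVT h0 dphi cphi.
rewrite in_itv/= => sh; rewrite /phi scale0r addr0 subr0 mulrC => E.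
by exists s.
Qed.

Lemma delta_mx_norm_le (i : 'I_n) (a : R) : `|a *: delta_mx 0 i : rV| <= `|a|.
Proof.
rewrite normrZ ler_piMr//.
rewrite /Num.norm/= mx_normrE; apply/bigmax_leP; split => // -[j k] _ /=.
rewrite mxE; case: (_ && _); by rewrite ?normr1 ?normr0.
Qed.

(** Two applications of the mean value theorem: to y |-> F (y + h e_j) - F y along e_i, then to
    [partial i F] along e_j. Both displacements have size at most h, so 3 h leaves room for a strict
    inequality. *)
Lemma second_difference F x i j (h : R) : smooth F -> 0 < h ->
  (forall y, `|y - x| < 3 * h -> y != 0) ->
  exists2 y, `|y - x| < 3 * h &
    F (x + h *: delta_mx 0 i + h *: delta_mx 0 j) - F (x + h *: delta_mx 0 i)
    - (F (x + h *: delta_mx 0 j) - F x) = h * (h * partial j (partial i F) y).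
Proof.
move=> sF h0 hx.
set u := delta_mx 0 i : rV; set v := delta_mx 0 j : rV.
have near_x s t : 0 <= s <= h -> 0 <= t <= h -> `|x + s *: u + t *: v - x| < 3 * h.
  move=> /andP[s0 sh] /andP[t0 th].
  rewrite -(addrA x) (addrC x) addrK; apply: le_lt_trans (ler_normD _ _) _.
  apply: le_lt_trans (lerD (delta_mx_norm_le _ _) (delta_mx_norm_le _ _)) _.
  by rewrite !ger0_norm//; lra.
have h00 : 0 <= (0 : R) <= h by rewrite lexx ltW.
have hh : 0 <= h <= h by rewrite lexx ltW.
have dF G s t : smooth G -> 0 <= s <= h -> 0 <= t <= h -> differentiable G (x + s *: u + t *: v).
  by move=> sG hs ht; apply: smooth_diff => //; apply: hx; exact: near_x.
have dF0 G s : smooth G -> 0 <= s <= h -> differentiable G (x + s *: u).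
  by move=> sG hs; have := dF G s 0 sG hs h00; rewrite scale0r addr0.
pose T (y : rV) := y + h *: v.
have dT y : differentiable T y by apply: differentiableD.
have dFT s : 0 <= s <= h -> differentiable (F \o T) (x + s *: u).
  by move=> hs; apply: differentiable_comp => //; exact: dF.
have [|s /andP[s0 sh]] := @mvt_line (fun y => (F \o T) y - F y) x u h h0.
  move=> s hs; apply: (@differentiableB _ _ _ (F \o T) F); first exact: dFT.
  exact: dF0.
have hs : 0 <= s <= h by rewrite !ltW.
rewrite (_ : 'D_u _ _ = partial i F (x + s *: u + h *: v) - partial i F (x + s *: u)); last first.
  transitivity ('D_u (F \o T) (x + s *: u) - 'D_u F (x + s *: u)).
    apply: (@deriveB _ _ _ (F \o T) F); apply: diff_derivable; [exact: dFT|exact: dF0].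
  by rewrite (@derive_comp_affine F T _ u u)// => k; rewrite /T -(addrA (k *: u)).
have [|t /andP[t0 th] ->] := @mvt_line (partial i F) (x + s *: u) v h h0.
  by move=> t ht; apply: dF => //; exact: smooth_partial.
rewrite /T /= => ->.
exists (x + s *: u + t *: v) => //.
by apply: near_x => //; rewrite !ltW.
Qed.

(** Suited to the mean value theorem, which equates the two mixed derivatives at two different
    points close to x. *)
Lemma eq_of_near (P Q : rV -> R) x : {for x, continuous P} -> {for x, continuous Q} ->
  (\forall r \near (0 : R)^'+, exists y z, [/\ `|y - x| < r, `|z - x| < r & P y = Q z]) ->
  P x = Q x.
Proof.
move=> cP cQ H; apply/eqP; rewrite -subr_eq0 -normr_le0; apply/ler_addgt0Pl => e e0.
rewrite addr0.
have e20 : 0 < e / 2 by rewrite divr_gt0.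
have n1 : \forall t \near x, `|P x - P t| < e / 2 by exact: (cvgrPdist_lt _ _).1 cP _ e20.
have n2 : \forall t \near x, `|Q x - Q t| < e / 2 by exact: (cvgrPdist_lt _ _).1 cQ _ e20.
have /nbhs_ballP[r1 /= r10 h1] := n1.
have /nbhs_ballP[r2 /= r20 h2] := n2.
have [r [r0 rr1 rr2 [y [z [yr zr E]]]]] : exists r : R, [/\ 0 < r, r < r1, r < r2 &
    exists y z, [/\ `|y - x| < r, `|z - x| < r & P y = Q z]].
  have K : \forall r \near (0 : R)^'+, [/\ 0 < r, r < r1, r < r2 &
    exists y z, [/\ `|y - x| < r, `|z - x| < r & P y = Q z]].
    near=> r; split.
    - by near: r; exact: nbhs_right_gt.
    - by near: r; exact: nbhs_right_lt.
    - by near: r; exact: nbhs_right_lt.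
    - by near: r; exact: H.
  exact: (filter_ex K).
have b1 : `|P x - P y| < e / 2.
  by apply: h1; rewrite -ball_normE/= distrC (lt_trans yr).
have b2 : `|Q x - Q z| < e / 2.
  by apply: h2; rewrite -ball_normE/= distrC (lt_trans zr).
rewrite E in b1; rewrite -(subrKA (Q z)); apply: le_trans (ler_normD _ _) _.
by rewrite (splitr e) lerD// ltW// distrC.
Unshelve. all: by end_near. Qed.

(** The second difference over a square of side h is symmetric in i and j, and it is h^2 times
    either mixed derivative at some point within 3 h of x; let h tend to 0. *)
Lemma schwarz F x i j : smooth F -> x != 0 ->
  partial i (partial j F) x = partial j (partial i F) x.
Proof.
move=> sF x0; apply: eq_of_near.
- by apply: smooth_cont0 => //; do 2 apply: smooth_partial.
- by apply: smooth_cont0 => //; do 2 apply: smooth_partial.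
have /nbhs_ballP[e /= e0 he] := near_neq0 x0.
near=> r.
have r0 : 0 < r by near: r; exact: nbhs_right_gt.
have re : r < e by near: r; exact: nbhs_right_lt.
pose h := r / 3; have h0 : 0 < h by rewrite divr_gt0.
have h3 : 3 * h = r by rewrite /h; field.
have hx y : `|y - x| < 3 * h -> y != 0.
  by rewrite h3 => yr; apply: he; rewrite -ball_normE/= distrC (lt_trans yr).
have [y1 hy1 E1] := @second_difference F x i j h sF h0 hx.
have [y2 hy2 E2] := @second_difference F x j i h sF h0 hx.
exists y2, y1; split; [by rewrite -h3|by rewrite -h3|].
have hn0 : h != 0 by rewrite gt_eqF.
apply: (mulfI hn0); apply: (mulfI hn0).
have swap (a b c d : R) : a - b - (c - d) = a - c - (b - d) by ring.
by apply: (etrans (esym E2)); apply: etrans E1; rewrite (addrAC x) swap.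
Unshelve. all: by end_near. Qed.

End calculus.

(** * Integration by parts along rotation fields *)

Section integration_by_parts.
Context {R : realType} {n : nat}.
Notation rV := 'rV[R]_n.
Implicit Types (F G : rV -> R) (x : rV).

Lemma sqnorm_neq0 (T : rV -> rV) x : sqnorm (T x) = sqnorm x -> x != 0 -> T x != 0.
Proof. by move=> h; rewrite -!sqnorm_eq0 h. Qed.

Lemma upd_add (j : 'I_n) x t : upd j x t = x + (t - x 0 j) *: delta_mx 0 j.
Proof.
apply/rowP => k; rewrite !mxE eqxx /=; case: eqP => [->|_]; first by rewrite mulr1 addrC subrK.
by rewrite mulr0 addr0.
Qed.

Lemma differentiable_upd (j : 'I_n) (g : rV -> R) x : differentiable g x ->
  differentiable (fun y => upd j y (g y)) x.
Proof.
move=> dg; have -> : (fun y => upd j y (g y)) = id + (fun y => (g y - y 0 j) *: delta_mx 0 j).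
  by apply/funext => y; rewrite upd_add.
apply: differentiableD => //; apply: (@differentiableZl _ _ _ (fun y => g y - y 0 j)).
apply: (@differentiableB _ _ _ g (fun y => y 0 j)) => //; exact: differentiable_coord.
Qed.

Lemma differentiable_flip i x : differentiable (flip i) x.
Proof.
apply: (@differentiable_upd i (fun y => - y 0 i)).
exact/(@differentiableN _ _ _ (fun y : rV => y 0 i))/differentiable_coord.
Qed.

Lemma rotE i j c s x : i != j -> rot i j c s x =
  upd j (upd i x (c * x 0 i - s * x 0 j)) (s * x 0 i + c * x 0 j).
Proof.
move=> ij; apply/rowP => k; rewrite !mxE; case: (eqVneq k i) => [ki|ki].
  by have -> : (k == j) = false by rewrite ki; exact: negbTE.
by case: eqP.
Qed.

Lemma flip_neq0 i x : x != 0 -> flip i x != 0.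
Proof. by apply: sqnorm_neq0; exact: sqnorm_flip. Qed.

Definition sgn_flip (i k : 'I_n) : R := if k == i then -1 else 1.

Lemma flip_delta i k : flip i (delta_mx 0 k) = sgn_flip i k *: (delta_mx 0 k : rV).
Proof.
apply/rowP => l; rewrite !mxE eqxx /sgn_flip /=.
case: (eqVneq l i) => [li|li]; case: (eqVneq k i) => [ki|ki] /=; rewrite ?mul1r ?mulN1r//.
- by rewrite li ki eqxx.
- by rewrite li eq_sym (negbTE ki) oppr0.
- by rewrite ki (negbTE li) oppr0.
Qed.

Lemma flipD i x y : flip i (x + y) = flip i x + flip i y.
Proof. by apply/rowP => k; rewrite !mxE; case: eqP => // _; rewrite opprD. Qed.

Lemma partial_flip F i k x : differentiable F (flip i x) ->
  partial k (F \o flip i) x = sgn_flip i k * partial k F (flip i x).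
Proof.
move=> dF; rewrite /partial (@derive_comp_affine _ _ _ _ _ _ (sgn_flip i k *: delta_mx 0 k)); last first.
  by move=> h; rewrite flipD flipZ flip_delta.
by rewrite !deriveE// linearZ.
Qed.

Lemma smooth_flip F i : smooth F -> smooth (F \o flip i).
Proof.
move=> sF k; elim: k F sF => [|k IH] F sF.
  split => // x x0; apply: differentiable_comp; first exact: differentiable_flip.
  by apply: smooth_diff => //; exact: flip_neq0.
apply: (@smoothk_step _ _ _ _ (fun k x => sgn_flip i k * (partial k F \o flip i) x)).
- move=> x x0; apply: differentiable_comp; first exact: differentiable_flip.
  by apply: smooth_diff => //; exact: flip_neq0.
- by move=> l x x0; rewrite partial_flip//; apply: smooth_diff => //; exact: flip_neq0.
- by move=> l; apply: smoothkM; [exact: smoothk_cst|apply: IH; exact: smooth_partial].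
Qed.

(* The derivative along the orbits of [rot i j]. *)
Definition Lf (i j : 'I_n) F x := x 0 i * partial j F x - x 0 j * partial i F x.

Lemma smooth_Lf i j F : smooth F -> smooth (Lf i j F).
Proof.
by move=> sF; apply: smoothB; apply: smoothM; (exact: smooth_coord || exact: smooth_partial).
Qed.

Lemma is_derive_rot F i j x (t : R) : i != j -> smooth F -> x != 0 ->
  is_derive t 1 (fun t => F (rot i j (cos t) (sin t) x)) (Lf i j F (rot i j (cos t) (sin t) x)).
Proof.
move=> ij sF x0; have ji : j != i by rewrite eq_sym.
set y := rot i j (cos t) (sin t) x.
have y0 : y != 0.
  apply: (@sqnorm_neq0 (rot i j (cos t) (sin t))) x0; apply: sqnorm_rot => //; exact: cos2Dsin2.
(* The velocity of the rotating point at y, namely y_i e_j - y_j e_i. *)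
pose dg : rV := \row_k (if k == i then - y 0 j else if k == j then y 0 i else 0).
have -> : Lf i j F y = \sum_k dg 0 k * partial k F y.
  rewrite (bigD1 i)//= (bigD1 j)//= big1 ?addr0; last first.
    by move=> k /andP[ki kj]; rewrite mxE (negbTE ki) (negbTE kj) mul0r.
  by rewrite /Lf !mxE !eqxx (negbTE ji); ring.
apply: is_derive_curve; last exact: smooth_diff.
move=> k; rewrite !mxE.
have -> : (fun s : R => rot i j (cos s) (sin s) x 0 k) =
   (fun s : R => if k == i then cos s * x 0 i - sin s * x 0 j
          else if k == j then sin s * x 0 i + cos s * x 0 j else x 0 k).
  by apply/funext => s; rewrite mxE.
rewrite !eqxx (negbTE ji).
case: eqP => _; last case: eqP => _; last exact: is_derive_cst.
- by apply: is_derive_eq; rewrite /GRing.scale/=; ring.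
- by apply: is_derive_eq; rewrite /GRing.scale/=; ring.
Qed.

Lemma rot0 i j x : rot i j 1 0 x = x.
Proof.
apply/rowP => k; rewrite mxE; case: eqP => [->|_]; first by rewrite mul1r mul0r subr0.
by case: eqP => [->|//]; rewrite mul0r mul1r add0r.
Qed.

Lemma differentiable_rot i j c s x : i != j -> differentiable (rot i j c s) x.
Proof.
move=> ij.
have -> : rot i j c s = (fun y => upd j (upd i y (c * y 0 i - s * y 0 j)) (s * y 0 i + c * y 0 j)).
  by apply/funext => y; rewrite rotE.
have dc k y : differentiable (fun y : rV => y 0 k) y by exact: differentiable_coord.
have dlin a b k l y : differentiable (fun y : rV => a * y 0 k + b * y 0 l) y.
  apply: (@differentiableD _ _ _ (fun y : rV => a * y 0 k) (fun y : rV => b * y 0 l)).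
    exact: (@differentiableZ _ _ _ (fun y : rV => y 0 k) a).
  exact: (@differentiableZ _ _ _ (fun y : rV => y 0 l) b).
have -> : (fun y : rV => upd j (upd i y (c * y 0 i - s * y 0 j)) (s * y 0 i + c * y 0 j)) =
  (fun y => upd i y (c * y 0 i + (- s) * y 0 j)) +
  (fun y => ((s * y 0 i + (c - 1) * y 0 j) *: delta_mx 0 j)).
  apply/funext => y; rewrite upd_add; congr (_ + _ *: _); first by rewrite mulNr.
  by rewrite mxE eq_sym (negbTE ij); ring.
apply: differentiableD; first exact: differentiable_upd.
exact: (@differentiableZl _ _ _ (fun y : rV => s * y 0 i + (c - 1) * y 0 j)).
Qed.

(* The derivative at [0] of the constant function [t |-> sint (F \o rot t)]. *)
Lemma sint_Lf i j F : i != j -> smooth F -> sint (Lf i j F) = 0.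
Proof.
move=> ij sF.
(* The angles 1, 1/2, 1/3, ... lie strictly between 0 and pi, so their sines do not vanish, as
   [mpres_sphere_rot] demands. *)
pose th (k : nat) : R := k.+1%:R^-1.
have th0 k : 0 < th k by rewrite invr_gt0.
have th1 k : th k <= 1 by rewrite invf_le1// ler1n.
pose T k := rot i j (cos (th k)) (sin (th k)).
have nT k x : sqnorm (T k x) = sqnorm x by apply: sqnorm_rot => //; exact: cos2Dsin2.
have mT k : mpres (@sphere_measure R n) (T k).
  apply: mpres_sphere_rot => //; last exact: cos2Dsin2.
  rewrite gt_eqF// sin_gt0_pi// th0 (le_lt_trans (th1 k))//.
  by apply: lt_le_trans (@pi_ge2 R); rewrite ltr1n.
have cFT k : cont0 (F \o T k).
  move=> x x0; apply: differentiable_continuous; apply: differentiable_comp.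
    exact: differentiable_rot.
  by apply: smooth_diff => //; apply: sqnorm_neq0 x0; exact: nT.
pose F_ k x := (th k)^-1 * (F (T k x) - F x).
have cF_ k : cont0 (F_ k).
  apply: (@cont0M _ _ (fun=> (th k)^-1) (fun x => F (T k x) - F x)); first exact: cont0_cst.
  apply: (@cont0D _ _ (F \o T k) (fun x => - F x)) => //.
  by apply: smooth_cont0; exact: smoothN.
have sF_ k : sint (F_ k) = 0.
  rewrite /F_ (@sintZ _ _ (th k)^-1 (fun x => F (T k x) - F x)); last first.
    apply: (@cont0D _ _ (F \o T k) (fun x => - F x)) => //.
    by apply: smooth_cont0; exact: smoothN.
  rewrite (@sintB _ _ (F \o T k) F)//; last exact: smooth_cont0.
  by rewrite sint_mpres ?subrr ?mulr0//; exact: smooth_cont0.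
have cL : cont0 (Lf i j F) by apply: smooth_cont0; exact: smooth_Lf.
have [M M0 hM] := cont0_bounded cL.
have := @sint_dct R n F_ (Lf i j F) M _ _ _ _.
rewrite (_ : (fun k => sint (F_ k)) = fun=> 0); last by apply/funext.
move=> h; suff : (fun=> 0 : R) @ \oo --> sint (Lf i j F).
  by move/(cvg_lim (@Rhausdorff R)); rewrite lim_cst//; exact: Rhausdorff.
apply: h => [k||k x Sx|x Sx].
- exact: cont0_measurable.
- exact: cont0_measurable.
- have x0 := sphere_neq0 Sx.
  pose phi t := F (rot i j (cos t) (sin t) x).
  have dphi (t : R) : is_derive t 1 phi (Lf i j F (rot i j (cos t) (sin t) x)).
    exact: is_derive_rot.
  have cphi : {within `[0, th k], continuous phi}.
    by apply: derivable_within_continuous => t _; have [] := dphi t.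
  (* Each difference quotient is a value of [Lf i j F] at a rotated point, hence at most M in
     absolute value: this is the majorant for dominated convergence. *)
  have [t _] := MVT (th0 k) (fun t _ => dphi t) cphi.
  rewrite /phi cos0 sin0 rot0 subr0 => E.
  rewrite /F_ -/(T k) /T E mulrC mulfK ?gt_eqF//.
  apply: hM; apply: sphere_annulus; move: Sx; rewrite /sphere/= !hsnorm_eq1.
  by rewrite sqnorm_rot//; exact: cos2Dsin2.
- have x0 := sphere_neq0 Sx.
  pose phi (t : R) : R := F (rot i j (cos t) (sin t) x).
  have [dv ev] := is_derive_rot 0 ij sF x0.
  rewrite cos0 sin0 rot0 in ev.
  have dv' : (fun h : R => h^-1 *: ((phi \o shift 0) (h *: 1) - phi 0)) @ (0 : R)^' --> Lf i j F x.
    by rewrite -ev; exact: dv.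
  have -> : F_ ^~ x = (fun k => (th k)^-1 *: ((phi \o shift 0) (th k *: 1) - phi 0)).
    apply/funext => k; rewrite /F_ /= addr0 /phi cos0 sin0 rot0.
    by rewrite [_ *: 1]mulr1.
  apply: ((cvgr_dnbhsP _ _ _).1 dv' th); split => [k|]; first by rewrite gt_eqF.
  exact: cvg_harmonic.
Qed.

End integration_by_parts.

(** * Divergence theorem and Bochner formula *)

Ltac smooth_auto := repeat first [assumption | apply: smooth_partial | apply: smooth_coord | apply: smooth_cst
  | apply: smoothD | apply: smoothB | apply: smoothM | apply: smoothN | apply: smoothX
  | (apply: smooth_sum => ?) | apply: smooth_Lf ].

Section divergence.
Context {R : realType} {n : nat}.
Notation rV := 'rV[R]_n.
Implicit Types (F G U W : rV -> R) (x : rV) (h : 'I_n -> rV -> R).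

Lemma sum_delta (f : 'I_n -> R) i : \sum_j (i == j)%:R * f j = f i.
Proof.
rewrite (bigD1 i)//= eqxx mul1r big1 ?addr0// => j ji.
by rewrite eq_sym (negbTE ji) mul0r.
Qed.

(** The pointwise identity behind the divergence theorem. With H = h(x) and D i j the j-th
    derivative of h_i, the left side is sum_ij L_ji (x_j h_i); the hypotheses are the tangency x . h
    = 0 and its derivatives. *)
Lemma div_algebra (X H : 'I_n -> R) (D : 'I_n -> 'I_n -> R) :
  \sum_i X i * H i = 0 -> (forall j, H j + \sum_i X i * D i j = 0) ->
  \sum_i \sum_j (X j * ((i == j)%:R * H i + X j * D i i) - X i * (H i + X j * D i j)) =
  (\sum_i X i ^+ 2) * \sum_i D i i.
Proof.
move=> XH HD.
transitivity (\sum_i (X i * H i + (\sum_j X j ^+ 2) * D i i - X i * H i *+ n)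
   - \sum_i \sum_j X i * X j * D i j).
  rewrite -sumrB; apply: eq_bigr => i _.
  transitivity (\sum_j ((i == j)%:R * (X j * H i) + X j ^+ 2 * D i i - X i * H i - X i * X j * D i j)).
    by apply: eq_bigr => j _; ring.
  rewrite !sumrB big_split/= sum_delta -mulr_suml; congr (_ - _ - _).
  by rewrite sumr_const card_ord.
rewrite exchange_big/=.
rewrite [X in _ - X](_ : _ = - \sum_j X j * H j); last first.
  rewrite -sumrN; apply: eq_bigr => j _.
  by rewrite -mulrN (addr0_eq (HD j)) mulr_sumr; apply: eq_bigr => i _; ring.
rewrite XH oppr0 subr0 sumrB big_split/= XH add0r sumrMnl XH mul0rn subr0.
by rewrite mulr_sumr.
Qed.

Lemma partial_div h j x : (forall i, smooth (h i)) ->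
  eq_off0 (fun x => \sum_i x 0 i * h i x) (fun=> 0) -> x != 0 ->
  h j x + \sum_i x 0 i * partial j (h i) x = 0.
Proof.
move=> sh h0 x0; have := eq_off0_partial j h0 x0; rewrite partial_cst => E; rewrite -[RHS]E {E}.
rewrite partial_sum//; last by move=> i; smooth_auto.
rewrite -{1}(sum_delta (h^~ x) j) -big_split/=; apply: eq_bigr => i _.
by rewrite partialM ?partial_coord//; apply: smooth_diff => //; smooth_auto.
Qed.

(** On the unit sphere the divergence of a field tangent to all concentric spheres is a sum of
    rotation derivatives, each of integral 0. *)
Lemma sint_div h : (forall i, smooth (h i)) ->
  eq_off0 (fun x => \sum_i x 0 i * h i x) (fun=> 0) ->
  sint (fun x => \sum_i partial i (h i) x) = 0.
Proof.
move=> sh h0.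
pose K i j x := Lf j i (fun x => x 0 j * h i x) x.
have sK i j : smooth (K i j) by rewrite /K; smooth_auto.
transitivity (sint (fun x => \sum_i \sum_j K i j x)).
  apply: eq_sint => x Sx; have x0 := sphere_neq0 Sx.
  have dh i : differentiable (h i) x by exact: smooth_diff.
  have dc i : differentiable (fun x : rV => x 0 i) x by exact: differentiable_coord0.
  have h0x : \sum_i x 0 i * h i x = 0 by exact: h0.
  have := @div_algebra (fun i => x 0 i) (h^~ x) (fun i j => partial j (h i) x) h0x.
  rewrite -/(sqnorm x) (hsnorm_eq1 x).1// mul1r => <-; last by move=> j; exact: partial_div.
  apply: eq_bigr => i _; apply: eq_bigr => j _.
  rewrite /K /Lf !partialM// !partial_coord eqxx mul1r; ring.
rewrite sint_sum; last by move=> i; apply: smooth_cont0; smooth_auto.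
rewrite big1// => i _; rewrite sint_sum; last by move=> j; exact: smooth_cont0.
rewrite big1// => j _; have [->|ij] := eqVneq i j.
  rewrite -(@sint0 R n); apply: eq_sint => x _; rewrite /K /Lf; ring.
by apply: sint_Lf; [rewrite eq_sym|smooth_auto].
Qed.

Lemma smooth_sqnorm : smooth (@sqnorm R n).
Proof. by rewrite /sqnorm; smooth_auto. Qed.

Lemma partial_sqnorm i x : x != 0 -> partial i (@sqnorm R n) x = 2 * x 0 i.
Proof.
move=> x0; rewrite /sqnorm partial_sum//; last by move=> j; smooth_auto.
transitivity (\sum_j (i == j)%:R * (2 * x 0 j)); last exact: sum_delta.
apply: eq_bigr => j _; under [X in partial _ X]eq_fun do rewrite expr2.
by rewrite partialM ?partial_coord; [ring|exact: differentiable_coord0..].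
Qed.

(* For 0-homogeneous functions these Euclidean expressions restrict on the
   sphere to the spherical Laplacian, to the product of the spherical gradients
   and to |Hess U|^2 + 2 |grad U|^2. *)
Definition lap U x := \sum_i partial i (partial i U) x.
Definition gdot U W x := \sum_i partial i U x * partial i W x.
Definition hess2 U x := \sum_i \sum_j partial i (partial j U) x ^+ 2.

Lemma smooth_lap U : smooth U -> smooth (lap U). Proof. by move=> sU; rewrite /lap; smooth_auto. Qed.
Lemma smooth_gdot U W : smooth U -> smooth W -> smooth (gdot U W).
Proof. by move=> sU sW; rewrite /gdot; smooth_auto. Qed.
Lemma smooth_hess2 U : smooth U -> smooth (hess2 U). Proof. by move=> sU; rewrite /hess2; smooth_auto. Qed.

Section homogeneous.
Variables (U : rV -> R) (sU : smooth U) (hU : hom0 U).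

Lemma euler1 x : x != 0 -> \sum_i x 0 i * partial i U x = 0.
Proof. by move=> x0; apply: euler => //; exact: smooth_diff. Qed.

(** The derivative of [euler1] along e_j; it is the Euler identity for [partial j U], homogeneous of
    degree -1. *)
Lemma euler2 j x : x != 0 -> \sum_i x 0 i * partial i (partial j U) x = - partial j U x.
Proof.
move=> x0; have E := @partial_div (fun i => partial i U) j x (fun i => smooth_partial i sU) euler1 x0.
rewrite (addr0_eq E).
by apply: eq_bigr => i _; rewrite (@schwarz _ _ U x i j).
Qed.

(** The divergence theorem for W grad U, a tangent field because U is 0-homogeneous. *)
Lemma green W : smooth W -> sint (fun x => gdot W U x + W x * lap U x) = 0.
Proof.
move=> sW; rewrite -(@sint_div (fun i x => W x * partial i U x)); first last.
- move=> x x0 /=; transitivity (W x * \sum_i x 0 i * partial i U x); last by rewrite euler1// mulr0.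
  by rewrite mulr_sumr; apply: eq_bigr => i _; ring.
- by move=> i; smooth_auto.
apply: eq_sint => x Sx; have x0 := sphere_neq0 Sx.
rewrite /gdot /lap mulr_sumr -big_split/=; apply: eq_bigr => i _.
by rewrite partialM//; apply: smooth_diff => //; smooth_auto.
Qed.

Lemma partial_gdot W i x : smooth W -> x != 0 ->
  partial i (gdot U W) x =
  \sum_j (partial i (partial j U) x * partial j W x + partial j U x * partial i (partial j W) x).
Proof.
move=> sW x0; rewrite /gdot partial_sum//; last by move=> j; smooth_auto.
by apply: eq_bigr => j _; rewrite partialM//; apply: smooth_diff => //; smooth_auto.
Qed.

(** The field p = Hess U grad U - Lap U grad U has divergence hess2 U - (lap U)^2, since the third
    derivatives cancel. It is not tangent: x . p = - |grad U|^2. The tangent field to integrate is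
    therefore |x|^2 p + |grad U|^2 x. On the sphere the correction contributes 2 x . p + n |grad
    U|^2 + x . grad |grad U|^2, with coefficients -2, n and -2, whence n - 4. *)
Lemma bochner : sint (fun x => hess2 U x - lap U x ^+ 2 + (n%:R - 4) * gdot U U x) = 0.
Proof.
pose p i x := (\sum_j partial j U x * partial i (partial j U) x) - partial i U x * lap U x.
have slap := smooth_lap sU.
have sg := smooth_gdot sU sU.
have sp i : smooth (p i) by rewrite /p; smooth_auto.
have sq := smooth_sqnorm.
have xp x : x != 0 -> \sum_i x 0 i * p i x = - gdot U U x.
  move=> x0; rewrite /p; under eq_bigr do rewrite mulrBr.
  rewrite sumrB [X in _ - X](_ : _ = (\sum_i x 0 i * partial i U x) * lap U x); last first.
    by rewrite mulr_suml; apply: eq_bigr => i _; ring.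
  rewrite euler1// mul0r subr0.
  under eq_bigr do rewrite mulr_sumr.
  rewrite exchange_big/= /gdot -sumrN; apply: eq_bigr => j _.
  rewrite -mulrN -(euler2 j x0) mulr_sumr; apply: eq_bigr => i _; ring.
have xV x : x != 0 -> \sum_i x 0 i * partial i (gdot U U) x = - 2 * gdot U U x.
  move=> x0; under eq_bigr do rewrite partial_gdot// mulr_sumr.
  rewrite exchange_big/= /gdot mulr_sumr; apply: eq_bigr => j _.
  transitivity (2 * partial j U x * \sum_i x 0 i * partial i (partial j U) x).
    by rewrite mulr_sumr; apply: eq_bigr => i _; ring.
  by rewrite euler2//; ring.
rewrite -(@sint_div (fun i x => sqnorm x * p i x + x 0 i * gdot U U x)); first last.
- move=> x x0 /=.
  transitivity (sqnorm x * (\sum_i x 0 i * p i x) + sqnorm x * gdot U U x).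
    rewrite mulr_sumr {3}/sqnorm mulr_suml -big_split/=; apply: eq_bigr => i _; ring.
  by rewrite xp//; ring.
- by move=> i; smooth_auto.
apply: eq_sint => x Sx; have x0 := sphere_neq0 Sx.
have dd F : smooth F -> differentiable F x by move=> sF; exact: smooth_diff.
transitivity (2 * (\sum_i x 0 i * p i x) + (\sum_i partial i (p i) x) +
   (n%:R * gdot U U x + \sum_i x 0 i * partial i (gdot U U) x)); last first.
  have -> : n%:R * gdot U U x = \sum_(i < n) gdot U U x.
    by rewrite sumr_const card_ord mulr_natl.
  rewrite mulr_sumr -!big_split/=; apply: eq_bigr => i _.
  rewrite (@partialD _ _ (fun x => sqnorm x * p i x) (fun x => x 0 i * gdot U U x));
    [|by apply: dd; smooth_auto..].
  rewrite (@partialM _ _ (@sqnorm R n) (p i)); [|exact: dd|exact: dd].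
  rewrite (@partialM _ _ (fun y => y 0 i) (gdot U U)); [|exact: differentiable_coord0|exact: dd].
  rewrite partial_coord eqxx (hsnorm_eq1 x).1// partial_sqnorm// !mul1r; ring.
rewrite xp// xV//.
suff -> : \sum_i partial i (p i) x = hess2 U x - lap U x ^+ 2 by ring.
transitivity (\sum_i ((\sum_j (partial i (partial j U) x ^+ 2 + partial j U x * partial i (partial i (partial j U)) x))
  - (partial i (partial i U) x * lap U x + partial i U x * partial i (lap U) x))).
  apply: eq_bigr => i _; rewrite /p partialB; [|by apply: dd; smooth_auto|by apply: dd; smooth_auto].
  rewrite partialM; [|by apply: dd; smooth_auto|exact: dd].
  rewrite partial_sum//; last by move=> j; smooth_auto.
  congr (_ - _); apply: eq_bigr => j _.
  by rewrite partialM; [|by apply: dd; smooth_auto|by apply: dd; smooth_auto]; rewrite expr2.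
rewrite sumrB big_split/= -mulr_suml -/(lap U x) -expr2.
under eq_bigr do rewrite big_split/=.
rewrite big_split/=.
have cancel (a b c d : R) : b = d -> a + b - (c + d) = a - c by move=> ->; ring.
apply: cancel.
rewrite exchange_big/=; apply: eq_bigr => j _.
rewrite /lap partial_sum//; last by move=> i; smooth_auto.
rewrite mulr_sumr; apply: eq_bigr => i _.
suff -> : partial i (partial i (partial j U)) x = partial j (partial i (partial i U)) x by [].
transitivity (partial i (partial j (partial i U)) x).
  have E : eq_off0 (partial i (partial j U)) (partial j (partial i U)).
    by move=> y y0; exact: (schwarz i j sU y0).
  exact: (eq_off0_partial i E x0).
exact: (schwarz i j (smooth_partial i sU) x0).
Qed.

End homogeneous.

End divergence.

(** * Wirtinger inequalities *)

Section wirtinger.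
Context {R : realType} {n : nat}.
Notation rV := 'rV[R]_n.
Implicit Types (F G U W : rV -> R) (x : rV).

Lemma sqr_le_norm (a M : R) : `|a| <= M -> a ^+ 2 <= M ^+ 2.
Proof.
move=> h; rewrite -(real_normK (num_real a)) lerXn2r ?nnegrE//.
exact: le_trans h.
Qed.

Definition odd_in (i : 'I_n) W := forall x, x != 0 -> W (flip i x) = - W x.

(** For x_a >= 1/2 the bound on W suffices. Otherwise W vanishes at the projection of x to the
    hyperplane x_a = 0, and the mean value theorem along e_a bounds W by x_a times a bound on its
    derivative. The two terms of C serve these two cases. *)
Lemma odd_in_bound_pos a W : smooth W -> odd_in a W -> exists2 C, 0 < C &
  forall x, sphere x -> 0 < x 0 a -> W x ^+ 2 <= C * x 0 a ^+ 2.
Proof.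
move=> sW oW.
have [M0 M00 h0] := cont0_bounded (smooth_cont0 sW).
have [M1 M10 h1] := cont0_bounded (smooth_cont0 (smooth_partial a sW)).
exists (4 * M0 ^+ 2 + M1 ^+ 2); first by rewrite addr_gt0// ?mulr_gt0// exprn_gt0.
move=> x Sx xa0; have := (hsnorm_eq1 x).1 Sx => N1.
have q0 (t : R) : 0 <= t ^+ 2 by exact: sqr_ge0.
have [xa|xa] := leP 2^-1 (x 0 a).
  have b : W x ^+ 2 <= M0 ^+ 2.
    exact/sqr_le_norm/h0/sphere_annulus.
  have b4 : 1 <= 4 * x 0 a ^+ 2 by nra.
  have := q0 (x 0 a); have := q0 M0; have := q0 M1; nra.
pose x' := upd a x 0.
have line s : x' + s *: delta_mx 0 a = upd a x s.
  apply/rowP => k; rewrite !mxE eqxx /=; case: eqP => _; first by rewrite add0r mulr1.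
  by rewrite mulr0 addr0.
have N s : sqnorm (upd a x s) = 1 - x 0 a ^+ 2 + s ^+ 2.
  rewrite -N1 /sqnorm (bigD1 a)//= [in RHS](bigD1 a)//= mxE eqxx.
  rewrite (eq_bigr (fun k => x 0 k ^+ 2)); first by ring.
  by move=> k ka; rewrite mxE (negbTE ka).
have An s : 0 <= s <= x 0 a -> annulus (upd a x s).
  move=> /andP[s0 sx]; rewrite /annulus/= hsnormE N.
  have s2 : s ^+ 2 <= x 0 a ^+ 2 by nra.
  have e : (2^-1 : R) = Num.sqrt (2^-1 ^+ 2) by rewrite sqrtr_sqr ger0_norm.
  apply/andP; split.
    by rewrite [X in X <= _]e; apply: ler_wsqrtr; have := q0 s; have := q0 (x 0 a); nra.
  by rewrite -[X in _ <= X]sqrtr1; apply: ler_wsqrtr; lra.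
have W0 : W x' = 0.
  have x'0 : x' != 0 by apply: annulus_neq0; apply: An; rewrite lexx ltW.
  have := oW _ x'0; rewrite (_ : flip a x' = x').
    by move=> h; lra.
  by apply/rowP => k; rewrite !mxE eqxx; case: eqP => _ //; rewrite oppr0.
have [s hs|s /andP[s0 sx]] := @mvt_line R n W x' (delta_mx 0 a) (x 0 a) xa0.
  by rewrite line; apply: smooth_diff => //; apply: annulus_neq0; exact: An.
rewrite !line W0 subr0 (_ : upd a x (x 0 a) = x); last first.
  by apply/rowP => k; rewrite mxE; case: eqP => [->|].
move=> ->; rewrite exprMn mulrC.
have b : ('D_(delta_mx 0 a) W (upd a x s)) ^+ 2 <= M1 ^+ 2.
  by apply: sqr_le_norm; apply: (h1 (upd a x s)); apply: An; rewrite !ltW.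
rewrite ler_wpM2r// (le_trans b)// lerDr mulr_ge0//.
Qed.

(** Reflection settles negative x_a. In the Wirtinger inequalities this controls W near the zeros of
    the ground state. *)
Lemma odd_in_bound a W : smooth W -> odd_in a W -> exists2 C, 0 < C &
  forall x, sphere x -> W x ^+ 2 <= C * x 0 a ^+ 2.
Proof.
move=> sW oW; have [C C0 h] := odd_in_bound_pos sW oW; exists C => // x Sx.
have x0 := sphere_neq0 Sx.
have [xa|xa|xa] := ltgtP (x 0 a) 0; last first.
- have := oW _ x0; rewrite (_ : flip a x = x).
    move=> E; have -> : W x = 0 by lra.
    by rewrite expr0n/= mulr_ge0 ?sqr_ge0// ltW.
  by apply/rowP => k; rewrite !mxE; case: eqP => [->|//]; rewrite xa oppr0.
- exact: h.
have Sf : sphere (flip a x) by move: Sx; rewrite /sphere/= !hsnorm_eq1 sqnorm_flip.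
have := h _ Sf; rewrite oW// !mxE eqxx !sqrrN; apply.
by rewrite oppr_gt0.
Qed.

Section Lf_rules.
Variables i j : 'I_n.
Notation L := (Lf i j).

Lemma LfM F G x : smooth F -> smooth G -> x != 0 ->
  L (fun y => F y * G y) x = L F x * G x + F x * L G x.
Proof.
move=> sF sG x0; rewrite /Lf !partialM; [|exact: smooth_diff..].
by move: (partial i F x) (partial j F x) (partial i G x) (partial j G x) => *; ring.
Qed.

Lemma LfD F G x : smooth F -> smooth G -> x != 0 ->
  L (fun y => F y + G y) x = L F x + L G x.
Proof.
move=> sF sG x0; rewrite /Lf !partialD; [|exact: smooth_diff..].
by move: (partial i F x) (partial j F x) (partial i G x) (partial j G x) => *; ring.
Qed.

Lemma LfB F G x : smooth F -> smooth G -> x != 0 ->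
  L (fun y => F y - G y) x = L F x - L G x.
Proof.
move=> sF sG x0; rewrite /Lf !partialB; [|exact: smooth_diff..].
by move: (partial i F x) (partial j F x) (partial i G x) (partial j G x) => *; ring.
Qed.

Lemma Lf_cst (a : R) x : L (fun=> a) x = 0.
Proof. by rewrite /Lf !partial_cst; ring. Qed.

Lemma LfV F x : smooth F -> (forall x, x != 0 -> F x != 0) -> x != 0 ->
  L (fun x => (F x)^-1) x = - (F x) ^- 2 * L F x.
Proof.
move=> sF F0 x0; rewrite /Lf !partialV//.
by move: (partial i F x) (partial j F x) => *; ring.
Qed.

End Lf_rules.

(* Jacobi's trick with the ground state [phi]: integrate
   (L W - W phi psi / (phi^2 + e))^2 >= 0 and let e tend to 0. *)
Lemma wirtinger_eps i j W phi psi (m e : R) : i != j -> smooth W -> smooth phi -> smooth psi ->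
  eq_off0 (Lf i j phi) psi -> eq_off0 (Lf i j psi) (fun x => - m * phi x) -> 0 < e ->
  sint (fun x => W x ^+ 2 * (m * phi x ^+ 2 * (phi x ^+ 2 + e)^-1
                             - psi x ^+ 2 * e * (phi x ^+ 2 + e) ^- 2))
  <= sint (fun x => Lf i j W x ^+ 2).
Proof.
move=> ij sW sphi spsi Lphi Lpsi e0.
pose D x := phi x * phi x + e.
have D0 x : D x != 0.
  by rewrite gt_eqF// /D -expr2 ltr_wpDl// sqr_ge0.
have sD : smooth D by rewrite /D; smooth_auto.
have siD : smooth (fun x => (D x)^-1) by exact: smoothV.
(* A regularization of psi / phi, the logarithmic derivative of the ground state; L (W^2 q)
   integrates to 0 and completes the square. *)
pose q x := phi x * psi x * (D x)^-1.
have sq : smooth q by rewrite /q; smooth_auto.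
pose K x := W x * W x * q x.
have sK : smooth K by rewrite /K; smooth_auto.
have sL : smooth (Lf i j W) by smooth_auto.
pose A x := W x ^+ 2 * (m * phi x ^+ 2 * (phi x ^+ 2 + e)^-1
                             - psi x ^+ 2 * e * (phi x ^+ 2 + e) ^- 2).
have sA : smooth A.
  apply: (@smooth_eq0 _ _ (fun x => W x ^+ 2 * (m * phi x ^+ 2 * (D x)^-1
            - psi x ^+ 2 * e * ((D x)^-1 * (D x)^-1)))); last by smooth_auto.
  by move=> x _; rewrite /A /D -!expr2 exprVn.
rewrite -[X in X <= _]addr0 -(sint_Lf ij sK) -sintD; [|exact: smooth_cont0|apply: smooth_cont0; smooth_auto].
rewrite -subr_ge0 -sintB; [|apply: smooth_cont0; smooth_auto|apply: smooth_cont0; smooth_auto].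
apply: sint_ge0 => x Sx; have x0 := sphere_neq0 Sx.
suff -> : Lf i j W x ^+ 2 - (A x + Lf i j K x) = (Lf i j W x - W x * q x) ^+ 2 by exact: sqr_ge0.
have -> : Lf i j K x = 2 * W x * Lf i j W x * q x + W x ^+ 2 * Lf i j q x.
  rewrite /K (LfM i j (F := fun y => W y * W y) (G := q))//; last by smooth_auto.
  by rewrite LfM//; ring.
have -> : Lf i j q x = (psi x ^+ 2 - m * phi x ^+ 2) * (D x)^-1
    - 2 * phi x ^+ 2 * psi x ^+ 2 * (D x) ^- 2.
  rewrite /q (LfM i j (F := fun y => phi y * psi y) (G := fun y => (D y)^-1))//; last by smooth_auto.
  rewrite LfM// LfV// {2}/D LfD//; [|by smooth_auto|by smooth_auto].
  by rewrite Lf_cst LfM// Lphi// Lpsi//; ring.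
rewrite /A /q !expr2 -!/(D x).
have -> : e = D x - phi x * phi x by rewrite /D; ring.
by field; exact: D0.
Qed.

(** As e tends to 0, the potential in [wirtinger_eps] tends to m where phi does not vanish, and W is
    0 elsewhere. The hypothesis on C dominates the second term: W^2 psi^2 e / (phi^2 + e)^2 is at
    most |C| phi^2 e / (phi^2 + e)^2 <= |C|. *)
Lemma wirtinger i j W phi psi (m C : R) : i != j -> smooth W -> smooth phi -> smooth psi ->
  eq_off0 (Lf i j phi) psi -> eq_off0 (Lf i j psi) (fun x => - m * phi x) -> 0 <= m ->
  (forall x, sphere x -> W x ^+ 2 * psi x ^+ 2 <= C * phi x ^+ 2) ->
  (forall x, sphere x -> phi x = 0 -> W x = 0) ->
  m * sint (fun x => W x ^+ 2) <= sint (fun x => Lf i j W x ^+ 2).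
Proof.
move=> ij sW sphi spsi Lphi Lpsi m0 hC hz.
pose e (k : nat) : R := k.+1%:R^-1.
have e0 k : 0 < e k by rewrite invr_gt0.
pose D k x := phi x ^+ 2 + e k.
have D0 k x : 0 < D k x by rewrite ltr_wpDl// sqr_ge0.
pose A k x := W x ^+ 2 * (m * phi x ^+ 2 * (D k x)^-1 - psi x ^+ 2 * e k * (D k x) ^- 2).
have sA k : smooth (A k).
  have sD : smooth (D k) by rewrite /D; smooth_auto.
  have siD : smooth (fun x => (D k x)^-1) by apply: smoothV => // x _; rewrite gt_eqF.
  apply: (@smooth_eq0 _ _ (fun x => W x ^+ 2 * (m * phi x ^+ 2 * (D k x)^-1
            - psi x ^+ 2 * e k * ((D k x)^-1 * (D k x)^-1)))); last by smooth_auto.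
  by move=> x _; rewrite /A -!expr2 exprVn.
have [M M0 hM] := cont0_bounded (smooth_cont0 sW).
have le_k k : sint (A k) <= sint (fun x => Lf i j W x ^+ 2) by exact: wirtinger_eps.
rewrite -sintZ; last by apply: smooth_cont0; smooth_auto.
have cv : (fun k => sint (A k)) @ \oo --> sint (fun x => m * W x ^+ 2).
  apply: (@sint_dct _ _ _ _ (m * M ^+ 2 + `|C|)).
  - by move=> k; apply: cont0_measurable; exact: smooth_cont0.
  - by apply: cont0_measurable; apply: smooth_cont0; smooth_auto.
  - move=> k x Sx.
    have b : W x ^+ 2 <= M ^+ 2 by exact/sqr_le_norm/hM/sphere_annulus.
    have := hC x Sx; have := D0 k x; have := e0 k; rewrite /A {1}/D.
    have dE : D k x = phi x ^+ 2 + e k by [].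
    have := sqr_ge0 (W x); have := sqr_ge0 (phi x); have := sqr_ge0 (psi x); move: b dE.
    move: (W x ^+ 2) (phi x ^+ 2) (psi x ^+ 2) (e k) (D k x) => w p q ek d b dE q0 p0 w0 ek0 + hw.
    rewrite -dE => d0.
    have r0 : 0 <= p / d by rewrite divr_ge0// ltW.
    have r1 : p / d <= 1 by rewrite ler_pdivrMr// mul1r dE lerDl ltW.
    have s0 : 0 <= ek / d ^+ 2 by rewrite divr_ge0 ?ltW// exprn_gt0.
    have s1 : p * (ek / d ^+ 2) <= 1.
      by rewrite mulrA ler_pdivrMr ?exprn_gt0// mul1r dE; nra.
    rewrite mulrBr; apply: le_trans (ler_normB _ _) _; apply: lerD.
      have -> : w * (m * p / d) = m * (w * (p / d)) by rewrite !mulrA (mulrC w).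
      have wr0 : 0 <= w * (p / d) by rewrite mulr_ge0.
      rewrite ger0_norm; last by rewrite mulr_ge0.
      apply: ler_wpM2l => //; apply: le_trans b.
      by rewrite ler_piMr.
    have -> : w * (q * ek / d ^+ 2) = (w * q) * (ek / d ^+ 2) by rewrite !mulrA.
    rewrite ger0_norm; last by apply: mulr_ge0 => //; exact: mulr_ge0.
    apply: (@le_trans _ _ (`|C| * (p * (ek / d ^+ 2)))).
      rewrite [X in _ <= X]mulrA; apply: ler_wpM2r => //; apply: le_trans hw _.
      by apply: ler_wpM2r => //; exact: ler_norm.
    by rewrite ler_piMr.
  - move=> x Sx; have [p0|p0] := eqVneq (phi x) 0.
      rewrite (hz x Sx p0) expr0n/= mulr0.
      rewrite (_ : A ^~ x = fun=> 0); first exact: cvg_cst.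
      by apply/funext => k; rewrite /A (hz x Sx p0) expr0n/= mul0r.
    have p20 : 0 < phi x ^+ 2 by rewrite lt_def sqr_ge0 sqrf_eq0 p0.
    have ce : e @ \oo --> (0 : R) by exact: cvg_harmonic.
    have cD : (fun k => D k x) @ \oo --> phi x ^+ 2 + 0 by apply: cvgD; [exact: cvg_cst|exact: ce].
    have ciD : (fun k => (D k x)^-1) @ \oo --> (phi x ^+ 2 + 0)^-1.
      by apply: cvgV => //; rewrite addr0 gt_eqF.
    rewrite [X in _ --> X](_ : _ = W x ^+ 2 * (m * phi x ^+ 2 * (phi x ^+ 2 + 0)^-1
       - psi x ^+ 2 * 0 * ((phi x ^+ 2 + 0)^-1 * (phi x ^+ 2 + 0)^-1))); last first.
      by field; rewrite p0.
    rewrite (_ : A ^~ x = fun k => W x ^+ 2 * (m * phi x ^+ 2 * (D k x)^-1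
       - psi x ^+ 2 * e k * ((D k x)^-1 * (D k x)^-1))); last first.
      by apply/funext => k; rewrite /A -!expr2 exprVn.
    apply: cvgM; first exact: cvg_cst.
    apply: cvgB; first by apply: cvgM => //; exact: cvg_cst.
    by apply: cvgM; [apply: cvgM => //; exact: cvg_cst|exact: cvgM].
rewrite -(cvg_lim (@Rhausdorff R) cv); apply: limr_le; first exact: cvgP cv.
exact: nearW.
Qed.

Lemma Lf_coordl i j x : i != j -> Lf i j (fun y => y 0 i) x = - x 0 j.
Proof. by move=> ij; rewrite /Lf !partial_coord eqxx eq_sym (negbTE ij) mulr0 mulr1 sub0r. Qed.

Lemma Lf_coordr i j x : i != j -> Lf i j (fun y => y 0 j) x = x 0 i.
Proof. by move=> ij; rewrite /Lf !partial_coord eqxx (negbTE ij) mulr0 mulr1 subr0. Qed.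

Lemma coord_sqr_le1 x k : sphere x -> x 0 k ^+ 2 <= 1.
Proof.
move=> Sx; rewrite -((hsnorm_eq1 x).1 Sx) /sqnorm (bigD1 k)//= lerDl.
by apply: sumr_ge0 => j _; exact: sqr_ge0.
Qed.

(** The ground state is x_i: on a circle in the (i, j) plane W vanishes at the ends of the two half
    circles where x_i has a constant sign, and L_ij applied twice to x_i gives - x_i. *)
Lemma wirtinger1 i j W : i != j -> smooth W -> odd_in i W ->
  sint (fun x => W x ^+ 2) <= sint (fun x => Lf i j W x ^+ 2).
Proof.
move=> ij sW oW; have [C C0 h] := odd_in_bound sW oW.
rewrite -[X in X <= _]mul1r.
apply: (@wirtinger i j W (fun y => y 0 i) (fun y => - y 0 j) 1 C) => //; try by smooth_auto.
- by move=> x _; rewrite Lf_coordl.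
- move=> x x0; rewrite -[RHS]/(-1 * x 0 i).
  have -> : Lf i j (fun y : rV => - y 0 j) x = Lf i j (fun y => (-1) * y 0 j) x.
    by congr (Lf _ _ _ x); apply/funext => y; rewrite mulN1r.
  rewrite LfM//; [|by smooth_auto|by smooth_auto].
  by rewrite Lf_cst Lf_coordr//; ring.
- move=> x Sx; apply: le_trans (h x Sx).
  by rewrite sqrrN ler_piMr ?sqr_ge0//; exact: coord_sqr_le1.
- move=> x Sx p0; have := h x Sx; rewrite p0 expr0n/= mulr0 => h0.
  by apply/eqP; rewrite -sqrf_eq0; apply/eqP/le_anti; rewrite h0 sqr_ge0.
Qed.

(** The ground state is x_i x_j, of constant sign on the four quarter circles at whose ends W
    vanishes; L_ij applied twice multiplies it by -4. *)
Lemma wirtinger2 i j W : i != j -> smooth W -> odd_in i W -> odd_in j W ->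
  4 * sint (fun x => W x ^+ 2) <= sint (fun x => Lf i j W x ^+ 2).
Proof.
move=> ij sW oi oj; have [C C0 h] := odd_in_bound sW oi.
have [C' C'0 h'] := odd_in_bound sW oj.
have z x : sphere x -> x 0 i = 0 \/ x 0 j = 0 -> W x = 0.
  move=> Sx p0; apply/eqP; rewrite -sqrf_eq0; apply/eqP/le_anti; rewrite sqr_ge0 andbT.
  by case: p0 => p0; [have := h x Sx|have := h' x Sx]; rewrite p0 expr0n/= mulr0.
apply: (@wirtinger i j W (fun y => y 0 i * y 0 j) (fun y => y 0 i * y 0 i - y 0 j * y 0 j)
  4 (C + C')) => //; try by smooth_auto.
- move=> x x0; rewrite LfM//; [|by smooth_auto|by smooth_auto].
  by rewrite !Lf_coordl// !Lf_coordr//; ring.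
- move=> x x0; rewrite LfB//; [|by smooth_auto|by smooth_auto].
  rewrite !LfM//; [|by smooth_auto..].
  by rewrite !Lf_coordl// !Lf_coordr//; ring.
- move=> x Sx; rewrite exprMn -!expr2.
  have := h x Sx; have := h' x Sx; have := coord_sqr_le1 i Sx; have := coord_sqr_le1 j Sx.
  have := sqr_ge0 (x 0 i); have := sqr_ge0 (x 0 j); have := sqr_ge0 (W x).
  set w := W x ^+ 2; set a := x 0 i ^+ 2; set b := x 0 j ^+ 2 => w0 b0 a0 b1 a1 hb ha.
  (* (a - b)^2 is at most the larger of a and b, while oddness in the other variable bounds w by a
     multiple of the smaller one. *)
  have [ab|ba] := leP a b.
    have k1 : (a - b) ^+ 2 <= b by nra.
    have k2 : w * (a - b) ^+ 2 <= w * b by rewrite ler_wpM2l.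
    have k3 : w * b <= C * a * b by rewrite ler_wpM2r.
    have k4 : 0 <= C' * (a * b) by apply: mulr_ge0; [exact: ltW|exact: mulr_ge0].
    by lra.
  have k1 : (a - b) ^+ 2 <= a by nra.
  have k2 : w * (a - b) ^+ 2 <= w * a by rewrite ler_wpM2l.
  have k3 : w * a <= C' * b * a by rewrite ler_wpM2r.
  have k4 : 0 <= C * (a * b) by apply: mulr_ge0; [exact: ltW|exact: mulr_ge0].
  by lra.
- move=> x Sx /eqP; rewrite mulf_eq0 => /orP[]/eqP ?; apply: z => //; [by left|by right].
Qed.

End wirtinger.

(** * Spectral gap for even functions *)

Section poincare.
Context {R : realType} {n : nat}.
Notation rV := 'rV[R]_n.
Implicit Types (F G U W : rV -> R) (x : rV).

(** Lagrange's identity for orthogonal vectors; every unordered pair occurs twice, hence the factor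
    2. *)
Lemma lagrange_algebra (X G : 'I_n -> R) : \sum_i X i * G i = 0 -> \sum_i X i ^+ 2 = 1 ->
  \sum_i \sum_j (X i * G j - X j * G i) ^+ 2 = 2 * \sum_i G i * G i.
Proof.
move=> XG XX.
transitivity (\sum_i (X i ^+ 2 * (\sum_j G j * G j) + G i * G i * (\sum_j X j ^+ 2)
   - 2 * (X i * G i) * \sum_j X j * G j)).
  apply: eq_bigr => i _; rewrite !mulr_sumr -sumrN -!big_split/=.
  by apply: eq_bigr => j _; ring.
under eq_bigr do rewrite XG XX mulr0 subr0 mulr1.
by rewrite big_split/= -mulr_suml XX; ring.
Qed.

(** For G = grad U and A = Hess U the term squared is the k-th derivative of L_ij U, written as
    a_ijk - a_jik. The Euler identities evaluate the sum of the squares ([S1]) and that of the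
    products ([S2]). *)
Lemma hess_algebra (X G : 'I_n -> R) (A : 'I_n -> 'I_n -> R) :
  \sum_i X i * G i = 0 -> \sum_i X i ^+ 2 = 1 -> (forall i j, A i j = A j i) ->
  (forall j, \sum_i X i * A i j = - G j) ->
  \sum_i \sum_j \sum_k ((k == i)%:R * G j + X i * A k j - ((k == j)%:R * G i + X j * A k i)) ^+ 2 =
  2 * (\sum_k \sum_j A k j ^+ 2 + (n%:R - 4) * \sum_j G j * G j).
Proof.
move=> XG XX As XA.
pose a i j k := (k == i)%:R * G j + X i * A k j.
have S1 : \sum_i \sum_j \sum_k a i j k ^+ 2 =
    \sum_k \sum_j A k j ^+ 2 + (n%:R - 2) * \sum_j G j * G j.
  transitivity (\sum_j \sum_k \sum_i a i j k ^+ 2).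
    by rewrite exchange_big/=; apply: eq_bigr => j _; rewrite exchange_big.
  transitivity (\sum_j (\sum_k (G j * G j + A k j ^+ 2) + 2 * G j * \sum_k X k * A k j)).
    apply: eq_bigr => j _; rewrite mulr_sumr -big_split/=; apply: eq_bigr => k _.
    transitivity (\sum_i ((k == i)%:R * (G j * G j + 2 * G j * (X i * A k j)) + X i ^+ 2 * A k j ^+ 2)).
      apply: eq_bigr => i _; rewrite /a; case: eqP => _; rewrite ?mul1r ?mul0r ?add0r; ring.
    by rewrite big_split/= sum_delta -mulr_suml XX; ring.
  transitivity (\sum_j (\sum_k A k j ^+ 2 + (n%:R - 2) * (G j * G j))).
    apply: eq_bigr => j _; rewrite XA big_split/= sumr_const card_ord -mulr_natl; ring.
  by rewrite big_split/= mulr_sumr exchange_big.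
have S2 : \sum_i \sum_j \sum_k a i j k * a j i k = 2 * \sum_j G j * G j.
  transitivity (\sum_k \sum_i \sum_j a i j k * a j i k).
    by rewrite [RHS]exchange_big/=; apply: eq_bigr => i _; rewrite exchange_big.
  rewrite mulr_sumr; apply: eq_bigr => k _.
  transitivity (\sum_i ((k == i)%:R * G i * (\sum_j (k == j)%:R * G j)
     + (k == i)%:R * A k i * (\sum_j X j * G j) + X i * G i * (\sum_j (k == j)%:R * A k j)
     + X i * A i k * \sum_j X j * A j k)).
    apply: eq_bigr => i _; rewrite !mulr_sumr -!big_split/=; apply: eq_bigr => j _.
    by rewrite /a (As i k) (As j k); ring.
  rewrite !big_split/= -!mulr_suml XG XA !sum_delta; ring.
have S3 : \sum_i \sum_j \sum_k a j i k ^+ 2 = \sum_i \sum_j \sum_k a i j k ^+ 2.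
  by rewrite exchange_big.
transitivity (\sum_i \sum_j \sum_k a i j k ^+ 2 + \sum_i \sum_j \sum_k a j i k ^+ 2
   - 2 * \sum_i \sum_j \sum_k a i j k * a j i k).
  rewrite mulr_sumr -sumrN -!big_split/=; apply: eq_bigr => i _.
  rewrite mulr_sumr -sumrN -!big_split/=; apply: eq_bigr => j _.
  rewrite mulr_sumr -sumrN -!big_split/=; apply: eq_bigr => k _.
  by rewrite /a; ring.
rewrite S3 S1 S2; ring.
Qed.

Lemma partial_hom0 U i (c : R) x : smooth U -> hom0 U -> 0 < c -> x != 0 ->
  partial i U (c *: x) = c^-1 * partial i U x.
Proof.
move=> sU hU c0 x0.
have cx0 : c *: x != 0 by rewrite scaler_eq0 negb_or x0 gt_eqF.
pose T (y : rV) := c *: y.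
have E : partial i U x = 'D_(c *: delta_mx 0 i) U (T x).
  rewrite -(@derive_comp_affine _ _ U T x (delta_mx 0 i)); last first.
    by move=> h; rewrite /T scalerDr !scalerA mulrC.
  have -> : U \o T = U by apply/funext => y; exact: hU.
  by [].
rewrite E /T /partial deriveE; last exact: smooth_diff.
by rewrite deriveE; [rewrite linearZ/= mulKf// gt_eqF|exact: smooth_diff].
Qed.

Lemma hom0_Lf i j U : smooth U -> hom0 U -> hom0 (Lf i j U).
Proof.
move=> sU hU c x c0; have [->|x0] := eqVneq x 0; first by rewrite scaler0.
rewrite /Lf !partial_hom0// !mxE; field; exact: lt0r_neq0.
Qed.

Lemma gdot_Lf U : smooth U -> hom0 U ->
  2 * sint (gdot U U) = \sum_i \sum_j sint (fun x => Lf i j U x ^+ 2).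
Proof.
move=> sU hU; rewrite -sintZ; last by apply: smooth_cont0; exact: smooth_gdot.
transitivity (sint (fun x => \sum_i \sum_j Lf i j U x ^+ 2)).
  apply: eq_sint => x Sx; have x0 := sphere_neq0 Sx.
  rewrite /gdot -(lagrange_algebra (X := fun i => x 0 i))//; first exact: euler1.
  exact: ((hsnorm_eq1 x).1 Sx).
rewrite sint_sum; last by move=> i; apply: smooth_cont0; smooth_auto.
by apply: eq_bigr => i _; rewrite sint_sum// => j; apply: smooth_cont0; smooth_auto.
Qed.

(** Bochner turns the left side into the integral of the pointwise identity [hess_algebra]. Together
    with [gdot_Lf] this reduces the gap for U to a Poincare inequality for each L_ij U. *)
Lemma lap_Lf U : smooth U -> hom0 U ->
  2 * sint (fun x => lap U x ^+ 2) = \sum_i \sum_j sint (gdot (Lf i j U) (Lf i j U)).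
Proof.
move=> sU hU.
have slap := smooth_lap sU; have sg := smooth_gdot sU sU; have sh := smooth_hess2 sU.
have sgL i j : smooth (gdot (Lf i j U) (Lf i j U)) by apply: smooth_gdot; smooth_auto.
have -> : sint (fun x => lap U x ^+ 2) = sint (fun x => hess2 U x + (n%:R - 4) * gdot U U x).
  apply/eqP; rewrite eq_sym -subr_eq0 -sintB; [|apply: smooth_cont0; smooth_auto|apply: smooth_cont0; smooth_auto].
  apply/eqP; rewrite -(bochner sU hU); apply: eq_sint => x _; ring.
rewrite -sintZ; last by apply: smooth_cont0; smooth_auto.
transitivity (sint (fun x => \sum_i \sum_j gdot (Lf i j U) (Lf i j U) x)).
  apply: eq_sint => x Sx; have x0 := sphere_neq0 Sx.
  rewrite /gdot /hess2.
  rewrite -(@hess_algebra (fun i => x 0 i) (fun i => partial i U x) (fun i j => partial i (partial j U) x)).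
  - apply: eq_bigr => i _; apply: eq_bigr => j _; apply: eq_bigr => k _.
    have -> : partial k (Lf i j U) x = (k == i)%:R * partial j U x + x 0 i * partial k (partial j U) x
        - ((k == j)%:R * partial i U x + x 0 j * partial k (partial i U) x).
      rewrite /Lf partialB; [|by apply: smooth_diff => //; smooth_auto|by apply: smooth_diff => //; smooth_auto].
      by rewrite !partialM ?partial_coord//; apply: smooth_diff => //; smooth_auto.
    by rewrite expr2.
  - exact: euler1.
  - exact: ((hsnorm_eq1 x).1 Sx).
  - by move=> i j; exact: schwarz.
  - by move=> j; exact: euler2.
rewrite sint_sum; last by move=> i; apply: smooth_cont0; smooth_auto.
by apply: eq_bigr => i _; rewrite sint_sum// => j; apply: smooth_cont0.
Qed.

(** The squared sum of indicators is 4, 1 or 0 according to how many of i and j lie in {a, b}; this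
    puts the Wirtinger inequalities into one form that can be summed over all pairs. *)
Lemma sint_Lf_ge a b i j U : a != b -> i != j -> smooth U -> odd_in a U -> odd_in b U ->
  (((i == a) || (i == b))%:R + ((j == a) || (j == b))%:R) ^+ 2 * sint (fun x => U x ^+ 2)
   <= sint (fun x => Lf i j U x ^+ 2).
Proof.
move=> ab ij sU oa ob.
have o k : (k == a) || (k == b) -> odd_in k U by case/orP => /eqP->.
have [ia|ia] := boolP ((i == a) || (i == b)); have [ja|ja] := boolP ((j == a) || (j == b)).
- rewrite (_ : (_ + _) ^+ 2 = 4); last by rewrite /=; ring.
  by apply: wirtinger2 => //; exact: o.
- rewrite (_ : (_ + _) ^+ 2 = 1); last by rewrite /=; ring.
  by rewrite mul1r; apply: wirtinger1 => //; exact: o.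
- rewrite (_ : (_ + _) ^+ 2 = 1); last by rewrite /=; ring.
  rewrite mul1r (_ : (fun x => Lf i j U x ^+ 2) = (fun x => Lf j i U x ^+ 2)).
    by apply: wirtinger1 => //; [rewrite eq_sym|exact: o].
  by apply/funext => x; rewrite /Lf; ring.
- rewrite (_ : (_ + _) ^+ 2 = 0); last by rewrite /=; ring.
  by rewrite mul0r; apply: sint_ge0 => x _; exact: sqr_ge0.
Qed.

Lemma weight_algebra (s : 'I_n -> R) :
  \sum_i \sum_j (i != j)%:R * (s i + s j) ^+ 2 =
  2 * n%:R * (\sum_i s i ^+ 2) + 2 * (\sum_i s i) ^+ 2 - 4 * \sum_i s i ^+ 2.
Proof.
transitivity (\sum_i ((\sum_j (s i ^+ 2 + s j ^+ 2 + 2 * s i * s j)) - \sum_j (i == j)%:R * (4 * s j ^+ 2))).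
  apply: eq_bigr => i _; rewrite -sumrN -big_split/=; apply: eq_bigr => j _.
  case: eqP => [->|_] /=; ring.
transitivity (\sum_i ((n%:R - 4) * s i ^+ 2 + \sum_j s j ^+ 2 + (2 * \sum_j s j) * s i)).
  apply: eq_bigr => i _.
  by rewrite sum_delta !big_split/= sumr_const card_ord -mulr_natl -mulr_sumr; ring.
by rewrite !big_split/= sumr_const card_ord -!mulr_sumr -mulr_natl; ring.
Qed.

Lemma poincare_odd2 a b U : a != b -> smooth U -> hom0 U -> odd_in a U -> odd_in b U ->
  2 * n%:R * sint (fun x => U x ^+ 2) <= sint (gdot U U).
Proof.
move=> ab sU hU oa ob.
pose s k : R := ((k == a) || (k == b))%:R.
have Ss : \sum_k s k = 2.
  rewrite (bigD1 a)//= (bigD1 b)//=; last by rewrite eq_sym.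
  rewrite /s !eqxx orbT big1 ?addr0//.
  by move=> k /andP[/negbTE-> /negbTE->].
have Ss2 : \sum_k s k ^+ 2 = 2.
  by rewrite -Ss; apply: eq_bigr => k _; rewrite /s; case: (_ || _); rewrite ?expr1n// expr0n.
rewrite -(@ler_pM2l _ 2)// (gdot_Lf sU hU).
(* Since s and s^2 both sum to 2, the weights add up to 4 n + 8 - 8 = 4 n. *)
have -> : 2 * (2 * n%:R * sint (fun x => U x ^+ 2)) =
    \sum_i \sum_j ((i != j)%:R * (s i + s j) ^+ 2) * sint (fun x => U x ^+ 2).
  under eq_bigr do rewrite -mulr_suml.
  rewrite -mulr_suml weight_algebra Ss Ss2; ring.
apply: ler_sum => i _; apply: ler_sum => j _.
have [->|ij] := eqVneq i j.
  by rewrite mul0r mul0r; apply: sint_ge0 => x _; exact: sqr_ge0.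
by rewrite mul1r; exact: (sint_Lf_ge ab ij).
Qed.

Definition gap U := 2 * n%:R * sint (gdot U U) <= sint (fun x => lap U x ^+ 2).

(** From the first-order to the second-order inequality: expand the integral of (lap U + 2 n U)^2 >=
    0, turn the mixed term into - int |grad U|^2 by Green, and bound int U^2 by [poincare_odd2]. *)
Lemma gap_odd2 a b U : a != b -> smooth U -> hom0 U -> odd_in a U -> odd_in b U -> gap U.
Proof.
move=> ab sU hU oa ob; have h := poincare_odd2 ab sU hU oa ob.
have slap := smooth_lap sU; have sg := smooth_gdot sU sU.
have g : sint (gdot U U) + sint (fun x => U x * lap U x) = 0.
  by rewrite -sintD ?green//; apply: smooth_cont0; smooth_auto.
have : 0 <= sint (fun x => lap U x ^+ 2 + (4 * n%:R * (U x * lap U x) + 4 * n%:R ^+ 2 * U x ^+ 2)).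
  apply: sint_ge0 => x _.
  by rewrite (_ : _ + _ = (lap U x + 2 * n%:R * U x) ^+ 2); [exact: sqr_ge0|ring].
rewrite sintD; [|by apply: smooth_cont0; smooth_auto..].
rewrite sintD; [|by apply: smooth_cont0; smooth_auto..].
rewrite !sintZ; [|by apply: smooth_cont0; smooth_auto..].
rewrite /gap; move: g h; set I1 := sint (gdot U U); set I2 := sint (fun x => U x * lap U x).
set I3 := sint (fun x => U x ^+ 2); set I4 := sint _ => g h.
have n0 : 0 <= n%:R :> R by [].
have : 2 * n%:R * (2 * n%:R * I3) <= 2 * n%:R * I1 by rewrite ler_wpM2l// mulr_ge0.
have -> : I2 = - I1 by lra.
lra.
Qed.

Definition flip_parity i (e : bool) U := forall x, x != 0 -> U (flip i x) = (-1) ^+ e * U x.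

(** L_ij multiplies by one of x_i, x_j and differentiates along the other, so it reverses the parity
    in both coordinates and makes [poincare_odd2] applicable to L_ij U. *)
Lemma gap_even U : smooth U -> hom0 U -> (forall i, flip_parity i false U) -> gap U.
Proof.
move=> sU hU pU; rewrite /gap -(@ler_pM2l _ 2)// (lap_Lf sU hU).
rewrite mulrCA (gdot_Lf sU hU) !mulr_sumr.
apply: ler_sum => i _; rewrite mulr_sumr; apply: ler_sum => j _.
have sL : smooth (Lf i j U) by smooth_auto.
have [ij|ij] := eqVneq i j.
  rewrite (_ : (fun x => Lf i j U x ^+ 2) = fun=> 0); last first.
    by apply/funext => x; rewrite ij /Lf; ring.
  rewrite sint0 mulr0; apply: sint_ge0 => x _; rewrite /gdot; apply: sumr_ge0 => k _.
  by rewrite -expr2 sqr_ge0.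
have P k l x : x != 0 -> partial l U (flip k x) = sgn_flip k l * partial l U x.
  move=> x0; have E : eq_off0 (U \o flip k) U by move=> y y0 /=; rewrite pU// mul1r.
  have dU : differentiable U (flip k x) by apply: smooth_diff => //; exact: flip_neq0.
  have := eq_off0_partial l E x0; rewrite partial_flip// => <-.
  by rewrite mulrA /sgn_flip; case: eqP => _; rewrite ?mulN1r ?mulrN1 ?opprK ?mul1r.
apply: (@poincare_odd2 i j) => //; first exact: hom0_Lf.
- move=> x x0; rewrite /Lf !P// !mxE /sgn_flip !eqxx eq_sym (negbTE ij); ring.
- move=> x x0; rewrite /Lf !P// !mxE /sgn_flip !eqxx (negbTE ij); ring.
Qed.

Lemma flips_parity (e : 'I_n -> bool) U (l : seq 'I_n) x : (forall i, flip_parity i (e i) U) ->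
  x != 0 -> foldr (@flip R n) x l != 0 /\
  U (foldr (@flip R n) x l) = (-1) ^+ count e l * U x.
Proof.
move=> pU x0; elim: l => [|i l [IH0 IH]] /=; first by rewrite mul1r.
split; first exact: flip_neq0.
by rewrite pU// IH mulrA exprD.
Qed.

Lemma flips_coord (l : seq 'I_n) x k : uniq l ->
  foldr (@flip R n) x l 0 k = if k \in l then - x 0 k else x 0 k.
Proof.
elim: l => [|i l IH] //= /andP[il ul]; rewrite mxE inE.
case: (eqVneq k i) => [ki|ki] /=.
  by rewrite -ki IH// ki (negbTE il).
by rewrite IH.
Qed.

Lemma flips_opp x : foldr (@flip R n) x (enum 'I_n) = - x.
Proof. by apply/rowP => k; rewrite flips_coord ?enum_uniq// mem_enum mxE. Qed.

(** The reflections in all coordinates compose to x |-> - x. If exactly one coordinate is odd, this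
    gives U (- x) = - U x, so U vanishes by evenness. *)
Lemma gap_parity (e : 'I_n -> bool) U : smooth U -> hom0 U -> (forall x, x != 0 -> U (- x) = U x) ->
  (forall i, flip_parity i (e i) U) -> gap U.
Proof.
move=> sU hU eU pU.
have [a ea|ne] := pickP e; last first.
  by apply: gap_even => // i; have := pU i; rewrite ne.
have odd i : e i -> odd_in i U by move=> ei x x0; rewrite pU// ei mulN1r.
have [b /andP[ba eb]|nb] := pickP (fun b => (b != a) && e b).
  by apply: (@gap_odd2 b a) => //; exact: odd.
have U0 : eq_off0 U (fun=> 0).
  move=> x x0; have [_] := flips_parity (enum 'I_n) pU x0.
  rewrite flips_opp eU// (_ : count e _ = 1%N); first by rewrite expr1; lra.
  rewrite (@eq_count _ _ (pred1 a)); last first.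
    move=> k /=; case: (eqVneq k a) => [->//|ka]; by have := nb k; rewrite ka.
  by rewrite count_uniq_mem ?enum_uniq// mem_enum.
rewrite /gap (_ : sint (gdot U U) = 0).
  by rewrite mulr0; apply: sint_ge0 => x _; exact: sqr_ge0.
rewrite -(@sint0 R n); apply: eq_sint => x Sx.
rewrite /gdot big1// => i _; rewrite (eq_off0_partial i U0) ?partial_cst ?mul0r//.
exact: sphere_neq0.
Qed.

Lemma lap_flip U i x : smooth U -> x != 0 -> lap (U \o flip i) x = lap U (flip i x).
Proof.
move=> sU x0; apply: eq_bigr => k _.
have fx0 := flip_neq0 i x0.
have E : eq_off0 (partial k (U \o flip i)) (fun y => sgn_flip i k * (partial k U \o flip i) y).
  by move=> y y0; rewrite partial_flip//; apply: smooth_diff => //; exact: flip_neq0.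
rewrite (eq_off0_partial k E x0) partialZ; last first.
  by apply: smooth_diff => //; apply: smooth_flip; smooth_auto.
rewrite partial_flip; last by apply: smooth_diff => //; smooth_auto.
by rewrite mulrA /sgn_flip; case: eqP => _; rewrite ?mulN1r ?opprK ?mul1r.
Qed.

Lemma gdot_flip U i x : smooth U -> x != 0 -> gdot (U \o flip i) (U \o flip i) x = gdot U U (flip i x).
Proof.
move=> sU x0; apply: eq_bigr => k _.
rewrite partial_flip; last by apply: smooth_diff => //; exact: flip_neq0.
by rewrite /sgn_flip; case: eqP => _; ring.
Qed.

Lemma sint_parallelogram F G P Q : smooth F -> smooth G -> smooth P -> smooth Q ->
  (forall x, x != 0 -> P x + Q x = 2 * F x + 2 * G x) -> sint G = sint F ->
  sint P + sint Q = 4 * sint F.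
Proof.
move=> sF sG sP sQ E GF.
transitivity (2 * sint F + 2 * sint G); last by rewrite GF; ring.
rewrite -(sintZ 2 (smooth_cont0 sF)) -(sintZ 2 (smooth_cont0 sG)).
rewrite -(sintD (smooth_cont0 sP) (smooth_cont0 sQ)).
rewrite -(sintD (smooth_cont0 (smoothZ 2 sF)) (smooth_cont0 (smoothZ 2 sG))).
by apply: eq_sint => x Sx; exact: E (sphere_neq0 Sx).
Qed.

Lemma half_le (a1 a2 b1 b2 b c g : R) : a1 + a2 = 4 * b -> b1 + b2 = 4 * c ->
  g * a1 <= b1 -> g * a2 <= b2 -> g * b <= c.
Proof.
by move=> E1 E2 h1 h2; rewrite -(@ler_pM2l _ 4)// -E2 mulrCA -E1 mulrDr; exact: lerD.
Qed.

Lemma smooth_sqr F : smooth F -> smooth (fun x => F x ^+ 2).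
Proof. by move=> sF; smooth_auto. Qed.

(** The list holds the coordinates whose parity is not yet definite. To treat a, split U by V = U o
    flip a into U + V and U - V, which keeps the parities already reached. Both sides of [gap] are
    quadratic forms invariant under the reflection, so by the parallelogram law the inequalities for
    the two parts add up to 4 times that for U. *)
Lemma gap_even_list (l : seq 'I_n) U : smooth U -> hom0 U -> (forall x, x != 0 -> U (- x) = U x) ->
  (forall i, i \notin l -> exists e, flip_parity i e U) -> gap U.
Proof.
elim: l U => [|a l IH] U sU hU eU pU.
  have /choice[e he] : forall i, exists e, flip_parity i e U by move=> i; exact: pU.
  exact: (@gap_parity e).
pose V := U \o flip a.
have sV : smooth V by exact: smooth_flip.
have hV : hom0 V by move=> c x c0; rewrite /V /= flipZ hU.
have flipN i x : flip i (- x) = - flip i x by rewrite -scaleN1r flipZ scaleN1r.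
have flipC i j x : flip i (flip j x) = flip j (flip i x).
  apply/rowP => k; rewrite !mxE; case: (eqVneq k i) => ki; case: (eqVneq k j) => kj //.
  - by rewrite -ki -kj eqxx.
  - by rewrite -ki (negbTE kj).
  - by rewrite -kj (negbTE ki).
have eV x : x != 0 -> V (- x) = V x.
  by move=> x0; rewrite /V /= flipN eU//; exact: flip_neq0.
have pV i : i \notin a :: l -> exists e, flip_parity i e U /\ flip_parity i e V.
  move=> /pU[e he]; exists e; split => // x x0.
  by rewrite /V /= flipC he//; exact: flip_neq0.
have lV x : x != 0 -> lap V x = lap U (flip a x) by exact: lap_flip.
have gV x : x != 0 -> gdot V V x = gdot U U (flip a x) by exact: gdot_flip.
have VE x : V x = U (flip a x) by [].
have VK x : V (flip a x) = U x by rewrite VE flipK.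
clearbody V.
have gA : gap (fun x => U x + V x).
  apply: IH; first by smooth_auto.
  - by move=> c x c0; rewrite hU// hV.
  - by move=> x x0; rewrite eU// eV.
  - move=> i il; have [->|ia] := eqVneq i a.
      by exists false => x x0; rewrite VK -VE mul1r addrC.
    have [|e [h1 h2]] := pV i; first by rewrite inE negb_or ia.
    by exists e => x x0; rewrite h1// h2// mulrDr.
have gB : gap (fun x => U x - V x).
  apply: IH; first by smooth_auto.
  - by move=> c x c0; rewrite hU// hV.
  - by move=> x x0; rewrite eU// eV.
  - move=> i il; have [->|ia] := eqVneq i a.
      by exists true => x x0; rewrite VK -VE mulN1r opprB.
    have [|e [h1 h2]] := pV i; first by rewrite inE negb_or ia.
    by exists e => x x0; rewrite h1// h2// mulrBr.
have sgU := smooth_gdot sU sU; have sgV := smooth_gdot sV sV.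
have slU := smooth_lap sU; have slV := smooth_lap sV.
have sA : smooth (fun x => U x + V x) by smooth_auto.
have sB : smooth (fun x => U x - V x) by smooth_auto.
have sgA := smooth_gdot sA sA; have sgB := smooth_gdot sB sB.
have slA := smooth_lap sA; have slB := smooth_lap sB.
have mf := @mpres_sphere_flip R n a.
have pD k x : x != 0 -> partial k (fun x => U x + V x) x = partial k U x + partial k V x.
  by move=> x0; rewrite partialD//; exact: smooth_diff.
have pB k x : x != 0 -> partial k (fun x => U x - V x) x = partial k U x - partial k V x.
  by move=> x0; rewrite partialB//; exact: smooth_diff.
have lD x : x != 0 -> lap (fun x => U x + V x) x = lap U x + lap V x.
  move=> x0; rewrite /lap -big_split/=; apply: eq_bigr => k _.
  have E : eq_off0 (partial k (fun x => U x + V x)) (fun x => partial k U x + partial k V x).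
    by move=> y; exact: pD.
  by rewrite (eq_off0_partial k E x0) partialD//; apply: smooth_diff => //; smooth_auto.
have lB x : x != 0 -> lap (fun x => U x - V x) x = lap U x - lap V x.
  move=> x0; rewrite /lap -sumrB/=; apply: eq_bigr => k _.
  have E : eq_off0 (partial k (fun x => U x - V x)) (fun x => partial k U x - partial k V x).
    by move=> y; exact: pB.
  by rewrite (eq_off0_partial k E x0) partialB//; apply: smooth_diff => //; smooth_auto.
have e1 : sint (gdot (fun x => U x + V x) (fun x => U x + V x)) +
          sint (gdot (fun x => U x - V x) (fun x => U x - V x)) = 4 * sint (gdot U U).
  apply: (sint_parallelogram sgU sgV sgA sgB) => [x x0|].
    rewrite /gdot !mulr_sumr -!big_split/=; apply: eq_bigr => k _.
    by rewrite (pD k x x0) (pB k x x0); ring.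
  transitivity (sint (gdot U U \o flip a)); last first.
    exact: (sint_mpres mf (sqnorm_flip a) (smooth_cont0 sgU)).
  by apply: eq_sint => x Sx; exact: gV (sphere_neq0 Sx).
have e2 : sint (fun x => lap (fun x => U x + V x) x ^+ 2) +
          sint (fun x => lap (fun x => U x - V x) x ^+ 2) = 4 * sint (fun x => lap U x ^+ 2).
  apply: (sint_parallelogram (smooth_sqr slU) (smooth_sqr slV) (smooth_sqr slA) (smooth_sqr slB)) => [x x0|].
    have par (p q c d : R) : p = c + d -> q = c - d -> p ^+ 2 + q ^+ 2 = 2 * c ^+ 2 + 2 * d ^+ 2.
      by move=> -> ->; ring.
    exact: par (lD x x0) (lB x x0).
  transitivity (sint ((fun x => lap U x ^+ 2) \o flip a)); last first.
    exact: (sint_mpres mf (sqnorm_flip a) (smooth_cont0 (smooth_sqr slU))).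
  apply: eq_sint => x Sx.
  exact: (congr1 (fun t => t ^+ 2) (lV x (sphere_neq0 Sx))).
exact: (half_le e1 e2 gA gB).
Qed.

Lemma poincare U : smooth U -> hom0 U -> (forall x, x != 0 -> U (- x) = U x) -> gap U.
Proof.
move=> sU hU eU; apply: (@gap_even_list (enum 'I_n)) => // i.
by rewrite mem_enum.
Qed.

End poincare.

(** * The inequality for u = sqrt f *)

Section main_inequality.
Context {R : realType} {n : nat}.
Notation rV := 'rV[R]_n.
Implicit Types (U W : rV -> R) (x : rV).

(** For G = grad U and A = Hess U at the point X of the sphere, A_ij + X_i G_j + G_i X_j is the
    spherical Hessian extended by 0 to the normal line, and delta_ij - X_i X_j is the metric: the
    left side is |Hess U - s g - t grad U (x) grad U|^2. The case s = t = 0 later gives the norm of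
    [shess]. *)
Lemma square_algebra (X G : 'I_n -> R) (A : 'I_n -> 'I_n -> R) (s t : R) :
  \sum_i X i * G i = 0 -> \sum_i X i ^+ 2 = 1 -> (forall i j, A i j = A j i) ->
  (forall j, \sum_i X i * A i j = - G j) ->
  \sum_i \sum_j (A i j + X i * G j + G i * X j - s * ((i == j)%:R - X i * X j) - t * (G i * G j)) ^+ 2 =
  \sum_i \sum_j A i j ^+ 2 - 2 * (\sum_i G i * G i) + (n%:R - 1) * s ^+ 2
  + t ^+ 2 * (\sum_i G i * G i) ^+ 2 - 2 * s * (\sum_i A i i)
  - 2 * t * (\sum_i \sum_j G i * G j * A i j) + 2 * s * t * (\sum_i G i * G i).
Proof.
move=> XG XX As XA; move: {-2}(\sum_i G i * G i) (erefl (\sum_i G i * G i)) => V VE.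
pose m i j := A i j + X i * G j + (G i + s * X i) * X j - t * G i * G j.
transitivity (\sum_i ((\sum_j m i j ^+ 2) + (s ^+ 2 - 2 * s * m i i))).
  apply: eq_bigr => i _.
  have -> : s ^+ 2 - 2 * s * m i i = \sum_j (i == j)%:R * (s ^+ 2 - 2 * s * m i j).
    by rewrite (sum_delta (fun j => s ^+ 2 - 2 * s * m i j)).
  rewrite -big_split/=; apply: eq_bigr => j _; rewrite /m; case: eqP => _ /=; ring.
have E1 i : \sum_j m i j ^+ 2 = \sum_j A i j ^+ 2 + X i ^+ 2 * V + (G i + s * X i) ^+ 2
   + t ^+ 2 * G i * G i * V + 2 * X i * (\sum_j A i j * G j) - 2 * (G i + s * X i) * G i
   - 2 * t * (\sum_j G i * G j * A i j) - 2 * t * X i * G i * V.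
  transitivity (\sum_j A i j ^+ 2 + X i ^+ 2 * V + (G i + s * X i) ^+ 2 * (\sum_j X j ^+ 2)
   + t ^+ 2 * G i * G i * V + 2 * X i * (\sum_j A i j * G j) + 2 * (G i + s * X i) * (\sum_j X j * A j i)
   - 2 * t * (\sum_j G i * G j * A i j) - 2 * t * X i * G i * V
   + 2 * (G i + s * X i) * (X i - t * G i) * \sum_j X j * G j); last by rewrite XG XX XA; ring.
  rewrite VE !mulr_sumr -!sumrN -!big_split/=; apply: eq_bigr => j _.
  by rewrite /m (As j i); ring.
have E2 : \sum_i X i * (\sum_j A i j * G j) = - V.
  transitivity (\sum_j G j * \sum_i X i * A i j).
    under eq_bigr do rewrite mulr_sumr.
    rewrite exchange_big/=; apply: eq_bigr => j _; rewrite mulr_sumr.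
    by apply: eq_bigr => i _; ring.
  by rewrite VE -sumrN; apply: eq_bigr => j _; rewrite XA mulrN.
transitivity (\sum_i \sum_j A i j ^+ 2 + (V - s ^+ 2) * (\sum_i X i ^+ 2)
   + (t ^+ 2 * V + 2 * s * t - 1) * (\sum_i G i * G i) + 2 * (\sum_i X i * (\sum_j A i j * G j))
   - 2 * t * (\sum_i \sum_j G i * G j * A i j) + (\sum_(i < n) s ^+ 2) - 2 * s * (\sum_i A i i)
   - (4 * s + 2 * t * V) * (\sum_i X i * G i)).
  rewrite !mulr_sumr -!sumrN -!big_split/=; apply: eq_bigr => i _.
  by rewrite E1 /m; ring.
rewrite XX XG E2 -VE sumr_const card_ord -mulr_natl; ring.
Qed.

(** Hess U (grad U, grad U); for 0-homogeneous U the Euclidean and the spherical Hessian agree on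
    tangent vectors of the unit sphere. *)
Definition hessdd U x := \sum_i \sum_j partial i U x * partial j U x * partial i (partial j U) x.

Lemma smooth_hessdd U : smooth U -> smooth (hessdd U).
Proof. by move=> sU; rewrite /hessdd; smooth_auto. Qed.

(** One linearity statement for the six integrals of [main_inequality], so that each identity
    between them becomes a list of coefficients. *)
Lemma sint_lin6 (F1 F2 F3 F4 F5 F6 : rV -> R) (a b c d e f : R) :
  cont0 F1 -> cont0 F2 -> cont0 F3 -> cont0 F4 -> cont0 F5 -> cont0 F6 ->
  sint (fun x => a * F1 x + b * F2 x + c * F3 x + d * F4 x + e * F5 x + f * F6 x) =
  a * sint F1 + b * sint F2 + c * sint F3 + d * sint F4 + e * sint F5 + f * sint F6.
Proof.
move=> h1 h2 h3 h4 h5 h6.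
have cZ (r : R) F : cont0 F -> cont0 (fun x => r * F x) by apply: cont0M; exact: cont0_cst.
have z1 := cZ a _ h1; have z2 := cZ b _ h2; have z3 := cZ c _ h3.
have z4 := cZ d _ h4; have z5 := cZ e _ h5; have z6 := cZ f _ h6.
have y2 := cont0D z1 z2; have y3 := cont0D y2 z3; have y4 := cont0D y3 z4.
have y5 := cont0D y4 z5.
by rewrite (sintD y5 z6) (sintD y4 z5) (sintD y3 z4) (sintD y2 z3) (sintD z1 z2) !sintZ.
Qed.

Section positive.
Variables (U : rV -> R).
Hypotheses (sU : smooth U) (hU : hom0 U) (U0 : forall x, x != 0 -> 0 < U x).

Let Un0 x : x != 0 -> U x != 0. Proof. by move=> /U0; exact: lt0r_neq0. Qed.

Lemma smooth_invU : smooth (fun x => (U x)^-1).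
Proof. exact: smoothV. Qed.

Notation V := (gdot U U).

Lemma cross_identity : sint (fun x => 2 * (hessdd U x * (U x)^-1)
   + (V x * lap U x * (U x)^-1 - V x ^+ 2 * ((U x)^-1 * (U x)^-1))) = 0.
Proof.
have siU := smooth_invU; have sV := smooth_gdot sU sU.
rewrite -(@green _ _ U sU hU (fun x => V x * (U x)^-1)); last by smooth_auto.
apply: eq_sint => x Sx; have x0 := sphere_neq0 Sx.
have -> : gdot (fun x => V x * (U x)^-1) U x = 2 * (hessdd U x * (U x)^-1) - V x ^+ 2 * ((U x)^-1 * (U x)^-1).
  transitivity ((\sum_i partial i V x * partial i U x) * (U x)^-1
    - V x * (U x) ^- 2 * \sum_i partial i U x * partial i U x).
    rewrite {1}/gdot mulr_suml mulr_sumr -sumrN -big_split/=; apply: eq_bigr => i _.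
    rewrite partialM; [|exact: smooth_diff|exact: smooth_diff].
    by rewrite partialV//; ring.
  have -> : \sum_i partial i V x * partial i U x = 2 * hessdd U x.
    rewrite /hessdd mulr_sumr; apply: eq_bigr => i _.
    rewrite partial_gdot// mulr_suml mulr_sumr; apply: eq_bigr => j _; ring.
  by rewrite -/(gdot U U x) -exprVn; ring.
ring.
Qed.

Lemma square_nonneg (c : R) : (2 <= n)%N ->
  0 <= sint (fun x => hess2 U x - 2 * V x
     - (n%:R - 1)^-1 * (lap U x - c * V x * (U x)^-1) ^+ 2
     + c ^+ 2 * (V x ^+ 2 * ((U x)^-1 * (U x)^-1)) - 2 * c * (hessdd U x * (U x)^-1)).
Proof.
move=> n2; apply: sint_ge0 => x Sx; have x0 := sphere_neq0 Sx.
have N0 : n%:R - 1 != 0 :> R.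
  by rewrite subr_eq0 pnatr_eq1; case: n n2 => [|[]].
pose N : R := n%:R - 1.
(* This s makes Hess U - s g - t grad U (x) grad U trace-free on the tangent space, whose dimension
   is N. *)
pose s := (lap U x - c * V x * (U x)^-1) / N.
pose t := c * (U x)^-1.
have := @square_algebra (fun i => x 0 i) (fun i => partial i U x) (fun i j => partial i (partial j U) x) s t
  (euler1 sU hU x0) ((hsnorm_eq1 x).1 Sx) (fun i j => schwarz i j sU x0) (fun j => euler2 sU hU j x0).
rewrite -/(gdot U U x) -/(hess2 U x) -/(lap U x) -/(hessdd U x) -/N => E.
have : 0 <= hess2 U x - 2 * V x + N * s ^+ 2 + t ^+ 2 * V x ^+ 2 - 2 * s * lap U x
    - 2 * t * hessdd U x + 2 * s * t * V x.
  by rewrite -E; apply: sumr_ge0 => i _; apply: sumr_ge0 => j _; exact: sqr_ge0.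
congr (_ <= _).
have Ux := Un0 x0; rewrite /s /t -/N; move: (hess2 U x) (V x) (lap U x) (hessdd U x) (U x) Ux => h v l hd u Ux.
by field; rewrite N0 Ux.
Qed.

Lemma combine_identities (IE IT IV IP IQ IS d : R) : 2 <= d -> (d = 2 \/ 3 <= d) ->
  (forall c, 0 <= IE - 2 * IV - (d - 1)^-1 * (IT - 2 * c * IP + c ^+ 2 * IQ) + c ^+ 2 * IQ - 2 * c * IS) ->
  2 * IS + (IP - IQ) = 0 -> IE - IT + (d - 4) * IV = 0 -> 2 * d * IV <= IT -> 0 <= IQ ->
  (d + 3 - 1 / (d - 1)) * IV <= IE + (d - 4) * IV + IP.
Proof.
move=> d2 dd K C B P Q0.
have IEE : IE = IT - (d - 4) * IV by lra.
have ISE : 2 * IS = IQ - IP by lra.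
(* On the circle N / (N - 1) is undefined. There c = 1 gives 3 IP >= IQ >= 0, and IP >= 0 leaves
   only the gap to be used. *)
case: dd => [dE|d3].
  have e : (2 - 1)^-1 = 1 :> R by rewrite (_ : 2 - 1 = 1) ?invr1//; lra.
  have := K 1; move: P; rewrite IEE dE div1r e; lra.
pose N := d - 1; have dN : d = N + 1 by rewrite /N; lra.
have N2 : 2 <= N by rewrite /N; lra.
have N0 : N != 0 by rewrite gt_eqF//; lra.
have N1 : N - 1 != 0 by rewrite gt_eqF//; lra.
have := K (N / (N - 1)); rewrite -/N.
have -> : IE - 2 * IV - N^-1 * (IT - 2 * (N / (N - 1)) * IP + (N / (N - 1)) ^+ 2 * IQ)
    + (N / (N - 1)) ^+ 2 * IQ - 2 * (N / (N - 1)) * IS =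
    (N * (N - 1))^-1 * ((N - 1) ^+ 2 * (IT - N * IV) + N * (N + 2) * IP).
  have -> : IS = (IQ - IP) / 2 by lra.
  by rewrite IEE dN; field; rewrite N0 N1.
rewrite pmulr_rge0; last by rewrite invr_gt0 mulr_gt0//; lra.
move=> h1.
have h2 : 0 <= (4 * N - 1) * (IT - 2 * d * IV) by rewrite mulr_ge0//; lra.
have NN : 0 < N * (N + 2) by rewrite mulr_gt0//; lra.
rewrite -(ler_pM2l NN) -subr_ge0.
have -> : N * (N + 2) * (IE + (d - 4) * IV + IP) - N * (N + 2) * ((d + 3 - 1 / N) * IV) =
  ((N - 1) ^+ 2 * (IT - N * IV) + N * (N + 2) * IP) + (4 * N - 1) * (IT - 2 * d * IV).
  by rewrite IEE dN; field.
exact: addr_ge0.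
Qed.

Lemma main_inequality : (2 <= n)%N -> (forall x, x != 0 -> U (- x) = U x) ->
  (n%:R + 3 - 1 / (n%:R - 1)) * sint V <=
  sint (fun x => hess2 U x - 2 * (hessdd U x * (U x)^-1) + V x ^+ 2 * ((U x)^-1 * (U x)^-1)
    + (n%:R - 4) * V x).
Proof.
move=> n2 eU.
have siU := smooth_invU; have sV := smooth_gdot sU sU; have sl := smooth_lap sU.
have sh := smooth_hess2 sU; have shd := smooth_hessdd sU.
pose P x := V x * lap U x * (U x)^-1.
pose Q x := V x ^+ 2 * ((U x)^-1 * (U x)^-1).
pose S x := hessdd U x * (U x)^-1.
pose T x := lap U x ^+ 2.
have cV := smooth_cont0 sV; have ch := smooth_cont0 sh.
have cP : cont0 P by apply: smooth_cont0; rewrite /P; smooth_auto.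
have cQ : cont0 Q by apply: smooth_cont0; rewrite /Q; smooth_auto.
have cS : cont0 S by apply: smooth_cont0; rewrite /S; smooth_auto.
have cT : cont0 T by apply: smooth_cont0; rewrite /T; smooth_auto.
have lin a b c d e f : sint (fun x => a * hess2 U x + b * T x + c * V x + d * P x + e * Q x + f * S x) =
    a * sint (hess2 U) + b * sint T + c * sint V + d * sint P + e * sint Q + f * sint S.
  exact: sint_lin6.
have IQ0 : 0 <= sint Q.
  apply: sint_ge0 => x _; rewrite /Q mulr_ge0 ?sqr_ge0// -expr2; exact: sqr_ge0.
have B : sint (hess2 U) - sint T + (n%:R - 4) * sint V = 0.
  transitivity (sint (fun x => 1 * hess2 U x + (-1) * T x + (n%:R - 4) * V x + 0 * P x + 0 * Q x + 0 * S x)).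
    by rewrite lin; ring.
  apply: etrans (bochner sU hU); apply: eq_sint => x _; rewrite /T; ring.
have C : 2 * sint S + (sint P - sint Q) = 0.
  transitivity (sint (fun x => 0 * hess2 U x + 0 * T x + 0 * V x + 1 * P x + (-1) * Q x + 2 * S x)).
    by rewrite lin; ring.
  apply: etrans cross_identity; apply: eq_sint => x _; rewrite /P /Q /S; ring.
have K c : 0 <= sint (hess2 U) - 2 * sint V
    - (n%:R - 1)^-1 * (sint T - 2 * c * sint P + c ^+ 2 * sint Q) + c ^+ 2 * sint Q - 2 * c * sint S.
  have := square_nonneg c n2.
  rewrite (_ : sint _ = sint (fun x => 1 * hess2 U x + (- (n%:R - 1)^-1) * T x + (-2) * V x
     + (n%:R - 1)^-1 * (2 * c) * P x + (c ^+ 2 - (n%:R - 1)^-1 * c ^+ 2) * Q x + (- (2 * c)) * S x)); last first.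
    by apply: eq_sint => x _; rewrite /T /P /Q /S; ring.
  rewrite lin; congr (_ <= _); ring.
have pc := poincare sU hU eU.
(* The terms Q - 2 S integrate to the same value as P by [cross_identity]. *)
rewrite [X in _ <= X](_ : _ = sint (hess2 U) + (n%:R - 4) * sint V + sint P); last first.
  transitivity (sint (fun x => 1 * hess2 U x + 0 * T x + (n%:R - 4) * V x + 0 * P x + 1 * Q x + (-2) * S x)).
    by apply: eq_sint => x _; rewrite /Q /S; ring.
  rewrite lin (_ : sint P = sint Q - 2 * sint S); first by ring.
  by apply/eqP; rewrite -subr_eq0 -C; apply/eqP; ring.
have d2 : 2 <= n%:R :> R by rewrite (ler_nat _ 2).
have dd : n%:R = 2 :> R \/ 3 <= n%:R :> R.
  by move: n2; rewrite leq_eqVlt => /orP[/eqP<-|n3]; [left|right; rewrite (ler_nat _ 3)].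
exact: (combine_identities d2 dd K C B pc IQ0).
Qed.

End positive.

End main_inequality.

(** * Spherical gradient and Hessian *)

Section radial_extension.
Context {R : realType} {n : nat}.
Notation rV := 'rV[R]_n.
Implicit Types (U W : rV -> R) (x : rV).

Lemma normalizeZ (c : R) x : 0 < c -> normalize (c *: x) = normalize x.
Proof.
move=> c0; rewrite /normalize hsnormZ gtr0_norm// scalerA; congr (_ *: _).
by rewrite invfM mulrAC mulVf ?mul1r// gt_eqF.
Qed.

Lemma hom0_radial (g : rV -> R) : hom0 (radial g).
Proof. by move=> c x c0; rewrite /radial /= normalizeZ. Qed.

Lemma normalize_sphere x : x != 0 -> sphere (normalize x).
Proof.
move=> x0; rewrite /sphere/= /normalize hsnormZ ger0_norm ?invr_ge0 ?ltW ?hsnorm_gt0//.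
by rewrite mulVf// gt_eqF// hsnorm_gt0.
Qed.

Lemma normalize_id x : sphere x -> normalize x = x.
Proof. by rewrite /sphere/= /normalize => ->; rewrite invr1 scale1r. Qed.

Lemma normalizeN x : normalize (- x) = - normalize x.
Proof. by rewrite /normalize -scaleN1r hsnormZ normrN1 mul1r scalerA mulrN1 scaleNr. Qed.

Lemma smooth_hsnorm : smooth (fun x : rV => hsnorm x).
Proof.
rewrite (_ : (fun x : rV => hsnorm x) = fun x => Num.sqrt (sqnorm x)); last first.
  by apply/funext => x; rewrite hsnormE.
apply: smooth_sqrt; first exact: smooth_sqnorm.
by move=> x x0; rewrite lt_def sqnorm_eq0 x0 sqnorm_ge0.
Qed.

Lemma partial_hsnorm i x : sphere x -> partial i (fun x : rV => hsnorm x) x = x 0 i.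
Proof.
move=> Sx; have x0 := sphere_neq0 Sx.
rewrite (_ : (fun x : rV => hsnorm x) = fun x => Num.sqrt (sqnorm x)); last first.
  by apply/funext => y; rewrite hsnormE.
rewrite partial_sqrt//; last 2 first.
- exact: smooth_sqnorm.
- by move=> y y0; rewrite lt_def sqnorm_eq0 y0 sqnorm_ge0.
by rewrite partial_sqnorm// (hsnorm_eq1 x).1// sqrtr1 mulr1 mulKf.
Qed.

Variables (g : rV -> R).
Hypothesis sg : smooth (radial g).
Notation G := (radial g).

(** The Euclidean gradient of a 0-homogeneous function is tangent already, so the projection leaves
    it unchanged. *)
Lemma sgradE x : x != 0 -> sgrad g x = \row_i partial i G x.
Proof.
move=> x0; rewrite /sgrad /tangent_proj mulmxBr mulmx1 mulmxA.
rewrite [X in X *m x](_ : _ = 0); last first.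
  apply/matrixP => i j; rewrite !mxE -[RHS](euler (@hom0_radial g) (smooth_diff sg x0)).
  by apply: eq_bigr => k _; rewrite !mxE (ord1 j) mulrC.
by rewrite mul0mx subr0.
Qed.

Lemma sqr_hsnorm_sgrad x : x != 0 -> hsnorm (sgrad g x) ^+ 2 = gdot G G x.
Proof.
move=> x0; rewrite sqr_hsnorm sgradE//; apply: eq_bigr => i _.
by rewrite mxE expr2.
Qed.

(** The partial derivatives are homogeneous of degree -1; the factor |x| restores degree 0. *)
Lemma radial_sgradE x : x != 0 -> radial (sgrad g) x = \row_i (hsnorm x * partial i G x).
Proof.
move=> x0; have nx0 : 0 < hsnorm x by rewrite hsnorm_gt0.
rewrite /radial /= sgradE; last exact/sphere_neq0/normalize_sphere.
apply/rowP => i; rewrite !mxE /normalize partial_hom0//; last 2 first.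
- exact: hom0_radial.
- by rewrite invr_gt0.
by rewrite invrK.
Qed.

(** The second term is the derivative of the factor |x| in [radial_sgradE]. *)
Lemma jacobian_sgrad x i j : sphere x ->
  ('J (radial (sgrad g)) x) i j = partial i (partial j G) x + x 0 i * partial j G x.
Proof.
move=> Sx; have x0 := sphere_neq0 Sx.
pose Phi (y : rV) : rV := \row_i (hsnorm y * partial i G y).
have PhiE : \near x, Phi x = radial (sgrad g) x.
  by apply: eq_off0_near => // y y0; rewrite radial_sgradE.
have PhiE' : \near x, radial (sgrad g) x = Phi x.
  by apply: eq_off0_near => // y y0; rewrite radial_sgradE.
have sh := smooth_hsnorm.
have dP : differentiable (radial (sgrad g)) x.
  apply: near_eq_differentiable PhiE _.
  have -> : Phi = \sum_i (fun y => (hsnorm y * partial i G y) *: (delta_mx 0 i : rV)).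
    apply/funext => y; rewrite [LHS](row_sum_delta (Phi y)) fct_sumE.
    by apply: eq_bigr => k _; rewrite mxE.
  apply: differentiable_sum => k; apply: (@differentiableZl _ _ _ (fun y => hsnorm y * partial k G y)).
  by apply: smooth_diff => //; smooth_auto.
rewrite /jacobian /lin1_mx mxE /= -deriveE// -(near_eq_derive _ PhiE).
rewrite derive_mx; last first.
  by apply: (near_eq_derivable PhiE'); exact: diff_derivable.
rewrite mxE.
rewrite (_ : (fun t => Phi t 0 j) = fun y => hsnorm y * partial j G y); last first.
  by apply/funext => y; rewrite mxE.
rewrite -/(partial i (fun y => hsnorm y * partial j G y) x) partialM; last 2 first.
- exact: smooth_diff.
- by apply: smooth_diff => //; smooth_auto.
by rewrite partial_hsnorm// Sx mul1r addrC.
Qed.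

(** The Jacobian J satisfies x J = 0 by the second Euler identity, so the left projection changes
    nothing; J x^T = - grad G, so the right projection adds the last term. *)
Lemma shessE x i j : sphere x -> shess g x i j =
  partial i (partial j G) x + x 0 i * partial j G x + partial i G x * x 0 j.
Proof.
move=> Sx; have x0 := sphere_neq0 Sx.
have XX := (hsnorm_eq1 x).1 Sx.
have XG := euler1 sg (@hom0_radial g) x0.
have XA := fun j => euler2 sg (@hom0_radial g) j x0.
set J := 'J (radial (sgrad g)) x.
have PJ k l : (tangent_proj x *m J) k l = partial k (partial l G) x + x 0 k * partial l G x.
  rewrite /tangent_proj mulmxBl mul1mx -mulmxA mxE jacobian_sgrad//.
  rewrite [X in _ + X]mxE [X in _ - X]mxE big_ord1 mxE.
  rewrite (_ : (x *m J) 0 l = 0) ?mulr0 ?subr0//.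
  rewrite mxE; under eq_bigr do rewrite jacobian_sgrad// mulrDr.
  rewrite big_split/= XA.
  rewrite (eq_bigr (fun k => x 0 k ^+ 2 * partial l G x)); last by move=> m _; ring.
  by rewrite -mulr_suml -/(sqnorm x) XX mul1r addNr.
rewrite /shess -/J {2}/tangent_proj mulmxBr mulmx1 mulmxA.
rewrite mxE PJ [X in _ + X]mxE [X in _ - X]mxE big_ord1.
rewrite (_ : (_ *m _ *m x^T) i 0 = - partial i G x); first by rewrite mulNr opprK.
rewrite mxE; under eq_bigr do rewrite PJ mxE mulrDl.
rewrite big_split/=.
rewrite (eq_bigr (fun k => x 0 k * partial k (partial i G) x)); last first.
  by move=> k _; rewrite mulrC schwarz.
rewrite XA (eq_bigr (fun k => x 0 i * (x 0 k * partial k G x))); last by move=> k _; ring.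
by rewrite -mulr_sumr XG mulr0 addr0.
Qed.

Lemma sqr_hsnorm_shess x : sphere x -> hsnorm (shess g x) ^+ 2 = hess2 G x - 2 * gdot G G x.
Proof.
move=> Sx; have x0 := sphere_neq0 Sx.
rewrite /hsnorm sqr_sqrtr; last first.
  by apply: sumr_ge0 => i _; apply: sumr_ge0 => j _; exact: sqr_ge0.
have E := @square_algebra R n (fun i => x 0 i) (fun i => partial i G x) (fun i j => partial i (partial j G) x) 0 0
  (euler1 sg (@hom0_radial g) x0) ((hsnorm_eq1 x).1 Sx) (fun i j => schwarz i j sg x0)
  (fun j => euler2 sg (@hom0_radial g) j x0).
transitivity (hess2 G x - 2 * gdot G G x + (n%:R - 1) * 0 ^+ 2
  + 0 ^+ 2 * gdot G G x ^+ 2 - 2 * 0 * lap G x - 2 * 0 * hessdd G x + 2 * 0 * 0 * gdot G G x); last by ring.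
apply: etrans E; apply: eq_bigr => i _; apply: eq_bigr => j _.
by rewrite shessE// !mul0r !subr0.
Qed.

End radial_extension.

(** * The substitution u = sqrt f *)

Section log_substitution.
Context {R : realType} {n : nat}.
Notation rV := 'rV[R]_n.
Variable f : rV -> R.
Hypotheses (sF : smooth (radial f)) (f0 : forall x, sphere x -> 0 < f x).
Notation F := (radial f).

Definition sqrt_radial (x : rV) : R := Num.sqrt (F x).
Notation U := sqrt_radial.

Lemma radial_gt0 x : x != 0 -> 0 < F x.
Proof. by move=> x0; apply: f0; exact: normalize_sphere. Qed.

Lemma smooth_sqrt_radial : smooth U.
Proof. by apply: smooth_sqrt => //; exact: radial_gt0. Qed.

Lemma hom0_sqrt_radial : hom0 U.
Proof. by move=> c x c0; rewrite /U hom0_radial. Qed.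

Lemma sqrt_radial_gt0 x : x != 0 -> 0 < U x.
Proof. by move=> x0; rewrite sqrtr_gt0 radial_gt0. Qed.

Lemma smooth_ln_radial : smooth (radial (fun x => ln (f x))).
Proof. by apply: (smooth_ln sF); exact: radial_gt0. Qed.
Notation G := (radial (fun x => ln (f x))).

Lemma radialE x : x != 0 -> F x = U x ^+ 2.
Proof. by move=> x0; rewrite sqr_sqrtr// ltW// radial_gt0. Qed.

Lemma partial_ln_radial i x : x != 0 -> partial i G x = 2 * (partial i U x * (U x)^-1).
Proof.
move=> x0; have Ux := lt0r_neq0 (sqrt_radial_gt0 x0).
rewrite (partial_ln i sF radial_gt0 x0).
have -> : partial i F x = 2 * U x * partial i U x.
  have E : eq_off0 F (fun x => U x * U x) by move=> y y0; rewrite radialE// expr2.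
  rewrite (eq_off0_partial i E x0) partialM; [ring|exact: smooth_diff smooth_sqrt_radial _..].
by rewrite radialE//; field.
Qed.

Lemma partial2_ln_radial i j x : x != 0 -> partial i (partial j G) x =
  2 * (partial i (partial j U) x * (U x)^-1 - partial i U x * partial j U x * (U x) ^- 2).
Proof.
move=> x0; have sU := smooth_sqrt_radial.
have siU : smooth (fun x => (U x)^-1) by apply: smoothV => // y y0; exact: lt0r_neq0 (sqrt_radial_gt0 y0).
have E : eq_off0 (partial j G) (fun x => 2 * (partial j U x * (U x)^-1)).
  by move=> y; exact: partial_ln_radial.
rewrite (eq_off0_partial i E x0) partialZ; last by apply: smooth_diff => //; smooth_auto.
rewrite partialM; [|by apply: smooth_diff => //; smooth_auto|exact: smooth_diff].
rewrite partialV//; last by move=> y y0; exact: lt0r_neq0 (sqrt_radial_gt0 y0).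
by move: (partial i (partial j U) x) (partial i U x) (partial j U x) => p q r; ring.
Qed.

Lemma integrand_sgrad x : sphere x ->
  f x * hsnorm (sgrad (fun x => ln (f x)) x) ^+ 2 = 4 * gdot U U x.
Proof.
move=> Sx; have x0 := sphere_neq0 Sx; have Ux := lt0r_neq0 (sqrt_radial_gt0 x0).
rewrite (sqr_hsnorm_sgrad smooth_ln_radial x0).
have -> : f x = U x ^+ 2 by rewrite -radialE// /radial/= normalize_id.
rewrite /gdot !mulr_sumr; apply: eq_bigr => i _; rewrite partial_ln_radial//.
by field.
Qed.

Lemma integrand_Gamma2 x : sphere x ->
  f x * Gamma2 (fun x => ln (f x)) x =
  4 * (hess2 U x - 2 * (hessdd U x * (U x)^-1) + gdot U U x ^+ 2 * ((U x)^-1 * (U x)^-1)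
    + (n%:R - 4) * gdot U U x).
Proof.
move=> Sx; have x0 := sphere_neq0 Sx; have Ux := lt0r_neq0 (sqrt_radial_gt0 x0).
have fx : f x = U x ^+ 2 by rewrite -radialE// /radial/= normalize_id.
have E := integrand_sgrad Sx.
rewrite (sqr_hsnorm_sgrad smooth_ln_radial x0) in E.
rewrite /Gamma2 (sqr_hsnorm_shess smooth_ln_radial Sx) (sqr_hsnorm_sgrad smooth_ln_radial x0).
have H : f x * hess2 G x = 4 * (hess2 U x - 2 * (hessdd U x * (U x)^-1) + gdot U U x ^+ 2 * ((U x)^-1 * (U x)^-1)).
  have -> : gdot U U x ^+ 2 = \sum_i \sum_j (partial i U x * partial j U x) ^+ 2.
    rewrite expr2 /gdot mulr_suml; apply: eq_bigr => i _; rewrite mulr_sumr.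
    have sqM (p q : R) : p * p * (q * q) = (p * q) ^+ 2 by ring.
    by apply: eq_bigr => j _; exact: sqM.
  rewrite fx /hess2 /hessdd mulr_suml (mulr_sumr _ _ _ 2) mulr_suml -sumrN -!big_split/= !mulr_sumr.
  apply: eq_bigr => i _; rewrite !mulr_suml mulr_sumr -sumrN -!big_split/= !mulr_sumr.
  apply: eq_bigr => j _; rewrite partial2_ln_radial//.
  by move: (partial i (partial j U) x) (partial i U x) (partial j U x) (U x) Ux => p q r u u0; field.
(* The coefficient n - 2 of [Gamma2] and the - 2 by which |shess|^2 differs from [hess2] combine to
   n - 4. *)
transitivity (f x * hess2 G x + (n%:R - 4) * (f x * gdot G G x)); first by ring.
by rewrite H E; ring.
Qed.

End log_substitution.

(** * Normalization of the surface measure *)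

Section normalization.
Context {R : realType}.

Definition box n (a b : R) : set 'rV[R]_n := [set x | forall i, a < x 0 i <= b].

Lemma measurable_box n (a b : R) : measurable (@box n a b).
Proof.
rewrite (_ : box a b = \bigcap_(i in [set: 'I_n])
   ((fun x : 'rV[R]_n => x 0 i) @^-1` `]a, b]%classic)); last first.
  apply/seteqP; split => x /= h i; first by move=> _; have := h i; rewrite /= ?in_itv.
  by have := h i Logic.I; rewrite /= ?in_itv.
apply: fin_bigcap_measurable; first exact: finite_finset.
move=> i _; rewrite -[X in measurable X]setTI.
by apply: (@measurable_rV_coord R n i) => //; exact: measurable_itv.
Qed.

Lemma consrV_0 n (t : R) (y : 'rV[R]_n) : consrV (t, y) 0 0 = t.
Proof. by rewrite -(consrV_upd0 0 t y) mxE eqxx. Qed.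

Lemma consrV_lift n (t : R) (y : 'rV[R]_n) j : consrV (t, y) 0 (lift ord0 j) = y 0 j.
Proof.
have := consrV_updS j t (y 0 j) y; rewrite (_ : upd j y (y 0 j) = y).
  by move=> <-; rewrite mxE eqxx.
by apply/rowP => k; rewrite mxE; case: eqP => [->|].
Qed.

Lemma lebesgue_box n (a b : R) : a < b -> lebesgue_rV n (box a b) = ((b - a) ^+ n)%:E.
Proof.
move=> ab; elim: n => [|n IH].
  rewrite /= expr0 diracE mem_set//.
  by move=> [].
rewrite /= /lebesgue_rVS /pushforward.
rewrite (_ : _ @^-1` _ = `]a, b]%classic `*` box a b); last first.
  apply/seteqP; split => [[t y] /= h|[t y] [/= h1 h2] i].
    split => /= [|j]; first by have := h 0; rewrite consrV_0 ?in_itv.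
    by have := h (lift ord0 j); rewrite consrV_lift.
  have [->|[j ->]] : i = 0 \/ exists j : 'I_n, i = lift ord0 j.
    by case: (unliftP ord0 i) => [j ->|->]; [right; exists j|left].
    by rewrite consrV_0; move: h1; rewrite ?in_itv.
  by rewrite consrV_lift; exact: h2.
rewrite product_measure1E; [|exact: measurable_itv|exact: measurable_box].
have L : lebesgue_measure (`]a, b]%classic : set R) = (b - a)%:E.
  by rewrite lebesgue_measure_itv/= lte_fin ab -EFinB.
transitivity ((b - a)%:E * ((b - a) ^+ n)%:E)%E; first by congr (_ * _)%E.
by rewrite -EFinM exprS.
Qed.

(** The ball lies between the cubes ]0, 1/n]^n and ]-2, 1]^n. The intervals are open on the left,
    which keeps the origin out of the small cube and asks for a left end below -1 in the large one.
    A finite positive volume ensures that the normalization of the surface measure does not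
    degenerate. *)
Lemma punctured_ball_volume n : (0 < n)%N ->
  exists2 v : R, 0 < v & lebesgue_rV n (@punctured_ball R n) = v%:E.
Proof.
move=> n0; have mB := @measurable_punctured_ball R n.
have n1 : 0 < n%:R^-1 :> R by rewrite invr_gt0 ltr0n.
have ub : (lebesgue_rV n (@punctured_ball R n) <= ((1 - (- 2)) ^+ n)%:E)%E.
  rewrite -lebesgue_box; last by lra.
  apply: le_measure; rewrite ?inE//; first exact: measurable_box.
  move=> x /andP[_ x1] i; have := le_trans (coord_le_hsnorm x i) x1.
  by rewrite ler_norml => /andP[h ->]; rewrite andbT; lra.
have lb : (((n%:R^-1 - 0) ^+ n)%:E <= lebesgue_rV n (@punctured_ball R n))%E.
  rewrite -lebesgue_box//.
  apply: le_measure; rewrite ?inE//; first exact: measurable_box.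
  move=> x hx; apply/andP; split.
    rewrite hsnorm_gt0; apply/eqP => x0; have := hx (Ordinal n0).
    by rewrite x0 mxE ltxx.
  rewrite hsnormE -[X in _ <= X]sqrtr1 ler_wsqrtr//.
  apply: (@le_trans _ _ (\sum_(i < n) n%:R^-1)).
    apply: ler_sum => i _; have /andP[a b] := hx i.
    have n2 : n%:R^-1 <= 1 :> R by rewrite invf_le1 ?ltr0n// ler1n.
    nra.
  have -> : \sum_(i < n) n%:R^-1 = n%:R * n%:R^-1 :> R by rewrite sumr_const card_ord mulr_natl.
  by rewrite mulfV// pnatr_eq0 -lt0n.
move: ub lb; case: (lebesgue_rV n _) => [v||] //= ub lb.
exists v => //; move: lb; rewrite lee_fin subr0; apply: lt_le_trans.
by rewrite exprn_gt0.
Qed.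

Lemma sphere_measure_sphere n : (0 < n)%N -> @sphere_measure R n (@sphere R n) = 1%E.
Proof.
move=> n0; have [v v0 vE] := punctured_ball_volume n0.
rewrite /sphere_measure (_ : _ `&` _ = @punctured_ball R n).
  by rewrite vE /= -EFinM mulVf// gt_eqF.
apply/setIidPr => x /andP[x0 _] /=; apply: normalize_sphere.
by rewrite -hsnorm_gt0.
Qed.

(** * Moments of the coordinates on the sphere *)

Section moments.
Context {n : nat}.
Notation rV := 'rV[R]_n.
Hypothesis n2 : (2 <= n)%N.

Let n0 : (0 < n)%N. Proof. exact: leq_trans n2. Qed.

Lemma sint_one : sint (fun _ : rV => 1) = 1.
Proof.
rewrite /sint Rintegral_cst; last exact: measurable_sphere.
by rewrite mul1r -[RHS]/(fine 1%E) -(sphere_measure_sphere n0).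
Qed.

(** L_ia (x_i x_a) = x_i^2 - x_a^2 integrates to 0, so all second moments coincide; they add up to
    the total mass 1. *)
Lemma second_moment (a : 'I_n) : sint (fun x : rV => x 0 a ^+ 2) = n%:R^-1.
Proof.
have cc (i : 'I_n) : cont0 (fun x : rV => x 0 i ^+ 2) by apply: smooth_cont0; smooth_auto.
have E i : sint (fun x : rV => x 0 i ^+ 2) = sint (fun x : rV => x 0 a ^+ 2).
  have [->//|ia] := eqVneq i a.
  apply/eqP; rewrite -subr_eq0 -sintB//; apply/eqP.
  have sxx : smooth (fun x : rV => x 0 i * x 0 a) by smooth_auto.
  rewrite -[RHS](sint_Lf ia sxx); apply: eq_sint => x Sx; have x0 := sphere_neq0 Sx.
  by rewrite LfM//; [rewrite Lf_coordl// Lf_coordr//; ring|smooth_auto|smooth_auto].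
have n00 : n%:R != 0 :> R by rewrite pnatr_eq0 -lt0n.
apply: (mulfI n00); rewrite mulfV//; apply: etrans sint_one.
transitivity (\sum_(i < n) sint (fun x : rV => x 0 i ^+ 2)).
  by rewrite (eq_bigr _ (fun i _ => E i)) sumr_const card_ord mulr_natl.
rewrite -sint_sum//; apply: eq_sint => x Sx; exact: ((hsnorm_eq1 x).1 Sx).
Qed.

(** L_ab (x_a^3 x_b) = x_a^4 - 3 x_a^2 x_b^2 makes the mixed moment a third of the fourth moment,
    which is at least m^2 > 0 because the variance of x_a^2 is nonnegative. *)
Lemma mixed_moment_gt0 (a b : 'I_n) : a != b -> 0 < sint (fun x : rV => (x 0 a * x 0 b) ^+ 2).
Proof.
move=> ab; pose m := sint (fun x : rV => x 0 a ^+ 2).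
have m0 : 0 < m by rewrite /m second_moment invr_gt0 ltr0n.
have c2 : cont0 (fun x : rV => x 0 a ^+ 2) by apply: smooth_cont0; smooth_auto.
have c4 : cont0 (fun x : rV => x 0 a ^+ 4) by apply: smooth_cont0; smooth_auto.
have cab : cont0 (fun x : rV => (x 0 a * x 0 b) ^+ 2) by apply: smooth_cont0; smooth_auto.
have sF : smooth (fun x : rV => x 0 a ^+ 3 * x 0 b) by smooth_auto.
have E : sint (fun x : rV => x 0 a ^+ 4) = 3 * sint (fun x : rV => (x 0 a * x 0 b) ^+ 2).
  rewrite -sintZ//; apply/eqP; rewrite -subr_eq0 -sintB//; last first.
    by apply: smooth_cont0; smooth_auto.
  apply/eqP; rewrite -[RHS](sint_Lf ab sF); apply: eq_sint => x Sx; have x0 := sphere_neq0 Sx.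
  have e3 : Lf a b (fun y : rV => y 0 a ^+ 3 * y 0 b) x = Lf a b (fun y : rV => y 0 a * (y 0 a * y 0 a) * y 0 b) x.
    by congr (Lf _ _ _ x); apply/funext => y; ring.
  rewrite e3 LfM//; [|by smooth_auto|by smooth_auto].
  rewrite LfM//; [|by smooth_auto|by smooth_auto].
  rewrite LfM//; [|by smooth_auto|by smooth_auto].
  by rewrite Lf_coordl// Lf_coordr//; ring.
have : 0 <= sint (fun x : rV => (x 0 a ^+ 4 - 2 * m * x 0 a ^+ 2) + m ^+ 2 * 1).
  apply: sint_ge0 => x _.
  by rewrite (_ : _ + _ = (x 0 a ^+ 2 - m) ^+ 2); [exact: sqr_ge0|ring].
have c2m : cont0 (fun x : rV => 2 * m * x 0 a ^+ 2) by apply: smooth_cont0; smooth_auto.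
have c1 : cont0 (fun x : rV => 1 : R) by exact: cont0_cst.
rewrite sintD; [|by apply: smooth_cont0; smooth_auto|by apply: smooth_cont0; smooth_auto].
rewrite sintB// sintZ// sintZ// sint_one E -/m.
have mm : 0 < m ^+ 2 by rewrite exprn_gt0.
by nra.
Qed.

End moments.

End normalization.

(** * The optimal constant *)

Section optimal_constant.
Context {R : realType} {n : nat}.
Notation rV := 'rV[R]_n.

(** A quarter of int f Gamma_2 (log f, log f) when U = sqrt f. *)
Definition Gamma2_energy (U : rV -> R) : R :=
  sint (fun x => hess2 U x - 2 * (hessdd U x * (U x)^-1) + gdot U U x ^+ 2 * ((U x)^-1 * (U x)^-1)
      + (n%:R - 4) * gdot U U x).

(** Both extended-real integrals are finite, the integrands being continuous on the sphere, and
    carry the same factor 4. *)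
Lemma Gamma2_ineqE (L : R) (f : rV -> R) : smooth_on_sphere f ->
  (forall x, sphere x -> 0 < f x) -> Gamma2_ineq L f <->
  L * sint (gdot (sqrt_radial f) (sqrt_radial f)) <= Gamma2_energy (sqrt_radial f).
Proof.
move=> /smoothP sf f0; set U := sqrt_radial f.
have sU : smooth U by exact: smooth_sqrt_radial.
have siU : smooth (fun x => (U x)^-1).
  by apply: smooth_invU => //; exact: sqrt_radial_gt0.
have sV := smooth_gdot sU sU; have sh := smooth_hess2 sU; have shd := smooth_hessdd sU.
pose H x := hess2 U x - 2 * (hessdd U x * (U x)^-1) + gdot U U x ^+ 2 * ((U x)^-1 * (U x)^-1)
      + (n%:R - 4) * gdot U U x.
have sH : smooth H by rewrite /H; smooth_auto.
have intE (h K : rV -> R) : smooth K -> (forall x, sphere x -> h x = 4 * K x) ->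
    (\int[@sphere_measure R n]_(x in @sphere R n) (h x)%:E = (4 * sint K)%:E)%E.
  move=> sK hK; rewrite -(sintZ 4 (smooth_cont0 sK)) /sint /Rintegral fineK.
    by apply: eq_integral => x /set_mem Sx; rewrite hK.
  apply: integrable_fin_num; first exact: measurable_sphere.
  by apply: cont0_integrable; apply: smooth_cont0; exact: smoothZ.
rewrite /Gamma2_ineq.
rewrite (intE _ H sH (fun x Sx => integrand_Gamma2 sf f0 Sx)).
rewrite (intE _ _ sV (fun x Sx => integrand_sgrad sf f0 Sx)).
by rewrite -EFinM lee_fin mulrCA ler_pM2l.
Qed.

Hypothesis n2 : (2 <= n)%N.

Lemma bound_admissible : (@admissible R n) (n%:R + 3 - 1 / (n%:R - 1)).
Proof.
move=> f sf f0 ef; apply/(Gamma2_ineqE _ sf f0).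
have sF : smooth (radial f) by exact/smoothP.
apply: main_inequality => //.
- exact: smooth_sqrt_radial.
- exact: hom0_sqrt_radial.
- by move=> x; exact: sqrt_radial_gt0.
- move=> x x0; rewrite /sqrt_radial /radial /= normalizeN ef//.
  exact: normalize_sphere.
Qed.

(** The 0-homogeneous extension of x_a x_b: for a != b an even function, odd in x_a and in x_b, so
    that [poincare_odd2] bounds its energy from below. *)
Definition xyratio (a b : 'I_n) (x : rV) : R := x 0 a * x 0 b * (sqnorm x)^-1.

Lemma smooth_xyratio a b : smooth (xyratio a b).
Proof.
have si : smooth (fun x : rV => (sqnorm x)^-1).
  by apply: smoothV; [exact: smooth_sqnorm|move=> x; rewrite sqnorm_eq0].
by rewrite /xyratio; smooth_auto.
Qed.

Lemma hom0_xyratio a b : hom0 (xyratio a b).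
Proof.
move=> c x c0; rewrite /xyratio -!sqr_hsnorm hsnormZ !mxE exprMn (gtr0_norm c0).
have [->|x0] := eqVneq x 0; first by rewrite !mxE; ring.
by field; rewrite !gt_eqF// hsnorm_gt0.
Qed.

Lemma xyratio_le1 a b x : - 1 <= xyratio a b x.
Proof.
have [x0|x0] := eqVneq (sqnorm x) 0; first by rewrite /xyratio x0 invr0; lra.
have s0 : 0 < sqnorm x by rewrite lt_def x0 sqnorm_ge0.
rewrite /xyratio ler_pdivlMr// mulN1r.
have := coord_le_hsnorm x a; have := coord_le_hsnorm x b.
rewrite -sqr_hsnorm !ler_norml => /andP[b1 b2] /andP[a1 a2].
have : 0 <= hsnorm x by rewrite hsnormE sqrtr_ge0.
by move: (hsnorm x) a1 a2 b1 b2 => r; nra.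
Qed.

Lemma exists_nonconstant : exists f : rV -> R, [/\ smooth_on_sphere f,
  (forall x, sphere x -> 0 < f x), (forall x, sphere x -> f (- x) = f x) &
  0 < sint (gdot (sqrt_radial f) (sqrt_radial f))].
Proof.
have n0 : (0 < n)%N by exact: leq_trans n2.
pose a : 'I_n := Ordinal n0; pose b : 'I_n := Ordinal n2.
have ab : a != b by [].
pose phi := xyratio a b.
have sphi : smooth phi by exact: smooth_xyratio.
have hphi : hom0 phi by exact: hom0_xyratio.
(* As phi >= -1, the shift by 2 makes psi positive; for f = psi^2 the square root is then psi
   itself, and its gradient is that of phi. *)
pose psi x := 2 + phi x.
have psi0 x : 0 < psi x by rewrite /psi; have := xyratio_le1 a b x; rewrite -/phi; lra.
have spsi : smooth psi by rewrite /psi; smooth_auto.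
pose f x := psi x ^+ 2.
have hf x : x != 0 -> radial f x = psi x ^+ 2.
  move=> x0; rewrite /radial /f /psi /= /normalize hphi// invr_gt0 hsnorm_gt0//.
have sf : smooth (radial f).
  by apply: (@smooth_eq0 _ _ (fun x => psi x ^+ 2)); [move=> x x0; rewrite hf|smooth_auto].
have UE : eq_off0 (sqrt_radial f) psi.
  by move=> x x0; rewrite /sqrt_radial hf// sqrtr_sqr gtr0_norm.
exists f; split.
- exact/smoothP.
- by move=> x _; rewrite /f exprn_gt0.
- move=> x _; rewrite /f /psi /phi /xyratio.
  have -> : sqnorm (- x) = sqnorm x by apply: eq_bigr => i _; rewrite mxE sqrrN.
  by rewrite !mxE mulrNN.
have -> : sint (gdot (sqrt_radial f) (sqrt_radial f)) = sint (gdot phi phi).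
  apply: eq_sint => x Sx; have x0 := sphere_neq0 Sx.
  apply: eq_bigr => i _; rewrite (eq_off0_partial i UE x0).
  have -> : partial i psi x = partial i phi x.
    rewrite /psi partialD; [by rewrite partial_cst add0r|exact: smooth_diff (smooth_cst 2) x0|].
    exact: smooth_diff.
  by [].
have oa : odd_in a phi.
  move=> x x0; rewrite /phi /xyratio sqnorm_flip !mxE eqxx eq_sym (negbTE ab).
  by rewrite !mulNr.
have ob : odd_in b phi.
  move=> x x0; rewrite /phi /xyratio sqnorm_flip !mxE eqxx (negbTE ab).
  by rewrite mulrN mulNr.
apply: lt_le_trans (poincare_odd2 ab sphi hphi oa ob).
apply: mulr_gt0; first by rewrite mulr_gt0// ltr0n.
rewrite (_ : sint _ = sint (fun x : rV => (x 0 a * x 0 b) ^+ 2)).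
  exact: mixed_moment_gt0.
apply: eq_sint => x Sx.
by rewrite /phi /xyratio (hsnorm_eq1 x).1// invr1 mulr1.
Qed.

(** [xget] leaves its default only if a largest element exists; the supremum, being attained, is
    that witness. *)
Lemma sup_max (A : set R) : A !=set0 -> has_ubound A -> A (sup A) ->
  forall a, A a -> a <= xget 0 (A `&` ubound A).
Proof.
move=> A0 ubA AsupA a Aa.
have h : (A `&` ubound A) (sup A) by split => // y Ay; exact: ub_le_sup.
by have [_] := xgetPex 0 (ex_intro _ _ h); exact.
Qed.

Lemma Lambda_ge : n%:R + 3 - 1 / (n%:R - 1) <= Lambda R n.
Proof.
have hL := bound_admissible.
have ne : (@admissible R n) !=set0 by exists (n%:R + 3 - 1 / (n%:R - 1)).
have [f [sf f0 ef A0]] := exists_nonconstant.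
have ub : has_ubound (@admissible R n).
  (* Testing an admissible constant on a function of positive energy bounds it by a finite
     quotient. *)
  exists (Gamma2_energy (sqrt_radial f) / sint (gdot (sqrt_radial f) (sqrt_radial f))).
  by move=> L /(_ f sf f0 ef)/(Gamma2_ineqE _ sf f0); rewrite ler_pdivlMr.
apply: (sup_max ne ub) => // g sg g0 eg; apply/(Gamma2_ineqE _ sg g0).
have V0 : 0 <= sint (gdot (sqrt_radial g) (sqrt_radial g)).
  by apply: sint_ge0 => x _; apply: sumr_ge0 => i _; rewrite -expr2 sqr_ge0.
(* If the energy of g is 0, the inequality for g does not involve the constant and is inherited from
   [bound_admissible]. Otherwise it bounds the constant by a quotient, and such a bound passes to
   the supremum. *)
move: V0; rewrite le_eqVlt => /predU1P[V0|V0].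
  by have := (Gamma2_ineqE _ sg g0).1 (hL _ sg g0 eg); rewrite -V0 !mulr0.
rewrite -ler_pdivlMr//; apply: ge_sup => // L /(_ g sg g0 eg)/(Gamma2_ineqE _ sg g0).
by rewrite ler_pdivlMr.
Qed.

End optimal_constant.

Theorem theorem1p1 (R : realType) :
  (forall d : nat, (2 <= d)%N ->
     Lambda R d >= d%:R + 3 - 1 / (d%:R - 1))
  /\ Lambda R 2 >= 4
  /\ Lambda R 3 >= 11 / 2.
Proof.
split; first by move=> d; exact: Lambda_ge.
split.
  apply: le_trans (Lambda_ge (isT : (2 <= 2)%N)).
  by rewrite (_ : 2%:R - 1 = 1 :> R); lra.
apply: le_trans (Lambda_ge (isT : (2 <= 3)%N)).
by rewrite (_ : 3%:R - 1 = 2 :> R); lra.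
Qed.
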